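(* For every fixed integer $k\ge 2$, $$\inf_{\substack{e(G)=m\\ \rho(G)>g_k(m)}}\frac{N(C_{2k+1},G)}{m^k}=\frac{\lceil k^2/2\rceil\,(k-1)!}{(k+1)^k}+o(1)\qquad\text{as } m\to\infty,$$ where the infimum is over all graphs $G$ with exactly $m$ edges and $\rho(G)>g_k(m)$. Equivalently, for every $\varepsilon>0$ there exists $m_0=m_0(k,\varepsilon)$ such that every graph $G$ with $e(G)=m\ge m_0$ and $\rho(G)>g_k(m)$ satisfies $$N(C_{2k+1},G)\ge\left(\frac{\lceil k^2/2\rceil\,(k-1)!}{(k+1)^k}-\varepsilon\right)m^k,$$ and moreover the constant $\frac{\lceil k^2/2\rceil (k-1)!}{(k+1)^k}$ is asymptotically best possible.
   Context: All graphs are finite and simple (isolated vertices are allowed). $e(G)$ is the number of edges of $G$, $\rho(G)$ is the spectral radius of its adjacency matrix, and $N(F,G)$ is the number of unoriented copies of $F$ in $G$ (i.e. subgraphs of $G$ isomorphic to $F$). $C_{2k+1}$ is the cycle on $2k+1$ vertices. For an integer $k\ge2$, $$g_k(m):=\frac{k-1+\sqrt{4m-k^2+1}}{2}.$$ ''Asymptotically best possible'' means the constant cannot be replaced by any larger constant in the lower bound for all sufficiently large $m$. *)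

(* Defs.v *)
From HB Require Import structures.
From mathcomp Require Import all_boot all_order all_algebra.
From mathcomp Require Import complex.
From mathcomp Require Import all_classical all_reals all_analysis.

Set Implicit Arguments.
Unset Strict Implicit.
Unset Printing Implicit Defensive.

Import Order.TTheory GRing.Theory Num.Theory.
Import numFieldNormedType.Exports.

Local Open Scope ring_scope.

Record sgraph := SGraph {
  vertex :> finType;
  adj : rel vertex;
  adj_sym : symmetric adj;
  adj_irrefl : irreflexive adj }.

Definition edges (G : sgraph) : {set {set G}} :=
  [set [set p.1; p.2] | p : G * G & adj p.1 p.2]%SET.

Definition nb_edges (G : sgraph) : nat := #|edges G|.

Definition cycle_adj (n : nat) : rel 'I_n :=
  fun i j => (i != j) && ((j == ordS i) || (i == ordS j)).

Lemma cycle_adj_sym n : symmetric (@cycle_adj n).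
Proof. by move=> i j; rewrite /cycle_adj eq_sym orbC. Qed.

Lemma cycle_adj_irrefl n : irreflexive (@cycle_adj n).
Proof. by move=> i; rewrite /cycle_adj eqxx. Qed.

(* This is the cycle on n vertices only for n >= 3. *)
Definition cycle_graph (n : nat) : sgraph :=
  SGraph (@cycle_adj_sym n) (@cycle_adj_irrefl n).

(* A subgraph is given by its vertex set and its edge set; it need not be
   induced. *)
Definition is_subgraph (G : sgraph) (H : {set G} * {set {set G}}) : bool :=
  (H.2 \subset edges G) && [forall A in H.2, A \subset H.1].

Definition subgraph_iso (F G : sgraph) (H : {set G} * {set {set G}}) : bool :=
  [exists f : {ffun F -> G},
    [&& injectiveb f, f @: [set: F]%SET == H.1
      & [forall x, forall y, adj x y == ([set f x; f y]%SET \in H.2)]]].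

Definition nb_copies (F G : sgraph) : nat :=
  #|[set H : {set G} * {set {set G}} |
      is_subgraph H && subgraph_iso F H]%SET|.

Definition adjacency_matrix (R : realType) (G : sgraph) : 'M[R]_#|G| :=
  \matrix_(i, j) (adj (enum_val i) (enum_val j))%:R.

Definition spectral_radius (R : realType) (n : nat) (A : 'M[R]_n) : R :=
  sup [set ComplexField.Normc.normc z | z in
        [set z : R[i] | eigenvalue (map_mx (real_complex R) A) z]]%classic.

Definition rho (R : realType) (G : sgraph) : R :=
  spectral_radius (adjacency_matrix R G).

Definition g_bound (R : realType) (k m : nat) : R :=
  (k%:R - 1 + Num.sqrt (4 * m%:R - k%:R ^+ 2 + 1)) / 2.

(* The infimum is taken in the extended reals, so that it is +oo (and not a
   default real value) for the m for which no graph is admissible. *)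
Definition inf_density (R : realType) (k m : nat) : \bar R :=
  ereal_inf [set x : \bar R | exists G : sgraph,
    [/\ nb_edges G = m, g_bound R k m < rho R G
      & x = ((nb_copies (cycle_graph k.*2.+1) G)%:R / m%:R ^+ k)%:E]]%classic.

Definition asymptotic_lower_bound (R : realType) (k : nat) (c : R) : Prop :=
  forall eps : R, 0 < eps -> exists m0 : nat, forall (m : nat) (G : sgraph),
    (m0 <= m)%N -> nb_edges G = m -> g_bound R k m < rho R G ->
    (c - eps) * m%:R ^+ k <= (nb_copies (cycle_graph k.*2.+1) G)%:R.

Definition cycle_constant (R : realType) (k : nat) : R :=
  (uphalf (k ^ 2))%:R * (k.-1)`!%:R / k.+1%:R ^+ k.

(* Main.v *)
(** Lower bound.  The trace of A^(2k+1) counts closed walks, and all but O(m^k) of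
    them are traversals of (2k+1)-cycles, each cycle being counted 2(2k+1) times;
    so we may assume that the trace is O(m^k).  Then the spectrum is nearly that
    of a complete bipartite graph: besides rho and one eigenvalue close to
    - sqrt m, the squares of the eigenvalues add up to O(sqrt m).

    If all degrees are o(m), only o(m^k) closed walks are degenerate, while the
    trace is at least (k^2 - 1) m^k - o(m^k), which gives more cycles than needed.

    Otherwise, approximating A^2 by its two dominant eigenvectors shows that the
    vertices of large Perron weight form a set S of bounded size s, whose set T of
    common neighbours satisfies s |T| ~ m.  The eigenvalue equation on S together
    with rho > g_k(m) forces 2 e(S) >= s (k - 1) and s > k, as well as
    e(S) >= k^2 / 2 when s = k + 1.  Every edge inside S closes up about
    (s-2)!/(s-k-1)! |T|^k paths that alternate between S and T, and the resulting
    number of cycles is smallest for s = k + 1.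

    Upper bound.  Join k + 1 vertices spanning ceil(k^2/2) edges to an independent
    set.  An odd cycle in such a graph must use an edge inside the k + 1
    vertices, and for a cycle of length 2k + 1 exactly one. *)
Require Import Defs.
From mathcomp Require Import all_boot all_order all_algebra.
From mathcomp Require Import complex.
From mathcomp Require Import all_classical all_reals all_analysis.
From mathcomp Require Import zify ring lra.

Set Implicit Arguments.
Unset Strict Implicit.
Unset Printing Implicit Defensive.

Import Order.TTheory GRing.Theory Num.Theory.
Import numFieldNormedType.Exports.

Local Open Scope ring_scope.

(** * Spectral decomposition of the adjacency matrix *)

(** The threshold for e(S) is decided at second order. If S has k + 1 vertices, rho is about sqrt m
    + e(S) / (k + 1), while g_k(m) is about sqrt m + (k - 1) / 2, that is sqrt m + (k^2 - 1) / (2 (k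
    + 1)). For odd k the value e(S) = (k^2 - 1) / 2 is therefore a tie, and any error term would
    lose the rounding in ceil(k^2/2). For this reason the inequality on the core carries no error
    term, it keeps track of the spread of the degrees inside S, and the tie is excluded by the
    strictness of rho > g_k(m) alone. The steps that locate the core may be rough: with q = m^(1/4),
    codegrees are known up to O(q^3), against main terms of order q^4.

    The constant is read off the case s = k + 1: ceil(k^2/2) choices of the edge inside S, (k - 1)!
    orders of the other vertices of S, and |T|^k with |T| about m / (k + 1).

    Eigenvectors come from a complex diagonalisation and only the moduli of their entries are kept,
    so every spectral estimate is phrased with absolute values. *)

Fixpoint nwalk (G : sgraph) (j : nat) (u v : G) : nat :=
  if j is j'.+1 then (\sum_(w | adj u w) nwalk j' w v)%N else (u == v).

Section Unitary.
Variables (C : numClosedFieldType) (n : nat) (A : 'M[C]_n).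
Hypothesis hA : A \is hermsymmx.
Let P := spectralmx A.
Let d := spectral_diag A.

Lemma spectral_row i j : \sum_u P i u * (P j u)^* = (i == j)%:R.
Proof.
have /unitarymxP/matrixP/(_ i j) := spectral_unitarymx A.
by rewrite !mxE => <-; apply: eq_bigr => u _; rewrite !mxE.
Qed.

Lemma spectral_col u v : \sum_i (P i u)^* * P i v = (u == v)%:R.
Proof.
have /unitarymxP/mulmx1C/matrixP/(_ u v) := spectral_unitarymx A.
by rewrite !mxE => <-; apply: eq_bigr => i _; rewrite !mxE.
Qed.

Lemma spectral_entry u v : A u v = \sum_i d 0 i * ((P i u)^* * P i v).
Proof.
have /hermitian_normalmx/orthomx_spectralP e := hA.
rewrite {1}e -mulmxA invmx_unitary ?spectral_unitarymx //.
rewrite mxE; apply: eq_bigr => i _; rewrite mul_diag_mx !mxE.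
by rewrite mulrCA.
Qed.

Lemma spectral_eigenvalue i : eigenvalue A (d 0 i).
Proof.
apply/eigenvalueP; exists (row i P).
  apply/rowP => v; rewrite !mxE.
  under eq_bigr => u _ do rewrite spectral_entry mxE mulr_sumr.
  rewrite exchange_big /= (bigD1 i) //= [X in _ + X]big1 ?addr0 => [|j ji].
    transitivity (d 0 i * P i v * \sum_u P i u * (P i u)^*).
      by rewrite mulr_sumr; apply: eq_bigr => u _; rewrite /P; ring.
    by rewrite spectral_row eqxx mulr1.
  transitivity (d 0 j * P j v * \sum_u P i u * (P j u)^*).
    by rewrite mulr_sumr; apply: eq_bigr => u _; rewrite /P; ring.
  by rewrite spectral_row eq_sym (negbTE ji) mulr0.
apply/negP => /eqP/rowP h; have := spectral_row i i.
rewrite eqxx big1 => [|u _]; first by move/esym/eqP; rewrite oner_eq0.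
by have := h u; rewrite !mxE /P => ->; rewrite mul0r.
Qed.

(** An eigenvector has a nonzero coordinate along some row of [P], and along that row the matrix
    acts as multiplication by [d 0 i]. *)
Lemma eigenvalue_spectral z : eigenvalue A z -> exists i, z = d 0 i.
Proof.
move=> /eigenvalueP [v ve v0].
have key i : (d 0 i - z) * (\sum_u v 0 u * (P i u)^*) = 0.
  apply/eqP; rewrite mulrBl subr_eq0; apply/eqP.
  transitivity (\sum_w (v *m A) 0 w * (P i w)^*); last first.
    by rewrite ve mulr_sumr; apply: eq_bigr => w _; rewrite mxE mulrA.
  rewrite mulr_sumr; under [RHS]eq_bigr => w _ do rewrite mxE mulr_suml.
  rewrite [RHS]exchange_big /=; apply: eq_bigr => u _.
  under [RHS]eq_bigr => w _.
    rewrite (spectral_entry u w) mulr_sumr mulr_suml; over.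
  rewrite exchange_big /= (bigD1 i) //= [X in _ + X]big1 ?addr0 => [|j ji].
    transitivity (v 0 u * d 0 i * (P i u)^* * \sum_w P i w * (P i w)^*).
      by rewrite spectral_row eqxx mulr1 /P; ring.
    by rewrite mulr_sumr; apply: eq_bigr => w _; rewrite /P; ring.
  transitivity (v 0 u * d 0 j * (P j u)^* * \sum_w P j w * (P i w)^*).
    by rewrite mulr_sumr; apply: eq_bigr => w _; rewrite /P; ring.
  by rewrite spectral_row (negbTE ji) mulr0.
have [/forallP h|] := boolP [forall i, \sum_u v 0 u * (P i u)^* == 0].
  case/eqP: v0; apply/rowP => w; rewrite mxE.
  transitivity (\sum_u v 0 u * (u == w)%:R).
    rewrite (bigD1 w) //= eqxx mulr1 big1 ?addr0 // => u uw.
    by rewrite (negbTE uw) mulr0.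
  under eq_bigr => u _ do rewrite -spectral_col mulr_sumr.
  rewrite exchange_big /= big1 // => i _.
  under eq_bigr => u _ do rewrite mulrA.
  by rewrite -mulr_suml (eqP (h i)) mul0r.
rewrite negb_forall => /existsP [i hi]; exists i.
have /eqP := key i; rewrite mulf_eq0 (negbTE hi) orbF subr_eq0 => /eqP.
by move=> ->.
Qed.
End Unitary.

Lemma nwalkS (G : sgraph) j (u v : G) :
  nwalk j.+1 u v = (\sum_w adj u w * nwalk j w v)%N.
Proof.
rewrite /= big_mkcond /=; apply: eq_bigr => w _.
by case: (adj u w); rewrite ?mul1n ?mul0n.
Qed.

Lemma nwalk0 (G : sgraph) (u v : G) : nwalk 0 u v = (u == v).
Proof. by []. Qed.

Arguments nwalk : simpl never.

Lemma nwalk1 (G : sgraph) (u v : G) : nwalk 1 u v = adj u v.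
Proof.
rewrite nwalkS (bigD1 v) //= nwalk0 eqxx muln1 big1 ?addn0 // => w wv.
by rewrite nwalk0 (negbTE wv) muln0.
Qed.

Lemma nwalk2 (G : sgraph) (u v : G) :
  nwalk 2 u v = (\sum_w adj u w * adj w v)%N.
Proof. by rewrite nwalkS; apply: eq_bigr => w _; rewrite nwalk1. Qed.

(* [wt i u] is the modulus of the entry at [u] of a unit eigenvector for
   [lam i].  [walk_err] isolates the contribution of the eigenvalue [lam i0] to
   the matrix A^2 + b A, and [mu] is the spectral measure of [f]. *)
Record spectrum (R : realType) (G : sgraph) := Spectrum {
  lam : 'I_#|G| -> R;
  wt : 'I_#|G| -> G -> R;
  wt_ge0 : forall i u, 0 <= wt i u;
  wt_row : forall i, \sum_u wt i u ^+ 2 = 1;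
  wt_col : forall u, \sum_i wt i u ^+ 2 = 1;
  walk_spec : forall j u, (nwalk j u u)%:R = \sum_i lam i ^+ j * wt i u ^+ 2;
  walk_err : forall i0 b u v,
    `| `|(nwalk 2 u v)%:R + b * (adj u v)%:R|
       - `|lam i0 ^+ 2 + b * lam i0| * (wt i0 u * wt i0 v) |
    <= \sum_(i | i != i0) `|lam i ^+ 2 + b * lam i| * (wt i u * wt i v);
  eig_sub : forall i u, `|lam i| * wt i u <= \sum_v (adj u v)%:R * wt i v;
  rayleigh : forall f : G -> R, exists mu : 'I_#|G| -> R,
    [/\ forall i, 0 <= mu i, \sum_i mu i = \sum_u f u ^+ 2,
        \sum_u \sum_v (adj u v)%:R * (f u * f v) = \sum_i lam i * mu i
      & \sum_u (\sum_v (adj u v)%:R * f v) ^+ 2 = \sum_i lam i ^+ 2 * mu i];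
  lam_le : forall i, `|lam i| <= rho R G;
  lam_max : (0 < #|G|)%N -> exists i, `|lam i| = rho R G }.

Section Spectrum.
Variables (R : realType) (G : sgraph).
Local Notation toC := (real_complex R).
Local Notation nc := ComplexField.Normc.normc.
Let M := map_mx toC (adjacency_matrix R G).

Lemma toC_normc (z : R[i]) : toC (nc z) = `|z|.
Proof. by case: z => a b; rewrite normc_def. Qed.

Lemma normc_toC (x : R) : nc (toC x) = `|x|.
Proof. by rewrite /= expr0n /= addr0 sqrtr_sqr. Qed.

Lemma adjacency_hermsym : M \is hermsymmx.
Proof.
apply: realsym_hermsym.
  apply/is_hermitianmxP; rewrite expr0 scale1r map_mx_id //.
  by apply/matrixP => i j; rewrite !mxE adj_sym.
apply/mxOverP => i j; rewrite !mxE; apply/complex_realP.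
by eexists.
Qed.

Let l (i : 'I_#|G|) : R := complex.Re (spectral_diag M 0 i).
Let U (i : 'I_#|G|) (u : G) : R[i] := spectralmx M i (enum_rank u).
Let w (i : 'I_#|G|) (u : G) : R := nc (U i u).

Lemma toC_lam i : toC (l i) = spectral_diag M 0 i.
Proof.
apply: RRe_real; have := hermitian_spectral_diag_real adjacency_hermsym.
by move=> /mxOverP; apply.
Qed.

Lemma U_row i j : \sum_u U i u * (U j u)^* = (i == j)%:R.
Proof.
rewrite -(spectral_row M i j) (reindex enum_rank) //.
exact/onW_bij/enum_rank_bij.
Qed.

Lemma U_col u v : \sum_i (U i u)^* * U i v = (u == v)%:R.
Proof. by rewrite spectral_col (inj_eq enum_rank_inj). Qed.

Lemma U_adj u v : (adj u v)%:R = \sum_i toC (l i) * ((U i u)^* * U i v).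
Proof.
under eq_bigr => i _ do rewrite toC_lam.
rewrite -(spectral_entry adjacency_hermsym) !mxE !enum_rankK.
by rewrite rmorph_nat.
Qed.

Lemma U_walk j u v :
  (nwalk j u v)%:R = \sum_i toC (l i) ^+ j * ((U i u)^* * U i v).
Proof.
elim: j u => [|j IH] u.
  by rewrite nwalk0 -U_col; apply: eq_bigr => i _; rewrite expr0 mul1r.
rewrite nwalkS natr_sum.
transitivity (\sum_x \sum_i \sum_k toC (l i) * toC (l k) ^+ j * (U i u)^*
    * U k v * (U i x * (U k x)^*)).
  apply: eq_bigr => x _.
  rewrite natrM U_adj IH mulr_suml; apply: eq_bigr => i _; rewrite mulr_sumr.
  by apply: eq_bigr => k _; ring.
rewrite exchange_big /=; apply: eq_bigr => i _; rewrite exchange_big /=.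
rewrite (bigD1 i) //= [X in _ + X]big1 ?addr0 => [|k ki].
  by rewrite -mulr_sumr U_row eqxx mulr1 exprS; ring.
by rewrite -mulr_sumr U_row eq_sym (negbTE ki) mulr0.
Qed.

Lemma w_sqr i u : toC (w i u ^+ 2) = (U i u)^* * U i u.
Proof. by rewrite rmorphXn /= toC_normc normCK mulrC. Qed.

Lemma normc_ge0 (z : R[i]) : 0 <= nc z.
Proof. by case: z => a b; exact: sqrtr_ge0. Qed.

(** The entry of A^2 + b A at [u], [v] is a sum over the eigenvalues; the reverse triangle
    inequality splits off one term. The phases of the eigenvectors are lost, hence the absolute
    value around the entry itself. *)
Lemma spectrum_walk_err i0 b u v :
    `| `|(nwalk 2 u v)%:R + b * (adj u v)%:R|
       - `|l i0 ^+ 2 + b * l i0| * (w i0 u * w i0 v) |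
    <= \sum_(i | i != i0) `|l i ^+ 2 + b * l i| * (w i u * w i v).
Proof.
set p : 'I_#|G| -> R := fun i => l i ^+ 2 + b * l i.
have key : toC ((nwalk 2 u v)%:R + b * (adj u v)%:R) =
    \sum_i toC (p i) * ((U i u)^* * U i v).
  rewrite rmorphD rmorphM !rmorph_nat U_walk U_adj mulr_sumr -big_split /=.
  by apply: eq_bigr => i _; rewrite /p rmorphD rmorphXn rmorphM /=; ring.
have nE (x : R) : toC `|x| = `|toC x| by rewrite -toC_normc normc_toC.
have tE i : toC (`|p i| * (w i u * w i v)) = `|toC (p i) * ((U i u)^* * U i v)|.
  by rewrite !normrM norm_conjC -!toC_normc normc_toC !rmorphM.
move: key; set x : R := (nwalk 2 u v)%:R + _ => key.
rewrite -/(p i0); suff: `|toC (`|x| - `|p i0| * (w i0 u * w i0 v))| <=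
    toC (\sum_(i | i != i0) `|p i| * (w i u * w i v)).
  by rewrite -nE lecR.
have -> : toC (`|x| - `|p i0| * (w i0 u * w i0 v)) =
    `|toC x| - `|toC (p i0) * ((U i0 u)^* * U i0 v)|.
  by rewrite rmorphB; congr (_ - _); [exact: nE | exact: tE].
have -> : toC (\sum_(i | i != i0) `|p i| * (w i u * w i v)) =
    \sum_(i | i != i0) `|toC (p i) * ((U i u)^* * U i v)|.
  by rewrite rmorph_sum; apply: eq_bigr => i _; exact: tE.
rewrite key.
apply: le_trans (ler_norm_sum _ _ _).
rewrite (bigD1 i0) //=.
set a := _ * _; set c := \sum_(_ | _) _.
apply: le_trans (ler_dist_dist _ _) _.
by rewrite addrC addrK.
Qed.

Lemma spectrum_eig_sub i u : `|l i| * w i u <= \sum_v (adj u v)%:R * w i v.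
Proof.
suff: `|toC (l i) * (U i u)^*| <= \sum_v `|(adj u v)%:R * (U i v)^*|.
  rewrite normrM norm_conjC -!toC_normc normc_toC -rmorphM.
  under eq_bigr => v _ do rewrite normrM norm_conjC normr_nat -toC_normc
    -(rmorph_nat toC) -rmorphM.
  by rewrite -rmorph_sum /= lecR.
have -> : toC (l i) * (U i u)^* = \sum_v (adj u v)%:R * (U i v)^*.
  under eq_bigr => v _ do rewrite U_adj mulr_suml.
  rewrite exchange_big /= (bigD1 i) //= [X in _ + X]big1 ?addr0 => [|k ki].
    transitivity (toC (l i) * (U i u)^* * \sum_v U i v * (U i v)^*).
      by rewrite U_row eqxx mulr1.
    by rewrite mulr_sumr; apply: eq_bigr => v _; ring.
  transitivity (toC (l k) * (U k u)^* * \sum_v U k v * (U i v)^*).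
    by rewrite mulr_sumr; apply: eq_bigr => v _; ring.
  by rewrite U_row (negbTE ki) mulr0.
exact: ler_norm_sum.
Qed.

Lemma spectrum_rayleigh (f : G -> R) : exists mu : 'I_#|G| -> R,
  [/\ forall i, 0 <= mu i, \sum_i mu i = \sum_u f u ^+ 2,
      \sum_u \sum_v (adj u v)%:R * (f u * f v) = \sum_i l i * mu i
    & \sum_u (\sum_v (adj u v)%:R * f v) ^+ 2 = \sum_i l i ^+ 2 * mu i].
Proof.
pose z i := \sum_v U i v * toC (f v).
pose mu i := nc (z i) ^+ 2.
have muE i : toC (mu i) =
    \sum_u \sum_v toC (f u * f v) * ((U i u)^* * U i v).
  rewrite rmorphXn /= toC_normc normCK mulrC rmorph_sum mulr_suml.
  apply: eq_bigr => u _; rewrite mulr_sumr; apply: eq_bigr => v _.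
  have cr x : (toC x)^* = toC x by apply/CrealP/complex_realP; exists x.
  by rewrite [X in X * _]rmorphM /= cr rmorphM /=; ring.
(* As [nwalk j] gives the entries of A^j, the three identities of the statement are the cases j = 0,
   1, 2. *)
have gen j : \sum_u \sum_v (nwalk j u v)%:R * (f u * f v) = \sum_i l i ^+ j * mu i.
  apply: (@complexI R); rewrite !rmorph_sum /=.
  transitivity (\sum_u \sum_v \sum_i
      toC (l i) ^+ j * (toC (f u * f v) * ((U i u)^* * U i v))).
    apply: eq_bigr => u _; rewrite rmorph_sum; apply: eq_bigr => v _.
    rewrite rmorphM /= rmorph_nat U_walk mulr_suml.
    by apply: eq_bigr => i _; ring.
  under [LHS]eq_bigr => u _ do rewrite exchange_big /=.
  rewrite exchange_big /=; apply: eq_bigr => i _.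
  rewrite rmorphM rmorphXn /= muE mulr_sumr; apply: eq_bigr => u _.
  by rewrite mulr_sumr.
exists mu; split=> [i||| ].
- by rewrite exprn_ge0 // normc_ge0.
- transitivity (\sum_i l i ^+ 0 * mu i).
    by apply: eq_bigr => i _; rewrite mul1r.
  rewrite -gen; apply: eq_bigr => u _.
  rewrite (bigD1 u) //= nwalk0 eqxx mul1r big1 ?addr0 // => v vu.
  by rewrite nwalk0 eq_sym (negbTE vu) mul0r.
- transitivity (\sum_i l i ^+ 1 * mu i); last first.
    by apply: eq_bigr => i _; rewrite expr1.
  rewrite -gen; apply: eq_bigr => u _; apply: eq_bigr => v _.
  by rewrite nwalk1.
- rewrite -gen.
  transitivity (\sum_x \sum_u \sum_v (adj x u)%:R * f u * ((adj x v)%:R * f v)).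
    apply: eq_bigr => x _; rewrite expr2 mulr_suml; apply: eq_bigr => u _.
    by rewrite mulr_sumr.
  rewrite exchange_big /=; apply: eq_bigr => u _; rewrite exchange_big /=.
  apply: eq_bigr => v _; rewrite nwalk2 natr_sum mulr_suml.
  by apply: eq_bigr => x _; rewrite natrM adj_sym; ring.
Qed.

Lemma spectrum_lam i : eigenvalue M (toC (l i)).
Proof. by rewrite toC_lam; apply: (spectral_eigenvalue adjacency_hermsym). Qed.

Lemma rho_set_ub (x : R) :
  [set nc z | z in [set z : R[i] | eigenvalue M z]]%classic x ->
  exists i, x = `|l i|.
Proof.
move=> [z /= /(eigenvalue_spectral adjacency_hermsym)[i ->] <-]; exists i.
by rewrite -toC_lam normc_toC.
Qed.

Lemma spectrum_lam_ub : has_ubound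
  [set nc z | z in [set z : R[i] | eigenvalue M z]]%classic.
Proof.
exists (\sum_i `|l i|) => x /rho_set_ub[i ->].
by rewrite (bigD1 i) //= lerDl sumr_ge0.
Qed.

Lemma spectrum_lam_in i :
  [set nc z | z in [set z : R[i] | eigenvalue M z]]%classic `|l i|.
Proof. by exists (toC (l i)); [exact: spectrum_lam|rewrite normc_toC]. Qed.

Lemma spectrum_lam_le i : `|l i| <= rho R G.
Proof. exact: ub_le_sup spectrum_lam_ub _ (spectrum_lam_in i). Qed.

Lemma spectrum_lam_max : (0 < #|G|)%N -> exists i, `|l i| = rho R G.
Proof.
move=> G0; pose i0 := Ordinal G0.
have [i _ hi] := @arg_maxP _ R _ i0 predT (fun i => `|l i|) isT.
exists i; apply/eqP; rewrite eq_le spectrum_lam_le /=.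
apply: ge_sup; first by exists `|l i|; exact: spectrum_lam_in.
by move=> x /rho_set_ub[j ->]; exact: hi.
Qed.

Definition graph_spectrum : spectrum R G.
Proof.
refine (@Spectrum R G l w _ _ _ _ spectrum_walk_err spectrum_eig_sub
  spectrum_rayleigh spectrum_lam_le spectrum_lam_max).
- by move=> i u; exact: normc_ge0.
- move=> i; apply: (@complexI R); rewrite rmorph_sum rmorph1 /=.
  under eq_bigr => u _ do rewrite w_sqr mulrC.
  by rewrite U_row eqxx.
- move=> u; apply: (@complexI R); rewrite rmorph_sum rmorph1 /=.
  under eq_bigr => i _ do rewrite w_sqr.
  by rewrite U_col eqxx.
- move=> j u; apply: (@complexI R); rewrite rmorph_nat rmorph_sum /= U_walk.
  by apply: eq_bigr => i _; rewrite rmorphM /= w_sqr rmorphXn.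
Qed.
End Spectrum.

Definition deg (G : sgraph) (u : G) : nat := (\sum_v adj u v)%N.

Lemma nwalk2_diag (G : sgraph) (u : G) : nwalk 2 u u = deg u.
Proof.
rewrite nwalk2; apply: eq_bigr => w _.
by rewrite [adj w u]adj_sym; case: (adj u w).
Qed.

Lemma nwalk2_sym (G : sgraph) (u v : G) : nwalk 2 u v = nwalk 2 v u.
Proof.
rewrite !nwalk2; apply: eq_bigr => w _.
by rewrite [adj w v]adj_sym [adj u w]adj_sym mulnC.
Qed.

Lemma nwalk2_le_deg (G : sgraph) (u v : G) : (nwalk 2 u v <= deg u)%N.
Proof.
by rewrite nwalk2; apply: leq_sum => w _; case: (adj u w); case: (adj w v).
Qed.

Lemma deg_sum (G : sgraph) : (\sum_(u : G) deg u = (nb_edges G).*2)%N.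
Proof.
rewrite /deg pair_big /=.
pose D := [set p : G * G | adj p.1 p.2]%SET.
pose h (p : G * G) := [set p.1; p.2]%SET.
transitivity (\sum_(p in D) 1)%N.
  by rewrite [RHS]big_mkcond; apply: eq_bigr => p _; rewrite inE; case: (adj _ _).
have eE : edges G = (h @: D)%SET.
  by apply/setP => e; apply/imsetP/imsetP => -[p hp ->]; exists p;
     rewrite ?inE in hp *.
rewrite (partition_big_imset h) /= -eE /nb_edges -sum1_card -muln2 big_distrl /=.
apply: eq_bigr => e; rewrite eE => /imsetP[[a b]]; rewrite inE /= => ab ->.
have nab : a != b by apply: contraTneq ab => ->; rewrite adj_irrefl.
rewrite (bigD1 (a, b)) /=; last by rewrite inE /= ab eqxx.
rewrite (bigD1 (b, a)) /=; last first.
  rewrite inE /= adj_sym ab /h /= finset.setUC eqxx /=.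
  by apply: contra nab => /eqP[->].
rewrite big1 // => -[c d]; rewrite inE /= => /andP[/andP[/andP[cd /eqP hcd] n1] n2].
have hs x : (x \in h (c, d)) = (x \in h (a, b)) by rewrite hcd.
rewrite /h /= in hs.
have ncd : c != d by apply: contraTneq cd => ->; rewrite adj_irrefl.
have := hs c; have := hs d; rewrite !inE !eqxx /= orbT => /esym/orP dE /esym/orP cE.
case: cE => /eqP cE; case: dE => /eqP dE; subst c d; rewrite ?eqxx // in ncd n1 n2.
Qed.

(** Every second step is chosen among the 2m oriented edges; the steps in between then leave at most
    one choice each. *)
Lemma nwalk_odd_le (G : sgraph) b (u v : G) :
  (nwalk b.*2.+1 u v <= (nb_edges G).*2 ^ b)%N.
Proof.
elim: b u => [|b IH] u; first by rewrite nwalk1; case: (adj u v).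
rewrite doubleS nwalkS expnS -{1}deg_sum big_distrl /=; apply: leq_sum => w _.
apply: (@leq_trans (nwalk b.*2.+2 w v)); first by case: (adj u w); rewrite ?mul1n.
rewrite nwalkS /deg big_distrl /=; apply: leq_sum => x _.
by apply: leq_mul; [|exact: IH].
Qed.

(** * Traces, Rayleigh quotients and the Perron vector *)

Section Perron.
Variables (R : realType) (G : sgraph) (sp : spectrum R G).
Local Notation A u v := ((adj u v)%:R : R).
Local Notation r := (rho R G).

Lemma trace_walk j : (\sum_(u : G) nwalk j u u)%N%:R = \sum_i lam sp i ^+ j.
Proof.
rewrite natr_sum; under eq_bigr => u _ do rewrite (walk_spec sp).
rewrite exchange_big /=; apply: eq_bigr => i _.
by rewrite -mulr_sumr wt_row mulr1.
Qed.

Lemma trace_sq : \sum_i lam sp i ^+ 2 = 2 * (nb_edges G)%:R.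
Proof.
rewrite -trace_walk; under eq_bigr => u _ do rewrite nwalk2_diag.
by rewrite deg_sum -muln2 natrM mulrC.
Qed.

Lemma rayleigh_le (f : G -> R) :
  \sum_u \sum_v A u v * (f u * f v) <= r * \sum_u f u ^+ 2.
Proof.
have [mu [mu0 <- -> _]] := rayleigh sp f.
rewrite mulr_sumr; apply: ler_sum => i _; apply: ler_wpM2r => //.
exact: le_trans (ler_norm _) (lam_le sp i).
Qed.

Hypothesis G0 : (0 < #|G|)%N.

Lemma rho_ge0 : 0 <= r.
Proof. by have [i <-] := lam_max sp G0. Qed.

Lemma rho_sq_le : r ^+ 2 <= 2 * (nb_edges G)%:R.
Proof.
have [i hi] := lam_max sp G0.
rewrite -trace_sq (bigD1 i) //= -hi real_normK ?num_real // lerDl.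
by apply: sumr_ge0 => j _; rewrite sqr_ge0.
Qed.

Lemma even_walk_le a (u : G) : (nwalk a.+1.*2 u u)%:R <= r ^+ a.*2 * (deg u)%:R.
Proof.
rewrite (walk_spec sp) -nwalk2_diag (walk_spec sp) mulr_sumr.
apply: ler_sum => i _; rewrite mulrA; apply: ler_wpM2r; first exact: sqr_ge0.
rewrite doubleS -addn2 exprD; apply: ler_wpM2r; first exact: sqr_ge0.
rewrite -(@ger0_norm _ (lam sp i ^+ _)) ?normrX; last by rewrite -muln2 exprM sqr_ge0.
by rewrite lerXn2r ?nnegrE ?rho_ge0 ?lam_le.
Qed.

(** By [eig_sub] the weights w of an eigenvalue of modulus rho satisfy r w <= A w pointwise; since A
    has norm r, equality holds everywhere. *)
Lemma perron : exists i0, lam sp i0 = r /\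
  forall u, \sum_v A u v * wt sp i0 v = r * wt sp i0 u.
Proof.
suff H i : `|lam sp i| = r ->
    forall u, \sum_v A u v * wt sp i v = r * wt sp i u.
  (* The eigenvalue of largest modulus found here may be - rho. Its weights are an eigenvector for
     rho nevertheless, so their spectral measure charges some index with eigenvalue exactly rho, and
     [H] applies to that index. *)
  have [i hi] := lam_max sp G0; have {}H' := H i hi.
  have [mu [mu0 mu1 muA _]] := rayleigh sp (wt sp i).
  rewrite wt_row in mu1.
  have e : \sum_k (r - lam sp k) * mu k = 0.
    under eq_bigr => k _ do rewrite mulrBl.
    rewrite sumrB -muA -mulr_sumr mu1 mulr1; apply/eqP; rewrite subr_eq0; apply/eqP.
    under [RHS]eq_bigr => u _.
      under eq_bigr => v _ do rewrite mulrCA.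
      rewrite -mulr_sumr H' mulrCA -expr2; over.
    by rewrite -mulr_sumr wt_row mulr1.
  have [/existsP[k /andP[/eqP ek _]]|] := boolP [exists k, (lam sp k == r) && (mu k != 0)].
    exists k; split=> //; apply: H; rewrite ek ger0_norm //.
    exact: rho_ge0.
  rewrite negb_exists => /forallP hk.
  suff : \sum_k mu k = 0 by rewrite mu1 => /eqP; rewrite oner_eq0.
  apply: big1 => k _; apply/eqP; have := hk k; rewrite negb_and negbK orbC.
  case/orP => // kr.
  have /eqP := e; rewrite psumr_eq0 => [/allP/(_ k)|j _].
    by rewrite mem_index_enum mulf_eq0 subr_eq0 eq_sym (negbTE kr) => /(_ isT).
  by rewrite mulr_ge0 // subr_ge0; exact: le_trans (ler_norm _) (lam_le sp j).
move=> hi.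
have ge u : 0 <= \sum_v A u v * wt sp i v - r * wt sp i u.
  by rewrite subr_ge0 -hi eig_sub.
have le : \sum_u (\sum_v A u v * wt sp i v) ^+ 2 <= r ^+ 2.
  have [mu [mu0 mu1 _ ->]] := rayleigh sp (wt sp i).
  rewrite wt_row in mu1.
  rewrite -[leRHS]mulr1 -mu1 mulr_sumr; apply: ler_sum => k _.
  apply: ler_wpM2r => //; rewrite -real_normK ?num_real //.
  by rewrite lerXn2r ?nnegrE ?rho_ge0 ?lam_le.
have sq u : 0 <= (\sum_v A u v * wt sp i v) ^+ 2 - (r * wt sp i u) ^+ 2.
  rewrite subr_ge0 lerXn2r ?nnegrE ?mulr_ge0 ?rho_ge0 ?wt_ge0 //.
    by rewrite sumr_ge0 // => v _; rewrite mulr_ge0 ?wt_ge0.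
  by rewrite -subr_ge0.
have : \sum_u ((\sum_v A u v * wt sp i v) ^+ 2 - (r * wt sp i u) ^+ 2) == 0.
  rewrite eq_le sumr_ge0 // andbT sumrB subr_le0.
  under [leRHS]eq_bigr => u _ do rewrite exprMn.
  by rewrite -mulr_sumr wt_row mulr1.
rewrite psumr_eq0 // => /allP h u.
have := h u; rewrite mem_index_enum subr_eq0 eqf_sqr => /(_ isT)/orP[/eqP //|/eqP e].
have a0 : 0 <= \sum_v A u v * wt sp i v.
  by rewrite sumr_ge0 // => v _; rewrite mulr_ge0 ?wt_ge0.
have b0 : 0 <= r * wt sp i u by rewrite mulr_ge0 ?rho_ge0 ?wt_ge0.
by lra.
Qed.
End Perron.

(** * Closed walks and copies of odd cycles *)

Section ClosedWalks.
Variable G : sgraph.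

Fixpoint seqsum n (F : seq G -> nat) : nat :=
  if n is n'.+1 then (\sum_u seqsum n' (fun s => F (u :: s)))%N else F [::].

Lemma eq_seqsum n (F F' : seq G -> nat) :
  (forall s, F s = F' s) -> seqsum n F = seqsum n F'.
Proof.
elim: n F F' => [|n IH] F F' h /=; first exact: h.
by apply: eq_bigr => u _; apply: IH => s; exact: h.
Qed.

Lemma seqsum_mull n c (F : seq G -> nat) :
  seqsum n (fun s => c * F s)%N = (c * seqsum n F)%N.
Proof.
elim: n F => [//|n IH] F /=; rewrite big_distrr /=.
by apply: eq_bigr => u _; rewrite IH.
Qed.

Lemma seqsum_cat a b (F : seq G -> nat) :
  seqsum (a + b) F = seqsum a (fun s1 => seqsum b (fun s2 => F (s1 ++ s2))).
Proof.
elim: a F => [//|a IH] F /=.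
by apply: eq_bigr => u _; rewrite IH.
Qed.

Lemma seqsum_tuple n (F : seq G -> nat) :
  seqsum n F = (\sum_(t : n.-tuple G) F t)%N.
Proof.
elim: n F => [|n IH] F /=.
  rewrite (big_pred1 [tuple]) // => t; rewrite (tuple0 t).
  by rewrite /= eqxx.
under eq_bigr => u _ do rewrite IH.
rewrite pair_big /=.
rewrite (reindex (fun p : G * n.-tuple G => [tuple of p.1 :: p.2])) //=.
exists (fun t : n.+1.-tuple G => (thead t, [tuple of behead t])).
  by move=> [u t] _ /=; congr (_, _); apply: val_inj.
by move=> t _ /=; rewrite -tuple_eta.
Qed.

Lemma seqsum_path n (u v : G) :
  seqsum n (fun s => path (@adj G) u s && adj (last u s) v) = nwalk n.+1 u v.
Proof.
elim: n u => [|n IH] u; first by rewrite nwalk1.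
rewrite nwalkS /=; apply: eq_bigr => w _; rewrite -IH -seqsum_mull.
by apply: eq_seqsum => s; case: (adj u w); rewrite ?mul1n ?mul0n.
Qed.

Lemma cycle_cons (u : G) s :
  cycle (@adj G) (u :: s) = path (@adj G) u s && adj (last u s) u.
Proof. by rewrite /= rcons_path. Qed.

Lemma closed_walk_cycle n : (0 < n)%N ->
  (\sum_(t : n.-tuple G) cycle (@adj G) t)%N = (\sum_(u : G) nwalk n u u)%N.
Proof.
case: n => // n _; rewrite -(seqsum_tuple _ (fun s => cycle (@adj G) s : nat)) /=.
apply: eq_bigr => u _; rewrite -seqsum_path.
by apply: eq_seqsum => s; rewrite -cycle_cons.
Qed.

Lemma closed_walk_split a b (x0 : G) : (0 < a)%N -> (0 < b)%N ->
  (\sum_(t : (a + b).-tuple G)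
     (cycle (@adj G) t && (nth x0 t 0 == nth x0 t a)))%N
    = (\sum_(v : G) nwalk a v v * nwalk b v v)%N.
Proof.
case: a => // a _; case: b => // b _.
pose F (s : seq G) : nat := cycle (@adj G) s && (nth x0 s 0 == nth x0 s a.+1).
transitivity (seqsum (a.+1 + b.+1) F); first by rewrite seqsum_tuple.
rewrite seqsum_cat {}/F.
have size_seqsum n (H H' : seq G -> nat) :
    (forall s, size s = n -> H s = H' s) -> seqsum n H = seqsum n H'.
  elim: n H H' => [|n IH] H H' h /=; first exact: h.
  by apply: eq_bigr => u _; apply: IH => s es; apply: h; rewrite /= es.
rewrite /=; apply: eq_bigr => u _.
transitivity (seqsum a (fun s1 =>
    (path (@adj G) u s1 && adj (last u s1) u) * nwalk b.+1 u u))%N; last first.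
  rewrite -[X in (X * _)%N]seqsum_path mulnC -seqsum_mull.
  by apply: eq_seqsum => s; rewrite mulnC.
apply: size_seqsum => s1 es1; rewrite (bigD1 u) //= [X in (_ + X)%N]big1 ?addn0.
  rewrite -seqsum_path -seqsum_mull; apply: eq_seqsum => s2.
  rewrite nth_cat -es1 ltnn subnn /= eqxx andbT rcons_cat cat_path /= rcons_path.
  by rewrite mulnb !andbA.
move=> v vu; transitivity (seqsum b (fun _ => 0 * 0))%N; last first.
  by rewrite seqsum_mull.
apply: eq_seqsum => s2; rewrite nth_cat -es1 ltnn subnn /= eq_sym (negbTE vu).
by rewrite andbF.
Qed.

(** A repetition at positions i < j is moved to positions 0 and j - i by rotating the walk, which
    costs the factor [n]; the walk is then cut at the repeated vertex. *)
Lemma nonuniq_cycle_le n :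
  (\sum_(t : n.-tuple G) (cycle (@adj G) t && ~~ uniq t) <=
   n * \sum_(1 <= d < n) \sum_(v : G) nwalk d v v * nwalk (n - d) v v)%N.
Proof.
case: n => [|n]; first by rewrite big1 // => t _; rewrite (tuple0 t).
case: (pickP (@predT G)) => [x0 _|noG]; last first.
  by rewrite big1 // => t _; case/tupleP: t => u; have := noG u.
pose F (d : nat) (t : seq G) := cycle (@adj G) t && (nth x0 t 0 == nth x0 t d).
have key (t : n.+1.-tuple G) : (cycle (@adj G) t && ~~ uniq t <=
    \sum_(i < n.+1) \sum_(1 <= d < n.+1) F d (rot i t))%N.
  have [/andP[ct ut]|//] := boolP (cycle (@adj G) t && ~~ uniq t).
  have /(uniqPn x0)[i [j [ij]]] := ut; rewrite size_tuple => jn eij.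
  rewrite (bigD1 (Ordinal (ltn_trans ij jn))) //=.
  rewrite (big_rem (j - i)%N) /=; last by rewrite mem_index_iota; lia.
  suff -> : F (j - i)%N (rot i t) by [].
  rewrite /F rot_cycle ct /= !nth_cat size_drop size_tuple !nth_drop.
  have -> : (0 < n.+1 - i)%N by lia.
  have -> : (j - i < n.+1 - i)%N by lia.
  by rewrite addn0 subnKC ?eij // ltnW.
apply: leq_trans (leq_sum _ (fun t _ => key t)) _.
rewrite exchange_big /=.
rewrite -[X in (_ <= X * _)%N](card_ord n.+1) -sum_nat_const.
apply: leq_sum => i _; rewrite exchange_big /= big_nat [leqRHS]big_nat.
apply: leq_sum => d /andP[d0 dn].
rewrite (reindex_inj (h := fun t : n.+1.-tuple G => [tuple of rotr i t])) /=.
  under eq_bigr => t _ do rewrite rotrK.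
  have dE : (d + (n.+1 - d) = n.+1)%N by lia.
  rewrite -(@closed_walk_split d (n.+1 - d) x0) //; last by lia.
  by rewrite dE.
move=> t1 t2 /(congr1 val) /= e; apply: val_inj => /=.
exact: (can_inj (rotrK i) e).
Qed.
End ClosedWalks.

Lemma set2_eqP (T : finType) (a b c d : T) :
  [set a; b]%SET = [set c; d]%SET -> (a = c /\ b = d) \/ (a = d /\ b = c).
Proof.
move=> e.
have : a \in [set c; d]%SET by rewrite -e !inE eqxx.
have : b \in [set c; d]%SET by rewrite -e !inE eqxx orbT.
have : c \in [set a; b]%SET by rewrite e !inE eqxx.
have : d \in [set a; b]%SET by rewrite e !inE eqxx orbT.
rewrite !inE => hd hc hb /orP[]/eqP ac; [left|right]; split=> //; subst.
  by case/orP: hb => /eqP // bc; subst; case/orP: hd => /eqP.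
by case/orP: hb => /eqP // bc; subst; case/orP: hc => /eqP.
Qed.

Lemma mem_edges (G : sgraph) (a b : G) : ([set a; b]%SET \in edges G) = adj a b.
Proof.
apply/imsetP/idP => [[[c d]]|ab]; last by exists (a, b); rewrite ?inE.
by rewrite inE /= => cd /set2_eqP[[-> ->]|[-> ->]] //; rewrite adj_sym.
Qed.

Lemma val_ordS n (i : 'I_n) : val (ordS i) = (if i.+1 == n then 0 else i.+1)%N.
Proof.
case: n i => [[]//|n] i /=; case: eqP => [->|ne]; first by rewrite modnn.
by rewrite modn_small //; have := ltn_ord i; lia.
Qed.

Section Copies.
Variables (n : nat) (G : sgraph).
Hypothesis n3 : (3 <= n)%N.

Definition cyc_homs : {set {ffun 'I_n -> G}} :=
  [set f : {ffun 'I_n -> G} | injectiveb f & [forall i, adj (f i) (f (ordS i))]]%SET.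

Definition copy_of (f : {ffun 'I_n -> G}) : {set G} * {set {set G}} :=
  (f @: [set: 'I_n], [set [set f p.1; f p.2] | p : 'I_n * 'I_n & cycle_adj p.1 p.2])%SET.

Lemma ordS_neq (i : 'I_n) : i != ordS i.
Proof.
by rewrite -val_eqE val_ordS /=; have := ltn_ord i; case: (eqVneq i.+1 n); lia.
Qed.

Lemma cycle_adjS (i : 'I_n) : cycle_adj i (ordS i).
Proof. by rewrite /cycle_adj ordS_neq eqxx. Qed.

Lemma cyc_homs_adj f i j : f \in cyc_homs -> cycle_adj i j -> adj (f i) (f j).
Proof.
rewrite inE => /andP[_ /forallP h] /andP[_ /orP[/eqP->|/eqP->]] //.
by rewrite adj_sym.
Qed.

Lemma mem_copy_of (f : {ffun 'I_n -> G}) i j : injective f ->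
  ([set f i; f j]%SET \in (copy_of f).2) = cycle_adj i j.
Proof.
move=> fi; apply/imsetP/idP => [[[a b]]|ij]; last by exists (i, j); rewrite ?inE.
rewrite inE /= => ab /set2_eqP[[/fi-> /fi->]|[/fi-> /fi->]] //.
by rewrite cycle_adj_sym.
Qed.

Lemma copy_of_iso f : f \in cyc_homs ->
  is_subgraph (copy_of f) && subgraph_iso (cycle_graph n) (copy_of f).
Proof.
move=> fh; have fi : injective f by move: fh; rewrite inE => /andP[/injectiveP].
apply/andP; split; [apply/andP; split|].
- apply/fintype.subsetP => e /imsetP[[a b]]; rewrite inE /= => ab ->.
  by rewrite mem_edges (cyc_homs_adj fh).
- apply/forallP => e; apply/implyP => /imsetP[[a b] _ ->] /=.
  by apply/fintype.subsetP => x; rewrite !inE => /orP[]/eqP->; exact: imset_f.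
- apply/existsP; exists f; rewrite /= eqxx /=.
  apply/andP; split; first exact/injectiveP.
  apply/forallP => i; apply/forallP => j; apply/eqP.
  exact/esym/mem_copy_of.
Qed.

Lemma iso_copy_of H : is_subgraph H -> subgraph_iso (cycle_graph n) H ->
  exists2 f, f \in cyc_homs & H = copy_of f.
Proof.
case: H => H1 H2 /andP[/= /fintype.subsetP sH /forallP sV] /existsP[f].
move=> /and3P[/injectiveP fi /eqP/= fH /forallP fE].
have fE' i j : cycle_adj i j = ([set f i; f j]%SET \in H2).
  by have /forallP/(_ j)/eqP := fE i.
exists f.
  rewrite inE; apply/andP; split; first exact/injectiveP.
  by apply/forallP => i; rewrite -mem_edges sH // -fE' cycle_adjS.
congr (_, _) => //; apply/setP => e; apply/idP/imsetP => [he|[[i j]]]; last first.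
  by rewrite inE /= => ij ->; rewrite -fE'.
have /imsetP[[a b]] := sH e he; rewrite inE /= => ab eab.
have /implyP/(_ he)/fintype.subsetP se := sV e.
have : a \in H1 by apply: se; rewrite eab !inE eqxx.
have : b \in H1 by apply: se; rewrite eab !inE eqxx orbT.
rewrite -fH => /imsetP[j _ bj] /imsetP[i _ ai]; exists (i, j).
  by rewrite inE /= fE' -ai -bj -eab.
by rewrite eab ai bj.
Qed.

Lemma nb_copiesE : nb_copies (cycle_graph n) G = #|copy_of @: cyc_homs|%SET.
Proof.
rewrite /nb_copies; apply: eq_card => H; rewrite inE; apply/andP/imsetP.
  by move=> [h1 h2]; have [f fh ->] := iso_copy_of h1 h2; exists f.
by move=> [f fh ->]; apply/andP/copy_of_iso.
Qed.

(** Each vertex of the copy has only two neighbours in it, so the value at a position is forced by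
    the values at the two preceding ones. *)
Lemma copy_of_rigid f g : f \in cyc_homs -> g \in cyc_homs ->
  copy_of f = copy_of g ->
  (forall i : 'I_n, (i < 2)%N -> f i = g i) -> f = g.
Proof.
move=> fh gh e h01.
have fi : injective f by move: fh; rewrite inE => /andP[/injectiveP].
have gi : injective g by move: gh; rewrite inE => /andP[/injectiveP].
suff H k : forall i : 'I_n, (i < k.+2)%N -> f i = g i.
  by apply/ffunP => i; apply: (H i); lia.
elim: k => [|k IH] i ik; first exact: h01.
have [ik'|ik'] := ltnP i k.+2; first exact: IH.
have ei : i = k.+2 :> nat by lia.
have hk : (k.+1 < n)%N by have := ltn_ord i; lia.
have hk' : (k < n)%N by lia.
pose i1 := Ordinal hk; pose i0 := Ordinal hk'.
have s1 : ordS i1 = i by apply: val_inj; rewrite val_ordS /= ei; case: ifP => //; have := ltn_ord i; lia.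
have s0 : ordS i0 = i1 by apply: val_inj; rewrite val_ordS /=; case: ifP => //; lia.
have f1 : f i1 = g i1 by apply: IH.
have f0 : f i0 = g i0 by apply: IH => /=; lia.
have : [set g i1; g i]%SET \in (copy_of g).2 by rewrite mem_copy_of // -s1 cycle_adjS.
rewrite -e => /imsetP[[a b]]; rewrite inE /= -f1 => ab.
have key c : cycle_adj i1 c -> g i = f c -> f i = g i.
  move=> /andP[_ /orP[/eqP->|/eqP e1]]; first by rewrite s1 => ->.
  have c0 : c = i0.
    apply: val_inj => /=; move: (congr1 val e1); rewrite val_ordS /=.
    by case: ifP => //; lia.
  rewrite c0 f0 => /gi /(congr1 val) /=; lia.
move=> /set2_eqP[[/fi e1 e2]|[/fi e1 e2]].
  by apply: (key b) => //; rewrite e1.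
by apply: (key a) => //; rewrite e1 cycle_adj_sym.
Qed.

(** By rigidity a labelling of a given copy is determined by the images of positions 0 and 1, which
    form one of the 2n oriented edges of the copy. *)
Lemma cyc_homs_le : (#|cyc_homs| <= n.*2 * nb_copies (cycle_graph n) G)%N.
Proof.
rewrite nb_copiesE -sum1_card (partition_big_imset copy_of) /= mulnC -sum_nat_const.
apply: leq_sum => H /imsetP[f fh ->].
rewrite sum1dep_card.
have n0 : (0 < n)%N by lia.
have n1 : (1 < n)%N by lia.
pose i0 := Ordinal n0; pose i1 := Ordinal n1.
set S := [set g | _]%SET.
have fi : injective f by move: fh; rewrite inE => /andP[/injectiveP].
have -> : #|S| = #|(fun g : {ffun 'I_n -> G} => (g i0, g i1)) @: S|%SET.
  rewrite card_in_imset // => g1 g2; rewrite !inE.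
  move=> /andP[g1h /eqP e1] /andP[g2h /eqP e2] [h0 h1].
  apply: copy_of_rigid; rewrite ?inE //; first by rewrite e1.
  move=> [[|[|j]] hi] //= _.
    by rewrite (_ : Ordinal hi = i0) //; apply: val_inj.
  by rewrite (_ : Ordinal hi = i1) //; apply: val_inj.
have -> : n.*2 = #|{: 'I_n * bool}| by rewrite card_prod card_ord card_bool muln2.
pose h (p : 'I_n * bool) := (f p.1, f (if p.2 then ordS p.1 else ord_pred p.1)).
apply: leq_trans (leq_imset_card h _).
apply/subset_leq_card/fintype.subsetP => y /imsetP[g]; rewrite inE => /andP[gh /eqP e] ->{y}.
have gi : injective g by move: gh; rewrite inE => /andP[/injectiveP].
have s01 : ordS i0 = i1 by apply: val_inj; rewrite val_ordS /=; case: ifP => //; lia.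
have : [set g i0; g i1]%SET \in (copy_of g).2 by rewrite mem_copy_of // -s01 cycle_adjS.
rewrite e => /imsetP[[a b]]; rewrite inE /= => ab.
have key c d : cycle_adj c d -> (f c, f d) \in (h @: {: 'I_n * bool})%SET.
  move=> /andP[_ /orP[/eqP->|/eqP->]].
    by apply/imsetP; exists (c, true).
  by apply/imsetP; exists (ordS d, false); [|rewrite /h /= ordSK].
move=> /set2_eqP[[-> ->]|[-> ->]]; first exact: key.
by apply: key; rewrite cycle_adj_sym.
Qed.

Lemma uniq_cycle_card :
  (\sum_(t : n.-tuple G) (cycle (@adj G) t && uniq t))%N = #|cyc_homs|.
Proof.
rewrite -sum1_card [RHS]big_mkcond /=.
pose h (f : {ffun 'I_n -> G}) := [tuple f i | i < n].
pose h' (t : n.-tuple G) := [ffun i => tnth t i].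
have hK : cancel h h' by move=> f; apply/ffunP => i; rewrite ffunE tnth_mktuple.
have h'K : cancel h' h by move=> t; apply: eq_from_tnth => i; rewrite tnth_mktuple ffunE.
rewrite (reindex h) /=; last by apply: onW_bij; exists h'.
apply: eq_bigr => f _; rewrite inE andbC.
have -> : uniq (h f) = injectiveb f by [].
have -> : cycle (@adj G) (h f) = [forall i, adj (f i) (f (ordS i))].
  have n0 : (0 < n)%N by lia.
  pose x0 := f (Ordinal n0).
  have nthE k (kn : (k < n)%N) : nth x0 (h f) k = f (Ordinal kn).
    by rewrite -[k]/(val (Ordinal kn)) -tnth_nth tnth_mktuple.
  have sz : size (h f) = n by rewrite size_tuple.
  move: sz nthE; case: (tval (h f)) => [|x s] /= sz nthE; first by exfalso; clear -sz n0; rewrite -sz in n0.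
  have eL k : (k < n)%N -> nth x0 (x :: rcons s x) k = nth x0 (x :: s) k.
    by move=> kn; rewrite -rcons_cons nth_rcons /= sz kn.
  have eR (i : 'I_n) : nth x0 (rcons s x) i = nth x0 (x :: s) (ordS i).
    rewrite nth_rcons val_ordS; move: (ltn_ord i) sz; move: (nat_of_ord i) => k kn sz.
    rewrite -sz eqSS; rewrite -sz ltnS in kn.
    by case: ltngtP kn.
  have e (i : 'I_n) : adj (f i) (f (ordS i)) =
      adj (nth x0 (x :: rcons s x) i) (nth x0 (rcons s x) i).
    rewrite eL // eR (nthE i (ltn_ord i)) (nthE (ordS i) (ltn_ord (ordS i))).
    by congr (adj (f _) (f _)); apply: val_inj.
  apply/(pathP x0)/forallP => [hp i|hf k]; first by rewrite e hp // size_rcons sz.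
  by rewrite size_rcons sz => kn; have := hf (Ordinal kn); rewrite e.
by case: (injectiveb f); case: [forall i, _].
Qed.
End Copies.

(** * Closed walks that repeat a vertex *)

Section Degenerate.
Variables (R : realType) (G : sgraph) (sp : spectrum R G) (k : nat).
Hypothesis k1 : (1 <= k)%N.
Hypothesis G0 : (0 < #|G|)%N.
Local Notation m := ((nb_edges G)%:R : R).
Local Notation N := ((nb_copies (cycle_graph k.*2.+1) G)%:R : R).
Local Notation tr j := ((\sum_(u : G) nwalk j u u)%N%:R : R).
Local Notation n := (k.*2.+1).

(** A closed walk of odd length with a repeated vertex splits there into one of even length 2(a + 1)
    and one of odd length 2b + 1. The factor [n ^ 2] accounts for the rotations and for the lengths
    of the pieces. *)
Lemma trace_le_copies (B : R) :
  (forall a b, (a.+1 + b = k)%N ->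
     \sum_(v : G) (nwalk a.+1.*2 v v)%:R * (nwalk b.*2.+1 v v)%:R <= B) ->
  tr n <= 2 * n%:R * N + n%:R ^+ 2 * B.
Proof.
move=> hB.
have hB' d : (1 <= d < n)%N ->
    (\sum_(v : G) nwalk d v v * nwalk (n - d) v v)%N%:R <= B.
  move=> /andP[d1 dn]; rewrite natr_sum; under eq_bigr => v _ do rewrite natrM.
  case od: (odd d).
    have -> : d = (d./2).*2.+1 by rewrite -[LHS]odd_double_half od.
    have -> : (n - (d./2).*2.+1 = (k - d./2).-1.+1.*2)%N.
      by have := odd_double_half d; rewrite od; lia.
    under eq_bigr => v _ do rewrite mulrC.
    by apply: hB; have := odd_double_half d; rewrite od; lia.
  have -> : d = (d./2).-1.+1.*2.
    by have := odd_double_half d; rewrite od; lia.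
  have -> : (n - (d./2).-1.+1.*2 = (k - d./2).*2.+1)%N.
    by have := odd_double_half d; rewrite od; lia.
  by apply: hB; have := odd_double_half d; rewrite od; lia.
have B0 : 0 <= B.
  by apply: le_trans (hB k.-1 0%N _); [apply: sumr_ge0 => v _; rewrite mulr_ge0|lia].
have n3 : (3 <= n)%N by lia.
rewrite -closed_walk_cycle //.
have -> : (\sum_(t : n.-tuple G) cycle (@adj G) t =
    #|cyc_homs n G| + \sum_(t : n.-tuple G) (cycle (@adj G) t && ~~ uniq t))%N.
  rewrite -uniq_cycle_card // -big_split /=; apply: eq_bigr => t _.
  by case: (cycle _ _); case: (uniq _).
rewrite natrD lerD //.
  have := cyc_homs_le G n3; rewrite -(ler_nat R) => /le_trans; apply.
  by rewrite -[(k.*2.+1).*2]mul2n !natrM.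
apply: (@le_trans _ _ (n * \sum_(1 <= d < n) \sum_(v : G) nwalk d v v * nwalk (n - d) v v)%N%:R).
  by rewrite ler_nat nonuniq_cycle_le.
rewrite natrM natr_sum expr2 -mulrA; apply: ler_wpM2l => //.
rewrite big_nat; apply: (@le_trans _ _ (\sum_(1 <= d < n) B)).
  rewrite [leRHS]big_nat; apply: ler_sum => d hd; exact: hB'.
rewrite sumr_const_nat -[leLHS]mulr_natl; apply: ler_wpM2r => //.
by rewrite ler_nat; lia.
Qed.

Lemma trace_le_copies_crude : tr n <= 2 * n%:R * N + n%:R ^+ 2 * (2 * m) ^+ k.
Proof.
apply: trace_le_copies => a b abk.
apply: (@le_trans _ _ (\sum_(v : G) (2 * m) ^+ a * (deg v)%:R * (2 * m) ^+ b)).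
  apply: ler_sum => v _; apply: ler_pM => //.
    apply: le_trans (even_walk_le sp G0 a v) _; apply: ler_wpM2r => //.
    rewrite -muln2 mulnC exprM; apply: lerXn2r; rewrite ?nnegrE ?sqr_ge0 ?mulr_ge0 //.
    exact: rho_sq_le sp G0.
  have := nwalk_odd_le b v v; rewrite -(ler_nat R) => /le_trans; apply.
  by rewrite natrX -muln2 natrM mulrC.
rewrite -mulr_suml -mulr_sumr -natr_sum deg_sum -muln2 natrM [_ * 2]mulrC.
by rewrite -exprSr -exprD abk.
Qed.

(** Compared with the crude bound, [D] replaces one factor m: the even piece is bounded at each
    vertex through its degree, so that the odd pieces can be summed to a trace, which [hC]
    controls. *)
Lemma trace_le_copies_degree (D C : R) :
  0 <= C ->
  (forall v : G, (deg v)%:R <= D) ->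
  (forall b, (1 <= b < k)%N -> tr b.*2.+1 <= C * m ^+ b) ->
  tr n <= 2 * n%:R * N + n%:R ^+ 2 * (2 ^+ k * C * D * m ^+ k.-1).
Proof.
move=> C0 hD hC; apply: trace_le_copies => a b abk.
have D0 : 0 <= D by have /card_gt0P[v _] := G0; exact: le_trans (hD v).
have T0 : 0 <= 2 ^+ k * C * D * m ^+ k.-1.
  by rewrite !mulr_ge0 // exprn_ge0.
(* A closed walk of length 1 would be a loop, which is why [hC] starts at [b = 1]. *)
case: b abk => [|b] abk.
  by rewrite big1 // => v _; rewrite nwalk1 adj_irrefl mulr0.
apply: (@le_trans _ _ (\sum_(v : G) (2 * m) ^+ a * D * (nwalk b.+1.*2.+1 v v)%:R)).
  apply: ler_sum => v _; apply: ler_wpM2r => //.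
  apply: le_trans (even_walk_le sp G0 a v) _; apply: ler_pM => //.
    by rewrite exprn_ge0 // (rho_ge0 sp G0).
  rewrite -muln2 mulnC exprM; apply: lerXn2r; rewrite ?nnegrE ?sqr_ge0 ?mulr_ge0 //.
  exact: rho_sq_le sp G0.
rewrite -mulr_sumr -natr_sum.
have := hC b.+1; rewrite (_ : (1 <= b.+1 < k)%N); last by lia.
move=> /(_ isT) h; apply: le_trans (ler_wpM2l _ h) _.
  by rewrite mulr_ge0 // exprn_ge0 // mulr_ge0.
have -> : (2 * m) ^+ a * D * (C * m ^+ b.+1) = 2 ^+ a * (C * D * m ^+ k.-1).
  by rewrite exprMn -abk addSn /= exprD; ring.
rewrite -!mulrA; apply: ler_wpM2r; first by rewrite !mulr_ge0 // exprn_ge0.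
by rewrite ler_weXn2l // ?ler1n; lia.
Qed.
End Degenerate.

(** * Graphs with few closed walks *)

Lemma odd_power_ge (R : realDomainType) (L x : R) j :
  0 <= L -> - L <= x -> - L ^+ j.*2.+1 <= x ^+ j.*2.+1.
Proof.
move=> L0 Lx; have [x0|x0] := leP 0 x.
  by apply: (@le_trans _ _ 0); rewrite ?oppr_le0 exprn_ge0.
rewrite lerNl -[- _ ^+ _]mulN1r -[X in X * _](_ : (-1) ^+ j.*2.+1 = -1); last first.
  by rewrite -signr_odd /= odd_double expr1.
rewrite -exprMn mulN1r; apply: lerXn2r; rewrite ?nnegrE //; last by rewrite lerNl.
by rewrite oppr_ge0 ltW.
Qed.

Lemma power_sub_le (R : realDomainType) (x y : R) n :
  0 <= y -> y <= x -> x ^+ n.+1 - y ^+ n.+1 <= n.+1%:R * (x - y) * x ^+ n.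
Proof.
move=> y0 yx; rewrite subrXX [n.+1%:R * _]mulrC -mulrA; apply: ler_wpM2l.
  by rewrite subr_ge0.
have -> : n.+1%:R * x ^+ n = \sum_(i < n.+1) x ^+ n.
  by rewrite sumr_const card_ord mulr_natl.
apply: ler_sum => i _; rewrite -[in leRHS](@subnK i n) -1?ltnS // exprD.
apply: ler_wpM2l; first by rewrite exprn_ge0 // (le_trans y0).
by apply: lerXn2r; rewrite ?nnegrE // (le_trans y0).
Qed.

Section Structure.
Variables (R : realType) (G : sgraph) (sp : spectrum R G) (k : nat).
Hypothesis k1 : (1 <= k)%N.
Hypothesis G0 : (0 < #|G|)%N.
Local Notation m := ((nb_edges G)%:R : R).
Local Notation r := (Num.sqrt (nb_edges G)%:R : R).
Local Notation tr j := ((\sum_(u : G) nwalk j u u)%N%:R : R).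
Local Notation rh := (rho R G).

Lemma sqr_r : r ^+ 2 = m.
Proof. by rewrite sqr_sqrtr. Qed.

Lemma lam_sq_rest i0 : lam sp i0 = rh ->
  \sum_(i | i != i0) lam sp i ^+ 2 = 2 * m - rh ^+ 2.
Proof.
by move=> h; rewrite -(trace_sq sp) [in RHS](bigD1 i0) //= h addrC addrK.
Qed.

(** Here - L is the least eigenvalue, or L = 0 if none is negative. Then lam^(2k+1) = lam^(2k-1)
    lam^2 >= - L^(2k-1) lam^2, and the squares other than rho^2 add up to 2m - rho^2. *)
Lemma trace_ge i0 : lam sp i0 = rh -> exists L : R,
  [/\ 0 <= L, L ^+ 2 <= 2 * m - rh ^+ 2,
      rh ^+ k.*2.+1 - L ^+ k.-1.*2.+1 * (2 * m - rh ^+ 2) <= tr k.*2.+1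
    & L = 0 \/ exists2 i1, i1 != i0 & lam sp i1 = - L].
Proof.
move=> h0.
have gen L : 0 <= L -> (forall i, - L <= lam sp i) ->
    rh ^+ k.*2.+1 - L ^+ k.-1.*2.+1 * (2 * m - rh ^+ 2) <= tr k.*2.+1.
  move=> L0 hL; rewrite (trace_walk sp) (bigD1 i0) //= h0 lerD2l.
  rewrite -(lam_sq_rest h0) mulr_sumr -sumrN; apply: ler_sum => i _.
  have -> : (k.*2.+1 = k.-1.*2.+1 + 2)%N by lia.
  by rewrite exprD -mulNr; apply: ler_wpM2r; rewrite ?sqr_ge0 ?odd_power_ge.
have [i1 _ hi1] := @arg_minP _ R _ i0 predT (fun i => lam sp i) isT.
have S0 : 0 <= 2 * m - rh ^+ 2 by rewrite subr_ge0 (rho_sq_le sp).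
have [l0|l0] := leP 0 (lam sp i1).
  exists 0; split=> //; first by rewrite expr0n.
    by apply: gen => // i; rewrite oppr0 (le_trans l0) // hi1.
  by left.
have n10 : i1 != i0.
  by apply: contraTneq l0 => ->; rewrite h0 -leNgt (rho_ge0 sp).
exists (- lam sp i1); split.
- by rewrite oppr_ge0 ltW.
- rewrite sqrrN -(lam_sq_rest h0) (bigD1 i1) //= lerDl.
  by apply: sumr_ge0 => i _; exact: sqr_ge0.
- by apply: gen => [|i]; rewrite ?oppr_ge0 ?(ltW l0) // opprK hi1.
- by right; exists i1; rewrite ?opprK.
Qed.

(** Put S = 2m - rh^2. As L <= r <= rh, [trace_ge] yields both r^(2k-1) (rh^2 - S) <= C r^(2k) and
    r^(2k) (r - L) <= C r^(2k). The first bounds rh from above, the second L from below. *)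
Lemma spectral_structure (C : R) i0 : lam sp i0 = rh ->
  0 <= C -> C < r -> r <= rh -> tr k.*2.+1 <= C * m ^+ k ->
  exists i1, [/\ i1 != i0, rh <= r + C, - r <= lam sp i1, lam sp i1 <= C - r
    & \sum_(i | (i != i0) && (i != i1)) lam sp i ^+ 2 <= 2 * C * r].
Proof.
move=> h0 C0 Cr rrh trC.
have r0 : 0 < r by exact: le_lt_trans Cr.
have [L [L0 L2 trL hL]] := trace_ge h0.
have hk : k = k.-1.+1 by lia.
move: trC trL; rewrite hk; move: k.-1 => j; rewrite /= doubleS => trC trL.
have rr := sqr_r.
set S := 2 * m - rh ^+ 2 in L2 trL *.
have rh2 : r ^+ 2 <= rh ^+ 2 by apply: lerXn2r; rewrite ?nnegrE ?(ltW r0) ?(le_trans (ltW r0)).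
have Sm : S <= r ^+ 2 by rewrite /S; lra.
have S0 : 0 <= S by exact: le_trans (sqr_ge0 _) L2.
have Lr : L <= r.
  by rewrite -(@ler_pXn2r _ 2) ?nnegrE ?(ltW r0) // (le_trans L2).
have pr i : 0 < r ^+ i by exact: exprn_gt0.
have main : rh ^+ j.*2.+3 - L ^+ j.*2.+1 * S <= C * r ^+ j.*2.+2.
  have -> : r ^+ j.*2.+2 = m ^+ j.+1 by rewrite -doubleS -mul2n exprM rr.
  exact: le_trans trL trC.
have rhL i : r ^+ i <= rh ^+ i.
  by apply: lerXn2r; rewrite ?nnegrE ?(ltW r0) // (le_trans (ltW r0)).
have LrX i : L ^+ i <= r ^+ i by apply: lerXn2r; rewrite ?nnegrE ?(ltW r0).
have H1 : rh ^+ 2 - S <= C * r.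
  have e1 : r ^+ j.*2.+1 * (rh ^+ 2 - S) <= r ^+ j.*2.+1 * (C * r).
    have -> : r ^+ j.*2.+1 * (C * r) = C * r ^+ j.*2.+2.
      by rewrite [r ^+ j.*2.+2]exprSr; ring.
    have a1 : r ^+ j.*2.+1 * rh ^+ 2 <= rh ^+ j.*2.+3.
      by rewrite -[j.*2.+3]addn2 exprD; apply: ler_wpM2r; rewrite ?sqr_ge0.
    have a2 : L ^+ j.*2.+1 * S <= r ^+ j.*2.+1 * S by apply: ler_wpM2r.
    by apply: le_trans main; rewrite mulrBr; lra.
  by rewrite ler_pM2l in e1.
have rhC : rh <= r + C.
  have : 2 * (rh - r) * (rh + r) <= C * r by rewrite /S in H1; nra.
  move=> h; have : 2 * (rh - r) * (2 * r) <= C * r.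
    apply: le_trans h; apply: ler_wpM2l; last by lra.
    by rewrite mulr_ge0 // subr_ge0.
  move=> h'; have : (4 * (rh - r)) * r <= C * r by lra.
  by rewrite ler_pM2r // => h''; lra.
have H2 : r - C <= L.
  have e2 : r ^+ j.*2.+2 * (r - C) <= r ^+ j.*2.+2 * L.
    have : L ^+ j.*2.+1 * S <= r ^+ j.*2.+2 * L.
      have -> : r ^+ j.*2.+2 * L = (L * r ^+ j.*2) * r ^+ 2.
        by rewrite -addn2 exprD; ring.
      apply: ler_pM => //; first by rewrite exprn_ge0.
      by rewrite exprS; apply: ler_wpM2l.
    have -> : r ^+ j.*2.+2 * (r - C) = r ^+ j.*2.+3 - C * r ^+ j.*2.+2.
      by rewrite [r ^+ j.*2.+3]exprSr; ring.
    have := rhL j.*2.+3; lra.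
  by rewrite ler_pM2l in e2.
have L1 : L <> 0 by move=> L00; move: H2; rewrite L00; lra.
case: hL => [//|[i1 i10 hi1]]; exists i1; split=> //; rewrite ?hi1; try lra.
have := lam_sq_rest h0; rewrite (bigD1 i1) //= -/S => e.
suff : S - lam sp i1 ^+ 2 <= 2 * C * r by rewrite -e addrC addrK.
(* S <= r^2 and L >= r - C leave at most r^2 - (r - C)^2 <= 2 C r for the remaining squares. *)
rewrite hi1 sqrrN.
have : (r - C) ^+ 2 <= L ^+ 2 by apply: lerXn2r; rewrite ?nnegrE //; lra.
have -> : (r - C) ^+ 2 = r ^+ 2 - 2 * C * r + C ^+ 2 by ring.
have := sqr_ge0 C; lra.
Qed.

(** The two dominant eigenvalues nearly cancel: their sum is at most 2 C, so their odd powers add up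
    to O(m^b) instead of m^(b+1/2). For each other eigenvalue the weak bound 2 C r on its modulus
    suffices, since its square is already counted in [rest]. *)
Lemma odd_trace_le (C : R) i0 i1 b :
  lam sp i0 = rh -> 1 <= C -> 1 <= r -> r <= rh ->
  i1 != i0 -> rh <= r + C -> - r <= lam sp i1 -> lam sp i1 <= C - r -> C <= r ->
  \sum_(i | (i != i0) && (i != i1)) lam sp i ^+ 2 <= 2 * C * r ->
  (1 <= b)%N ->
  tr b.*2.+1 <= (b.*2.+1%:R * (2 * C) * 2 ^+ b + (2 * C) ^+ b.*2) * m ^+ b.
Proof.
move=> h0 C1 r1 rrh i10 rhC Lr LC Cr rest b1.
rewrite (trace_walk sp) (bigD1 i0) //= (bigD1 i1) //= h0 addrA mulrDl; apply: lerD.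
  have := @power_sub_le R rh (- lam sp i1) b.*2; rewrite exprNn.
  rewrite -signr_odd /= odd_double expr1 mulN1r opprK => /(_ _ _)/le_trans; apply; try lra.
  rewrite -mulrA -[leRHS]mulrA -[leRHS]mulrA; apply: ler_wpM2l => //.
  apply: ler_pM; try lra; first by rewrite exprn_ge0 // (rho_ge0 sp).
  rewrite -exprMn -muln2 mulnC exprM; apply: lerXn2r; rewrite ?nnegrE ?sqr_ge0 ?mulr_ge0 //.
  exact: rho_sq_le sp G0.
apply: (@le_trans _ _ (\sum_(i | (i != i0) && (i != i1))
   lam sp i ^+ 2 * (2 * C * r) ^+ b.-1.*2.+1)).
  apply: ler_sum => i hi.
  have -> : (b.*2.+1 = 2 + b.-1.*2.+1)%N by move: b1; clear; lia.
  rewrite exprD; apply: ler_wpM2l; first exact: sqr_ge0.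
  apply: le_trans (ler_norm _) _; rewrite normrX; apply: lerXn2r; rewrite ?nnegrE //.
    by rewrite !mulr_ge0 //; lra.
  have l2 : lam sp i ^+ 2 <= 2 * C * r.
    apply: le_trans rest; rewrite (bigD1 i) //= lerDl.
    by apply: sumr_ge0 => j _; exact: sqr_ge0.
  have Cr1 : 1 <= 2 * C * r by nra.
  rewrite -(@ler_pXn2r _ 2) ?nnegrE //; last by lra.
  by rewrite real_normK ?num_real // (le_trans l2) // expr2; nra.
rewrite -mulr_suml; apply: le_trans (ler_wpM2r _ rest) _.
  by rewrite exprn_ge0 // !mulr_ge0 //; lra.
rewrite -exprS; have -> : (b.-1.*2.+2 = b.*2)%N by move: b1; clear; lia.
by rewrite exprMn -[r ^+ _](_ : m ^+ b = _) // -mul2n exprM sqr_r.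
Qed.
End Structure.

(** * Codegrees from the two dominant eigenvectors *)

Section Codegree.
Variables (R : realType) (G : sgraph) (sp : spectrum R G).

Lemma wt_cauchy (P : pred 'I_#|G|) u v :
  \sum_(i | P i) wt sp i u * wt sp i v <= 1.
Proof.
apply: (@le_trans _ _ (\sum_i wt sp i u * wt sp i v)).
  rewrite [leRHS](bigID P) /= lerDl; apply: sumr_ge0 => i _.
  by rewrite mulr_ge0 ?wt_ge0.
apply: (@le_trans _ _ (\sum_i (wt sp i u ^+ 2 + wt sp i v ^+ 2) / 2)).
  apply: ler_sum => i _; rewrite ler_pdivlMr //.
  have := sqr_ge0 (wt sp i u - wt sp i v); rewrite sqrrB; lra.
by rewrite -mulr_suml big_split /= !wt_col; lra.
Qed.

Lemma wt_le1 i u : wt sp i u <= 1.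
Proof.
rewrite -(@ler_pXn2r _ 2) ?nnegrE ?wt_ge0 // expr1n -(wt_row sp i).
by rewrite (bigD1 u) //= lerDl sumr_ge0 // => v _; exact: sqr_ge0.
Qed.

(* Since [lam j] is close to [- lam i], adding [lam i] times A to A^2 doubles the
   contribution of [lam i] and almost cancels that of [lam j]. *)
Lemma codegree_estimate (C r q : R) i j u v :
  1 <= C -> 1 <= q -> r = q ^+ 2 ->
  j != i -> `|lam sp i| <= 2 * r -> `|lam sp j| <= 2 * r ->
  `|lam sp i + lam sp j| <= 2 * C ->
  \sum_(a | (a != i) && (a != j)) lam sp a ^+ 2 <= 2 * C * r ->
  `| (nwalk 2 u v)%:R - 2 * lam sp i ^+ 2 * (wt sp i u * wt sp i v) |
    <= 12 * C * q ^+ 3.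
Proof.
move=> C1 q1 rE ji li lj lij rest.
set l := lam sp i in li lij *; set l' := lam sp j in lj lij *.
have := walk_err sp i l u v; rewrite -/l.
set n2 := (nwalk 2 u v)%:R; set B := _ * (adj u v)%:R.
have -> : l ^+ 2 + l * l = 2 * l ^+ 2 by rewrite expr2; ring.
rewrite (@ger0_norm _ (2 * l ^+ 2)); last by apply: mulr_ge0 => //; exact: sqr_ge0.
set T := 2 * l ^+ 2 * _ => H.
have B2 : `|B| <= 2 * r.
  rewrite /B; case: (adj u v); rewrite ?mulr1 ?mulr0 ?normr0 //.
  by rewrite rE mulr_ge0 // sqr_ge0.
have n20 : 0 <= n2 by [].
have r1 : 1 <= r by rewrite rE expr_ge1 // (le_trans ler01).
have q3 : q ^+ 3 = q * r by rewrite rE exprS.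
have Cr0 : 0 <= C * r by apply: mulr_ge0; lra.
have qr0 : 0 <= q * r by apply: mulr_ge0; lra.
have rq : r <= q * r by rewrite ler_peMl //; lra.
suff : \sum_(a | a != i) `|lam sp a ^+ 2 + l * lam sp a| * (wt sp a u * wt sp a v)
    <= 10 * C * (q * r).
  move=> H2; have := le_trans H H2; rewrite q3.
  have rC : r <= C * (q * r) by rewrite (le_trans rq) // ler_peMl //; lra.
  have hd := ler_dist_dist (n2 + B) n2; rewrite [`|n2|]ger0_norm // in hd.
  have e : n2 + B - n2 = B by ring.
  rewrite e in hd; move: (le_trans hd B2).
  by rewrite !ler_norml => /andP[a1 a2] /andP[b1 b2]; apply/andP; split; lra.
rewrite (bigD1 j) //= -/l'.
have t1 : `|l' ^+ 2 + l * l'| * (wt sp j u * wt sp j v) <= 4 * C * r.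
  rewrite -[4 * C * r]mulr1; apply: ler_pM => //.
  - by rewrite mulr_ge0 ?wt_ge0.
  - have -> : l' ^+ 2 + l * l' = (l + l') * l' by ring.
    rewrite normrM; have -> : 4 * C * r = (2 * C) * (2 * r) by ring.
    exact: ler_pM.
  - by rewrite -[1]mulr1; apply: ler_pM; rewrite ?wt_ge0 ?wt_le1.
have t2 : \sum_(a | (a != i) && (a != j))
    `|lam sp a ^+ 2 + l * lam sp a| * (wt sp a u * wt sp a v) <= 2 * C * r + 4 * C * (q * r).
  apply: (@le_trans _ _ (\sum_(a | (a != i) && (a != j))
     (2 * C * r + 4 * C * (q * r)) * (wt sp a u * wt sp a v))).
    apply: ler_sum => a ha; apply: ler_wpM2r; first by rewrite mulr_ge0 ?wt_ge0.
    have l2 : lam sp a ^+ 2 <= 2 * C * r.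
      apply: le_trans rest; rewrite (bigD1 a) //= lerDl.
      by apply: sumr_ge0 => b _; exact: sqr_ge0.
    apply: le_trans (ler_normD _ _) _; apply: lerD.
      by rewrite ger0_norm // sqr_ge0.
    (* This bound, multiplied by [|l| <= 2 r] with r = q^2, is the source of the error term q^3. *)
    have la : `|lam sp a| <= 2 * C * q.
      rewrite -(@ler_pXn2r _ 2) ?nnegrE //; last by nra.
      rewrite real_normK ?num_real // (le_trans l2) // exprMn -rE.
      have : 0 <= (C * r) * (2 * C - 1) by rewrite mulr_ge0 //; lra.
      rewrite expr2; lra.
    rewrite normrM; have -> : 4 * C * (q * r) = (2 * r) * (2 * C * q) by ring.
    exact: ler_pM.
  rewrite -mulr_sumr -[leRHS]mulr1; apply: ler_wpM2l; last exact: wt_cauchy.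
  nra.
nra.
Qed.
End Codegree.

(** * The core of a graph with a vertex of large degree *)

Section Core.
Variables (R : realType) (G : sgraph).
Local Notation A u v := ((adj u v)%:R : R).
Local Notation m := ((nb_edges G)%:R : R).
Local Notation cod u v := ((nwalk 2 u v)%:R : R).

(** The degree of [w] is at least its codegree with [u0], so 2 P x_w^2 is at least about 2 P x_u0
    x_w. Once [x u0] is bounded below, every weight is thus O(1/q) or within O(1/q) of [x u0]. *)
Lemma weight_gap (x : G -> R) (P K q : R) u0 w :
  0 < q -> q ^+ 4 <= P -> 0 <= x w -> x w <= x u0 ->
  (forall u v, `|cod u v - 2 * P * (x u * x v)| <= K * q ^+ 3) ->
  q * (x w * (x u0 - x w)) <= K.
Proof.
move=> q0 qP xw xX H.
have := H u0 w; have := H w w; rewrite !ler_norml => /andP[_ h1] /andP[h2 _].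
have h3 : cod u0 w <= cod w w.
  by rewrite nwalk2_sym nwalk2_diag ler_nat nwalk2_le_deg.
have t0 : 0 <= x w * (x u0 - x w) by rewrite mulr_ge0 // subr_ge0.
have h4 : P * (x w * (x u0 - x w)) <= K * q ^+ 3 by lra.
have h5 := ler_wpM2r t0 qP.
have q3 : 0 < q ^+ 3 by rewrite exprn_gt0.
rewrite -(ler_pM2r q3).
by apply: le_trans h4; apply: le_trans h5; rewrite exprS; lra.
Qed.

(** By [weight_gap] the weights cluster near 0 and near [x u0]; cutting at half the maximum
    separates the two clusters. *)
Definition core (x : G -> R) (u0 : G) : {set G} := [set w | x u0 <= 2 * x w]%SET.

Definition core_nbrs (S : {set G}) : {set G} :=
  [set v | (v \notin S) && [forall u in S, adj u v]]%SET.

Lemma core_card (x : G -> R) u0 : (forall u, 0 <= x u) -> \sum_u x u ^+ 2 = 1 ->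
  #|core x u0|%:R * x u0 ^+ 2 <= 4.
Proof.
move=> x0 x1.
have : \sum_(u in core x u0) (x u0 / 2) ^+ 2 <= 1.
  rewrite -[leRHS]x1 [leRHS](bigID [in core x u0]) /= -[leLHS]addr0; apply: lerD.
    apply: ler_sum => u; rewrite inE => hu; apply: lerXn2r; rewrite ?nnegrE //.
      by rewrite divr_ge0.
    by rewrite ler_pdivrMr //; lra.
  by apply: sumr_ge0 => u _; exact: sqr_ge0.
rewrite sumr_const expr_div_n -[_ *+ _]mulr_natl; lra.
Qed.

(** A neighbour of [u0] outside S that is no common neighbour misses some [w] in S, and is therefore
    counted in deg u0 - cod u0 w. *)
Lemma core_nbrs_card (S : {set G}) u0 :
  (deg u0)%:R <= #|core_nbrs S|%:R + #|S|%:R +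
     \sum_(w in S) ((deg u0)%:R - cod u0 w).
Proof.
have e : \sum_(w in S) ((deg u0)%:R - cod u0 w) =
    \sum_v \sum_(w in S) (A u0 v - A u0 v * A v w).
  rewrite exchange_big /=; apply: eq_bigr => w _.
  rewrite sumrB /deg nwalk2 !natr_sum; congr (_ - _).
  by apply: eq_bigr => v _; rewrite natrM.
rewrite e /deg natr_sum -!sum1_card !natr_sum.
rewrite (big_mkcond [in core_nbrs S]) (big_mkcond [in S] (fun _ => 1)) /=.
rewrite -!big_split /=; apply: ler_sum => v _.
have T0 (w : G) : 0 <= A u0 v - A u0 v * A v w.
  by case: (adj u0 v); case: (adj v w); rewrite ?mulr1 ?mulr0 ?subr0 ?subrr.
have [vS|vS] := boolP (v \in S).
  rewrite (_ : v \in core_nbrs S = false); last by rewrite inE vS.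
  rewrite add0r -[leLHS]addr0; apply: lerD; first by case: (adj _ _).
  by apply: sumr_ge0.
rewrite addr0; have [vF|] := boolP (v \in core_nbrs S).
  rewrite -[leLHS]addr0; apply: lerD; first by case: (adj _ _).
  by apply: sumr_ge0.
rewrite inE vS /= => /forall_inPn[w wS nwv]; rewrite add0r (bigD1 w) //=.
rewrite [adj v w]adj_sym (negbTE nwv) mulr0 subr0 lerDl.
by apply: sumr_ge0.
Qed.

Lemma weight_square (x : G -> R) (rh : R) :
  (forall u, \sum_v A u v * x v = rh * x u) ->
  forall u, rh ^+ 2 * x u = \sum_w cod u w * x w.
Proof.
move=> H u.
transitivity (\sum_v A u v * (\sum_w A v w * x w)).
  under eq_bigr => v _ do rewrite H mulrCA.
  by rewrite -mulr_sumr H mulrA expr2.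
under eq_bigr => v _ do rewrite mulr_sumr.
rewrite exchange_big /=; apply: eq_bigr => w _.
rewrite nwalk2 natr_sum mulr_suml; apply: eq_bigr => v _.
by rewrite natrM mulrA.
Qed.

Lemma cod_sum (u : G) : \sum_w cod u w <= 2 * m.
Proof.
rewrite -natr_sum; have -> : 2 * m = (\sum_(v : G) deg v)%N%:R.
  by rewrite deg_sum -muln2 natrM mulrC.
rewrite ler_nat; under eq_bigr => w _ do rewrite nwalk2.
rewrite exchange_big /=; apply: leq_sum => v _; rewrite -big_distrr /=.
by case: (adj u v); rewrite ?mul1n.
Qed.

Lemma degree_sum_real : \sum_(u : G) \sum_v A u v = 2 * m.
Proof.
have -> : 2 * m = (\sum_(v : G) deg v)%N%:R.
  by rewrite deg_sum -muln2 natrM mulrC.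
by rewrite natr_sum; apply: eq_bigr => u _; rewrite natr_sum.
Qed.

Lemma outside_edges (S : {set G}) :
  \sum_(u | u \notin S) \sum_(v | v \notin S) A u v
    <= 2 * m - 2 * (#|S|%:R * #|core_nbrs S|%:R).
Proof.
have low : #|S|%:R * #|core_nbrs S|%:R <= \sum_(u in S) \sum_(v | v \notin S) A u v.
  rewrite mulr_natl -sumr_const; apply: ler_sum => u uS.
  rewrite -sum1_card natr_sum big_mkcond [leRHS]big_mkcond /=.
  apply: ler_sum => v _; rewrite inE.
  have [vS|vS] /= := boolP (v \in S) => //.
  by case: ifP => [/forall_inP/(_ u uS) -> //|_]; case: (adj _ _).
have sym : \sum_(u | u \notin S) \sum_(v in S) A u v =
    \sum_(u in S) \sum_(v | v \notin S) A u v.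
  rewrite exchange_big /=; apply: eq_bigr => u _; apply: eq_bigr => v _.
  by rewrite adj_sym.
have := degree_sum_real; rewrite (bigID [in S]) /=.
under eq_bigr => u _ do rewrite (bigID [in S]) /=.
under [X in _ + X = _]eq_bigr => u _ do rewrite (bigID [in S]) /=.
rewrite !big_split /= sym.
have : 0 <= \sum_(i in S) \sum_(j in S) A i j.
  by apply: sumr_ge0 => u _; apply: sumr_ge0.
lra.
Qed.
End Core.

(** In the application [x] is the Perron vector, [y] holds the weights of the other dominant
    eigenvalue, [Q] is the square of that eigenvalue, and [q] is m^(1/4). What matters is that [K2]
    and [q0] depend on [K] and [b] only. *)
Lemma core_exists (R : realType) (K b : R) : 1 <= K -> 0 < b -> b <= 1 ->
  exists K2 q0 : R, [/\ 0 <= K2, 1 <= q0 &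
  forall (G : sgraph) (x y : G -> R) (Q rh q : R) (u0 : G),
    q0 <= q -> (forall u, 0 <= x u) -> (forall u, 0 <= y u) ->
    \sum_u x u ^+ 2 = 1 ->
    (forall u, \sum_v (adj u v)%:R * x v = rh * x u) ->
    (forall v, x v <= x u0) -> b <= x u0 ->
    q ^+ 4 = (nb_edges G)%:R -> q ^+ 2 <= rh -> rh ^+ 2 <= 2 * q ^+ 4 ->
    q ^+ 4 <= 4 * Q -> Q <= q ^+ 4 ->
    (forall u v, `|(nwalk 2 u v)%:R - 2 * rh ^+ 2 * (x u * x v)| <= K * q ^+ 3) ->
    (forall u v, `|(nwalk 2 u v)%:R - 2 * Q * (y u * y v)| <= K * q ^+ 3) ->
    (forall v, (deg v)%:R <= rh ^+ 2 * x v ^+ 2 + Q * y v ^+ 2 + K * q ^+ 2) ->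
    let S := core x u0 in
    [/\ #|S|%:R * b ^+ 2 <= 4,
        q ^+ 4 - K2 * q ^+ 3 <= #|S|%:R * #|core_nbrs S|%:R
      & forall w w', w \notin S -> w' \notin S ->
          2 * rh * (x w * x w') <= b ^+ 2]].
Proof.
move=> K1' b0 b1.
pose sm := 4 / b ^+ 2; pose K1 := 2 * K / b; pose K3 := 40 * K / b.
pose K2 := sm * K + 2 * K1 / b + 12 * sm ^+ 2 * K.
pose K4 := 2 * K1 ^+ 2 + K3 ^+ 2 + K.
pose K6 := 2 * sm + sm * K4 + 2 * K1 * K2.
have K0 : 0 < K by lra.
have b20 : 0 < b ^+ 2 by rewrite exprn_gt0.
have sm0 : 0 <= sm by rewrite divr_ge0 // ltW.
have K10 : 0 <= K1 by rewrite /K1 divr_ge0 ?mulr_ge0 // ltW.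
have K30 : 0 <= K3 by rewrite /K3 divr_ge0 ?mulr_ge0 // ltW.
have K20 : 0 <= K2.
  have k1 : 0 <= sm * K by apply: mulr_ge0 => //; exact: ltW.
  have k2 : 0 <= 2 * K1 / b by apply: divr_ge0; [apply: mulr_ge0|exact: ltW].
  have k3 : 0 <= sm ^+ 2 * K by apply: mulr_ge0; [exact: exprn_ge0|exact: ltW].
  by rewrite /K2; lra.
have K40 : 0 <= K4.
  by have := sqr_ge0 K1; have := sqr_ge0 K3; rewrite /K4; lra.
have K60 : 0 <= K6.
  have k1 : 0 <= sm * K4 by rewrite mulr_ge0.
  have k2 : 0 <= K1 * K2 by rewrite mulr_ge0.
  by rewrite /K6; lra.
have bK1 : K1 * b = 2 * K by rewrite /K1 divfK // gt_eqF.
have bK3 : K3 * b = 40 * K by rewrite /K3 divfK // gt_eqF.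
exists K2, (1 + 2 * K / b ^+ 2 + 2 * K6 / b).
have hq1 : 0 <= 2 * K / b ^+ 2 by rewrite divr_ge0 ?mulr_ge0 // ltW.
have hq2 : 0 <= 2 * K6 / b by apply: divr_ge0; [apply: mulr_ge0|exact: ltW].
split=> //; first by lra.
move=> G x y Q rh q u0 q0q x0 y0 x1 Hx xmax bX qm qrh rhq qQ Qq H2 H3 H4 S.
have q1 : 1 <= q by lra.
have qp : 0 < q by lra.
have qb2 : 2 * K <= q * b ^+ 2 by rewrite -ler_pdivrMr //; lra.
have qb : 2 * K6 <= q * b by rewrite -ler_pdivrMr //; lra.
pose X := x u0; pose s : R := #|S|%:R; pose P := rh ^+ 2.
have X0 : 0 < X by exact: lt_le_trans bX.
have rh0 : 0 <= rh by rewrite (le_trans _ qrh) // sqr_ge0.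
have qP : q ^+ 4 <= P.
  rewrite /P (_ : q ^+ 4 = (q ^+ 2) ^+ 2); last by rewrite -exprM.
  by apply: lerXn2r; rewrite ?nnegrE ?(ltW (exprn_gt0 2 qp)).
have P0 : 0 <= P by exact: sqr_ge0.
have q20 : 0 < q ^+ 2 by exact: exprn_gt0.
have q30 : 0 < q ^+ 3 by exact: exprn_gt0.
have q40 : 0 < q ^+ 4 by exact: exprn_gt0.
have q31 : 1 <= q ^+ 3 by rewrite expr_ge1 // ltW.
have q43 : q ^+ 4 = q * q ^+ 3 by rewrite exprS.
have q42 : q ^+ 4 = q ^+ 2 * q ^+ 2 by rewrite -exprD.
have gap w : q * (x w * (X - x w)) <= K by apply: (weight_gap (P := P)).
have codx u v : (nwalk 2 u v)%:R <= 2 * P * (x u * x v) + K * q ^+ 3.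
  by have := H2 u v; rewrite ler_norml => /andP[_]; rewrite -/P; clear; lra.
have codx' u v : 2 * P * (x u * x v) - K * q ^+ 3 <= (nwalk 2 u v)%:R.
  by have := H2 u v; rewrite ler_norml => /andP[+ _]; rewrite -/P; clear; lra.
have u0S : u0 \in S by rewrite inE -/X; move: X0; clear; lra.
have s1 : 1 <= s by rewrite ler1n; apply/card_gt0P; exists u0.
have sb : s * b ^+ 2 <= 4.
  apply: le_trans (core_card u0 x0 x1); apply: ler_wpM2l => //.
  by apply: lerXn2r; rewrite ?nnegrE // ltW.
have ssm : s <= sm by rewrite /sm ler_pdivlMr.
have A1X w : w \notin S -> q * (X * x w) <= 2 * K.
  rewrite inE -ltNge -/X => hw; have h := gap w.
  have : x w * X <= 2 * (x w * (X - x w)).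
    have : 0 <= x w * (X - 2 * x w) by rewrite mulr_ge0 // subr_ge0 ltW.
    by clear; lra.
  by move=> /(ler_wpM2l (ltW qp)); move: h; clear; lra.
have A1 w : w \notin S -> q * x w <= K1.
  move=> /A1X h; rewrite -(ler_pM2r b0) bK1; apply: le_trans h.
  rewrite [X * _]mulrC mulrA; apply: ler_wpM2l => //.
  by rewrite mulr_ge0 // ltW.
have A2 w : w \in S -> q * (X * (X - x w)) <= 2 * K.
  rewrite inE -/X => hw; have h := gap w.
  have : X * (X - x w) <= 2 * (x w * (X - x w)).
    have : 0 <= (X - x w) * (2 * x w - X) by rewrite mulr_ge0 // subr_ge0 // xmax.
    by clear; lra.
  by move=> /(ler_wpM2l (ltW qp)); move: h; clear; lra.
have PqK t : 0 <= t -> q * t <= 2 * K -> P * t <= 4 * K * q ^+ 3.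
  move=> t0 ht; rewrite -(ler_pM2l qp).
  apply: le_trans (_ : P * (2 * K) <= _).
    by rewrite mulrCA; apply: ler_wpM2l.
  apply: le_trans (_ : 2 * q ^+ 4 * (2 * K) <= _).
    by apply: ler_wpM2r => //; rewrite mulr_ge0 // ltW.
  by rewrite q43; clear; lra.
have dX : (deg u0)%:R <= 2 * P * (X * X) + K * q ^+ 3.
  by rewrite -nwalk2_diag codx.
have dX' : 2 * P * (X * X) - K * q ^+ 3 <= (deg u0)%:R.
  by rewrite -nwalk2_diag codx'.
have A3 w : w \in S -> (deg u0)%:R - (nwalk 2 u0 w)%:R <= 10 * K * q ^+ 3.
  move=> wS; have h := codx' u0 w; rewrite -/X in h.
  have := PqK (X * (X - x w)) _ (A2 _ wS); rewrite mulr_ge0 ?subr_ge0 ?xmax ?(ltW X0) //.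
  by move=> /(_ isT); move: h dX; clear; lra.
have KsQ : 0 < K * q ^+ 3 by rewrite mulr_gt0.
have A4 : 2 * P * (X * X) - 12 * s * K * q ^+ 3 <= #|core_nbrs S|%:R.
  have h := core_nbrs_card R S u0.
  have h2 : \sum_(w in S) ((deg u0)%:R - (nwalk 2 u0 w)%:R) <= s * (10 * K * q ^+ 3).
    by apply: le_trans (ler_sum _ A3) _; rewrite sumr_const /s [leRHS]mulr_natl.
  have h3 : s * 1 <= s * (K * q ^+ 3).
    by apply: ler_wpM2l => //; exact: mulr_ege1.
  have h4 : 1 * (K * q ^+ 3) <= s * (K * q ^+ 3) by apply: ler_wpM2r => //; exact: ltW.
  by rewrite -/s in h; move: h h2 h3 h4 dX'; clear; lra.
(* The equation A^2 x = rh^2 x is read at [u0]. Each core vertex contributes at most about 2 P X^2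
   times X; the others have weight O(1/q) and total codegree at most 2m. With [A4] this gives s |T|
   >= rh^2 - O(q^3). *)
have A5 : P <= s * (2 * P * (X * X) + K * q ^+ 3) + 2 * K1 / b * q ^+ 3.
  have hP := weight_square Hx u0; rewrite (bigID [in S]) /= -/P -/X in hP.
  have h1 : \sum_(w in S) (nwalk 2 u0 w)%:R * x w <=
      s * (2 * P * (X * X) + K * q ^+ 3) * X.
    rewrite -[leRHS]mulrA /s [leRHS]mulr_natl -sumr_const; apply: ler_sum => w wS.
    apply: ler_pM => //.
    apply: le_trans (codx u0 w) _; rewrite lerD2r; apply: ler_wpM2l.
      by apply: mulr_ge0.
    by apply: ler_wpM2l; [exact: ltW|exact: xmax].
  have h2 : \sum_(w | w \notin S) (nwalk 2 u0 w)%:R * x w <= 2 * K1 * q ^+ 3.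
    apply: le_trans (_ : \sum_w (nwalk 2 u0 w)%:R * (K1 / q) <= _).
      rewrite [leRHS](bigID [in S]) /= -[leLHS]add0r; apply: lerD.
        by apply: sumr_ge0 => w _; rewrite mulr_ge0 // divr_ge0 // ltW.
      apply: ler_sum => w wS; apply: ler_wpM2l => //.
      by rewrite ler_pdivlMr // mulrC A1.
    rewrite -mulr_suml; apply: le_trans (ler_wpM2r _ (cod_sum R u0)) _.
      by rewrite divr_ge0 // ltW.
    have -> : 2 * (nb_edges G)%:R * (K1 / q) = 2 * K1 * q ^+ 3 * (q / q).
      by rewrite -qm q43; ring.
    by rewrite divff ?mulr1 // gt_eqF.
  rewrite -lerBlDl -(ler_pM2r b0) [leRHS]mulrAC divfK ?gt_eqF //.
  set Z := P - _.
  have ZX : Z * X <= 2 * K1 * q ^+ 3 by rewrite /Z; move: hP h1 h2; clear; lra.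
  have [Z0|Z0] := leP Z 0.
    apply: (@le_trans _ _ 0); first by rewrite mulr_le0_ge0 // ltW.
    by apply: mulr_ge0; [apply: mulr_ge0|exact: ltW].
  by apply: le_trans ZX; apply: ler_wpM2l => //; exact: ltW.
have A6 : q ^+ 4 - K2 * q ^+ 3 <= s * #|core_nbrs S|%:R.
  have h := ler_wpM2l (le_trans ler01 s1) A4.
  have h1 : s * (K * q ^+ 3) <= sm * (K * q ^+ 3) by apply: ler_wpM2r => //; exact: ltW.
  have h2 : s * s * (K * q ^+ 3) <= sm ^+ 2 * (K * q ^+ 3).
    by apply: ler_wpM2r; [exact: ltW|rewrite expr2; apply: ler_pM => //; lra].
  by rewrite /K2; move: h h1 h2 A5 qP; clear; lra.
(* The codegree estimate at (w, w) would leave an error of order q^3, too large for [A9]. The error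
   in [H4] is only q^2, but it involves [y], which has to be shown small outside the core as well:
   [u0] has small codegree with [w], while [y u0] is bounded below because [u0] has large degree. *)
have A7 w : w \notin S -> (deg w)%:R <= K4 * q ^+ 2.
  move=> wS.
  have c9 : (nwalk 2 u0 w)%:R <= 9 * K * q ^+ 3.
    have := codx u0 w; rewrite -/X.
    have := PqK (X * x w) _ (A1X _ wS); rewrite mulr_ge0 ?(ltW X0) //.
    by move=> /(_ isT); clear; lra.
  have cy : 2 * Q * (y u0 * y w) <= 10 * K * q ^+ 3.
    by have := H3 u0 w; rewrite ler_norml => /andP[+ _]; move: c9; clear; lra.
  have y0b : b / 2 <= y u0.
    have dy : (deg u0)%:R <= 2 * Q * (y u0 * y u0) + K * q ^+ 3.
      by have := H3 u0 u0; rewrite nwalk2_diag ler_norml => /andP[_]; clear; lra.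
    have e1 : q ^+ 4 * b ^+ 2 <= P * (X * X).
      apply: ler_pM => //; [exact: ltW|exact: ltW|].
      by rewrite -expr2; apply: lerXn2r; rewrite ?nnegrE ?(ltW b0) ?(ltW X0).
    have e2 : 2 * K * q ^+ 3 <= q ^+ 4 * b ^+ 2.
      by rewrite q43 [leRHS]mulrAC; apply: ler_wpM2r => //; exact: ltW.
    have e3 : Q * (y u0 * y u0) <= q ^+ 4 * (y u0 * y u0).
      by apply: ler_wpM2r => //; rewrite mulr_ge0.
    have e4 : q ^+ 4 * b ^+ 2 <= q ^+ 4 * (2 * (y u0 * y u0)).
      by move: dy dX' e1 e2 e3; clear; lra.
    rewrite ler_pM2l // in e4.
    rewrite -(@ler_pXn2r _ 2) ?nnegrE ?divr_ge0 // ?(ltW b0) //.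
    by rewrite expr_div_n ler_pdivrMr ?exprn_gt0 //; move: e4 (sqr_ge0 (y u0)); clear; lra.
  have A7y : q * y w <= K3.
    rewrite -(ler_pM2r b0) bK3 -(ler_pM2r q30).
    have e1 : q ^+ 4 * (b / 2 * y w) <= 4 * Q * (y u0 * y w).
      apply: ler_pM => //; first exact: ltW.
        by rewrite mulr_ge0 // divr_ge0 // ltW.
      exact: ler_wpM2r.
    by rewrite q43 in e1; move: e1 cy; clear; lra.
  have A7x := A1 _ wS.
  have x2 : (q * x w) ^+ 2 <= K1 ^+ 2.
    by apply: lerXn2r; rewrite ?nnegrE // mulr_ge0 // ltW.
  have y2 : (q * y w) ^+ 2 <= K3 ^+ 2.
    by apply: lerXn2r; rewrite ?nnegrE // mulr_ge0 // ltW.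
  apply: le_trans (H4 w) _.
  have e1 : rh ^+ 2 * x w ^+ 2 <= q ^+ 2 * (2 * K1 ^+ 2).
    apply: le_trans (_ : 2 * q ^+ 4 * x w ^+ 2 <= _).
      by apply: ler_wpM2r => //; exact: sqr_ge0.
    rewrite q42; have -> : 2 * (q ^+ 2 * q ^+ 2) * x w ^+ 2 =
      q ^+ 2 * (2 * (q * x w) ^+ 2) by ring.
    by apply: ler_wpM2l; [exact: ltW|move: x2; clear; lra].
  have e2 : Q * y w ^+ 2 <= q ^+ 2 * K3 ^+ 2.
    apply: le_trans (_ : q ^+ 4 * y w ^+ 2 <= _).
      by apply: ler_wpM2r => //; exact: sqr_ge0.
    rewrite q42 -mulrA -exprMn.
    by apply: ler_wpM2l => //; exact: ltW.
  by rewrite /K4; move: e1 e2; clear; lra.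
have A8 : \sum_(u | u \notin S) \sum_(v | v \notin S) (adj u v)%:R <= 2 * K2 * q ^+ 3.
  by have := outside_edges R S; rewrite -qm -/s; move: A6; clear; lra.
have xle1 w : x w <= 1.
  rewrite -(@ler_pXn2r _ 2) ?nnegrE // expr1n -[leRHS]x1.
  by rewrite (bigD1 w) //= lerDl sumr_ge0 // => v _; exact: sqr_ge0.
have rh2q : rh <= 2 * q ^+ 2.
  have q2n : 0 <= 2 * q ^+ 2 by rewrite mulr_ge0 // ltW.
  rewrite -(@ler_pXn2r _ 2) ?nnegrE //.
  by rewrite exprMn -exprM /=; move: rhq q40; clear; lra.
have xS u : \sum_(v in S) (adj u v)%:R * x v <= s.
  rewrite /s -[leRHS]mulr1 [leRHS]mulr_natl -sumr_const; apply: ler_sum => v _.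
  by case: (adj u v); rewrite ?mul1r ?mul0r.
(* The bound O(1/q) of [A1] would make rh x_w x_w' merely bounded. Expanding rh^2 x_w over two steps
   gains a factor q: neighbours in S contribute O(q^2), and those outside are controlled by the
   degree bound [A7] and by the O(q^3) outside edges of [A8]. *)
have A9 w : w \notin S -> q ^+ 2 * x w <= K6.
  move=> wS.
  have e : rh * (rh * x w) = \sum_(v in S) (adj w v)%:R * (rh * x v)
      + \sum_(v | v \notin S) (adj w v)%:R * (rh * x v).
    rewrite -Hx mulr_sumr (bigID [in S]) /=.
    by congr (_ + _); apply: eq_bigr => v _; rewrite mulrCA.
  have e1 : \sum_(v in S) (adj w v)%:R * (rh * x v) <= 2 * q ^+ 2 * sm.
    under eq_bigr => v _ do rewrite mulrCA.
    rewrite -mulr_sumr; apply: ler_pM => //.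
      by apply: sumr_ge0 => v _; rewrite mulr_ge0.
    exact: le_trans (xS w) ssm.
  have e2 v : v \notin S -> rh * x v <= sm +
      K1 / q * \sum_(z | z \notin S) (adj v z)%:R.
    move=> vS; rewrite -Hx (bigID [in S]) /=; apply: lerD.
      exact: le_trans (xS v) ssm.
    rewrite mulr_sumr; apply: ler_sum => z zS; rewrite [leRHS]mulrC.
    apply: ler_wpM2l => //; by rewrite ler_pdivlMr // mulrC A1.
  have e3 : \sum_(v | v \notin S) (adj w v)%:R * (rh * x v) <=
      sm * (K4 * q ^+ 2) + 2 * K1 * K2 * q ^+ 2.
    apply: (@le_trans _ _ (\sum_(v | v \notin S) ((adj w v)%:R * sm +
       K1 / q * \sum_(z | z \notin S) (adj v z)%:R))).
      apply: ler_sum => v vS.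
      apply: le_trans (ler_wpM2l _ (e2 v vS)) _ => //.
      rewrite mulrDr lerD2l; apply: ler_piMl; last by case: (adj _ _).
      by apply: mulr_ge0; [apply: divr_ge0 => //; exact: ltW|exact: sumr_ge0].
    rewrite big_split /=; apply: lerD.
      rewrite -mulr_suml mulrC; apply: ler_wpM2l => //.
      apply: le_trans (A7 w wS); rewrite /deg natr_sum [leRHS](bigID [in S]) /=.
      by rewrite lerDr sumr_ge0.
    rewrite -mulr_sumr; apply: le_trans (ler_wpM2l _ A8) _.
      by rewrite divr_ge0 // ltW.
    have -> : K1 / q * (2 * K2 * q ^+ 3) = 2 * K1 * K2 * q ^+ 2 * (q / q).
      by rewrite exprS; ring.
    by rewrite divff ?mulr1 // gt_eqF.
  rewrite -(ler_pM2l q20).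
  apply: le_trans (_ : rh * (rh * x w) <= _).
    rewrite [leLHS](_ : _ = q ^+ 4 * x w); last by rewrite q42; ring.
    rewrite [leRHS](_ : _ = rh ^+ 2 * x w); last by ring.
    exact: ler_wpM2r.
  by rewrite e /K6; move: e1 e3; clear; lra.
split=> // w w' wS wS'.
rewrite -(ler_pM2l q40).
have e1 : (q ^+ 2 * x w) * (q ^+ 2 * x w') <= K6 ^+ 2.
  by rewrite expr2; apply: ler_pM; rewrite ?A9 // mulr_ge0 // ltW.
have e2 : 4 * K6 ^+ 2 <= q ^+ 2 * b ^+ 2.
  rewrite -exprMn (_ : 4 * K6 ^+ 2 = (2 * K6) ^+ 2); last by ring.
  by apply: lerXn2r; rewrite ?nnegrE // mulr_ge0 // ltW.
have e3 := ler_pM rh0 (mulr_ge0 (mulr_ge0 (ltW q20) (x0 w)) (mulr_ge0 (ltW q20) (x0 w'))) rh2q e1.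
have e4 := ler_wpM2l (ltW q20) e2.
by rewrite q42; move: e3 e4; clear; lra.
Qed.

Lemma cauchy_schwarz (R : realDomainType) (I : finType) (P : pred I) (a x : I -> R) :
  (\sum_(i | P i) a i * x i) ^+ 2 <=
    (\sum_(i | P i) a i ^+ 2) * (\sum_(i | P i) x i ^+ 2).
Proof.
(* Lagrange's identity. *)
have e : \sum_(i | P i) \sum_(j | P j) (a i * x j - a j * x i) ^+ 2 =
    2 * ((\sum_(i | P i) a i ^+ 2) * (\sum_(i | P i) x i ^+ 2)
         - (\sum_(i | P i) a i * x i) ^+ 2).
  have e1 : \sum_(i | P i) \sum_(j | P j) a i ^+ 2 * x j ^+ 2 =
      (\sum_(i | P i) a i ^+ 2) * (\sum_(i | P i) x i ^+ 2).
    by rewrite mulr_suml; apply: eq_bigr => i _; rewrite mulr_sumr.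
  have e2 : \sum_(i | P i) \sum_(j | P j) (a i * x i) * (a j * x j) =
      (\sum_(i | P i) a i * x i) ^+ 2.
    by rewrite expr2 mulr_suml; apply: eq_bigr => i _; rewrite mulr_sumr.
  transitivity (\sum_(i | P i) \sum_(j | P j) a i ^+ 2 * x j ^+ 2 +
      \sum_(i | P i) \sum_(j | P j) a j ^+ 2 * x i ^+ 2
      - 2 * \sum_(i | P i) \sum_(j | P j) (a i * x i) * (a j * x j)).
    rewrite mulr_sumr -big_split -sumrB /=; apply: eq_bigr => i _.
    rewrite mulr_sumr -big_split -sumrB /=; apply: eq_bigr => j _.
    by ring.
  rewrite [X in _ + X - _]exchange_big /= e1 e2; ring.
have : 0 <= \sum_(i | P i) \sum_(j | P j) (a i * x j - a j * x i) ^+ 2.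
  by apply: sumr_ge0 => i _; apply: sumr_ge0 => j _; exact: sqr_ge0.
by rewrite e pmulr_rge0 // subr_ge0.
Qed.

(** * The eigenvalue equation on the core *)

Section Inequality.
Variables (R : realType) (G : sgraph).
Local Notation A u v := ((adj u v)%:R : R).
Local Notation m := ((nb_edges G)%:R : R).

(* Apply A twice to [x] restricted to [S].  A vertex [w] outside [S] contributes
   the square of the weight of its neighbours in [S], at most its degree into
   [S] times [a] by Cauchy-Schwarz, and exactly [sg ^+ 2] if [w] is a common
   neighbour. *)
Lemma core_ineq (x : G -> R) (rh : R) (S : {set G}) :
  0 <= rh -> (forall u, 0 <= x u) ->
  (forall u, \sum_v A u v * x v = rh * x u) ->
  let a := \sum_(u in S) x u ^+ 2 in
  let sg := \sum_(u in S) x u in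
  let D := \sum_(u in S) \sum_(v in S) A u v in
  (forall w w', w \notin S -> w' \notin S -> 2 * rh * (x w * x w') <= a) ->
  (rh ^+ 2 - m + D / 2) * a <=
    rh * (\sum_(u in S) \sum_(v in S) A u v * (x u * x v))
    - #|core_nbrs S|%:R * (#|S|%:R * a - sg ^+ 2).
Proof.
move=> rh0 x0 Hx a sg D hW.
pose z w := \sum_(u in S) A w u * x u.
pose t w := \sum_(u | u \notin S) A w u * x u.
pose d w : R := \sum_(u in S) A w u.
pose EW : R := \sum_(u | u \notin S) \sum_(v | v \notin S) A u v.
have zt w : rh * x w = z w + t w by rewrite -Hx (bigID [in S]).
have e2m : 2 * m = D + 2 * (\sum_(w | w \notin S) d w) + EW.
  have sym : \sum_(u in S) \sum_(v | v \notin S) A u v =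
      \sum_(w | w \notin S) d w.
    rewrite exchange_big /=; apply: eq_bigr => u _; apply: eq_bigr => v _.
    by rewrite adj_sym.
  rewrite -(degree_sum_real R G) (bigID [in S]) /=.
  under eq_bigr => u _ do rewrite (bigID [in S]) /=.
  under [X in _ + X = _]eq_bigr => u _ do rewrite (bigID [in S]) /=.
  rewrite !big_split /= sym -/D -/EW /d; ring.
have main : rh ^+ 2 * a = rh * (\sum_(u in S) \sum_(v in S) A u v * (x u * x v))
    + \sum_(w | w \notin S) z w ^+ 2 + \sum_(w | w \notin S) t w * z w.
  have -> : rh ^+ 2 * a = \sum_(u in S) (rh * x u) * (z u + t u).
    rewrite mulr_sumr; apply: eq_bigr => u _; rewrite -zt; ring.
  under eq_bigr => u _ do rewrite mulrDr.
  rewrite big_split /= -addrA; congr (_ + _).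
    rewrite mulr_sumr; apply: eq_bigr => u _.
    rewrite !mulr_sumr; apply: eq_bigr => v _; ring.
  rewrite -big_split /=.
  transitivity (\sum_(u in S) \sum_(w | w \notin S) A w u * x u * (rh * x w)).
    apply: eq_bigr => u _; rewrite mulr_sumr; apply: eq_bigr => w _.
    by rewrite adj_sym; ring.
  rewrite exchange_big /=; apply: eq_bigr => w _.
  rewrite -mulr_suml -/(z w) zt; ring.
have a0 : 0 <= a by apply: sumr_ge0 => u _; exact: sqr_ge0.
(* An ordered pair of adjacent vertices outside S counts 1/2 in m, and by [hW] it contributes at
   most a / 2 here. These edges therefore leave no error term. *)
have tz : \sum_(w | w \notin S) t w * z w <= EW / 2 * a.
  apply: (@le_trans _ _ (\sum_(w | w \notin S) t w * (rh * x w))).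
    apply: ler_sum => w _; rewrite zt mulrDr lerDl.
    by rewrite -expr2 sqr_ge0.
  rewrite /EW !mulr_suml; apply: ler_sum => w wS.
  rewrite !mulr_suml; apply: ler_sum => v vS.
  have := hW w v wS vS; case: (adj w v); rewrite ?mul1r ?mul0r; lra.
have z2 : \sum_(w | w \notin S) z w ^+ 2 <= a * (\sum_(w | w \notin S) d w)
    - #|core_nbrs S|%:R * (#|S|%:R * a - sg ^+ 2).
  rewrite mulr_natl -sumr_const [X in _ - X]big_mkcond.
  rewrite [X in _ - X](bigID [in S]) /= [X in _ - (X + _)]big1 ?add0r; last first.
    by move=> w wS; rewrite inE wS.
  rewrite mulr_sumr -sumrB; apply: ler_sum => w wS.
  have cs : z w ^+ 2 <= a * d w.
    have := cauchy_schwarz [in S] (fun u => A w u) x.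
    rewrite mulrC; congr (_ <= _ * _); apply: eq_bigr => u _.
    by case: (adj w u); rewrite ?expr1n ?expr0n.
  rewrite inE wS /=; case: ifP => [/forall_inP hF|_]; last by rewrite subr0.
  have Aw u : u \in S -> A w u = 1 by move=> uS; rewrite adj_sym hF.
  have -> : z w = sg.
    by apply: eq_bigr => u uS; rewrite Aw ?mul1r.
  have -> : d w = #|S|%:R.
    rewrite -sum1_card natr_sum; apply: eq_bigr => u uS; exact: Aw.
  by rewrite opprB addrC mulrC subrK.
have -> : (rh ^+ 2 - m + D / 2) * a = rh ^+ 2 * a - (2 * m) / 2 * a + D / 2 * a by field.
rewrite main e2m; lra.
Qed.

(** Write x = c + eps on S, with c the mean weight. Irregular degrees enter linearly, through 2 c rh
    V1, while the common neighbours penalise the variance of [x] by M E. Completing the square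
    leaves only the spread of the degrees. *)
Lemma spread_ineq (x : G -> R) (rh K M : R) (S : {set G}) :
  0 <= rh -> (forall u, 0 <= x u) -> (exists2 u, u \in S & 0 < x u) ->
  let s : R := #|S|%:R in
  let a := \sum_(u in S) x u ^+ 2 in
  let sg := \sum_(u in S) x u in
  let d u : R := \sum_(v in S) A u v in
  let D := \sum_(u in S) d u in
  0 < M -> rh ^+ 2 <= 2 * M ->
  M + rh * s <= #|core_nbrs S|%:R * s + K ->
  (rh ^+ 2 - m + D / 2) * a <=
    rh * (\sum_(u in S) \sum_(v in S) A u v * (x u * x v))
    - #|core_nbrs S|%:R * (s * a - sg ^+ 2) ->
  K < rh ^+ 2 - m + D / 2 ->
  s * K - rh * D < 2 * \sum_(u in S) (d u - D / s) ^+ 2.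
Proof.
move=> rh0 x0 [u1 u1S xu1] s a sg d D M0 rhM hM hI hK.
have s0 : 0 < s by rewrite ltr0n; apply/card_gt0P; exists u1.
have sg0 : 0 < sg.
  by rewrite /sg (bigD1 u1) //= ltr_pwDl // sumr_ge0.
have a0 : 0 < a.
  rewrite /a (bigD1 u1) //= ltr_pwDl ?exprn_gt0 // sumr_ge0 // => u _; exact: sqr_ge0.
pose c := sg / s; pose eps u := x u - c.
have c0 : 0 < c by exact: divr_gt0.
have cs : c * s = sg by rewrite /c divfK // gt_eqF.
have sumc (y : R) : \sum_(u in S) y = s * y.
  by rewrite sumr_const /s [RHS]mulr_natl.
have eps0 : \sum_(u in S) eps u = 0.
  by rewrite sumrB sumc -/sg -cs; ring.
pose E := \sum_(u in S) eps u ^+ 2.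
pose V := \sum_(u in S) (d u - D / s) ^+ 2.
pose V1 := \sum_(u in S) (d u - D / s) * eps u.
have E0 : 0 <= E by apply: sumr_ge0 => u _; exact: sqr_ge0.
have V0 : 0 <= V by apply: sumr_ge0 => u _; exact: sqr_ge0.
have aE : a = s * c ^+ 2 + E.
  transitivity (\sum_(u in S) (c ^+ 2 + 2 * c * eps u + eps u ^+ 2)).
    by apply: eq_bigr => u _; rewrite /eps; ring.
  by rewrite !big_split /= sumc -mulr_sumr eps0 mulr0 addr0.
have deps : \sum_(u in S) d u * eps u = V1.
  transitivity (V1 + D / s * \sum_(u in S) eps u); last by rewrite eps0 mulr0 addr0.
  by rewrite mulr_sumr -big_split /=; apply: eq_bigr => u _; ring.
pose EE := \sum_(u in S) \sum_(v in S) A u v * (eps u * eps v).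
have qE : \sum_(u in S) \sum_(v in S) A u v * (x u * x v) =
    c ^+ 2 * D + 2 * c * V1 + EE.
  have e1 : \sum_(u in S) \sum_(v in S) A u v * eps u = V1.
    by rewrite -deps; apply: eq_bigr => u _; rewrite mulr_suml.
  have e2 : \sum_(u in S) \sum_(v in S) A u v * eps v = V1.
    rewrite exchange_big /= -e1; apply: eq_bigr => u _; apply: eq_bigr => v _.
    by rewrite adj_sym.
  have -> : 2 * c * V1 = c * V1 + c * V1 by ring.
  rewrite -{1}e1 -{1}e2 /D !mulr_sumr -!big_split /=; apply: eq_bigr => u _.
  rewrite /d !mulr_sumr -!big_split /=; apply: eq_bigr => v _; rewrite /eps; ring.
have EEle : EE <= s * E.
  have -> : s * E = \sum_(u in S) \sum_(v in S) (eps u ^+ 2 + eps v ^+ 2) / 2.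
    under [RHS]eq_bigr => u _ do rewrite -mulr_suml big_split /= sumc.
    rewrite -mulr_suml big_split /= -mulr_sumr sumc -/E; by field.
  rewrite /EE; apply: ler_sum => u _; apply: ler_sum => v _.
  have := sqr_ge0 (eps u - eps v); have := sqr_ge0 (eps u + eps v).
  case: (adj u v); rewrite ?mul1r ?mul0r ?sqrrB ?sqrrD; lra.
have sq : 2 * c * rh * M * V1 <= c ^+ 2 * rh ^+ 2 * V + M ^+ 2 * E.
  have : 0 <= \sum_(u in S) (c * rh * (d u - D / s) - M * eps u) ^+ 2.
    by apply: sumr_ge0 => u _; exact: sqr_ge0.
  suff -> : \sum_(u in S) (c * rh * (d u - D / s) - M * eps u) ^+ 2 =
    c ^+ 2 * rh ^+ 2 * V - 2 * c * rh * M * V1 + M ^+ 2 * E by lra.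
  rewrite /V /V1 /E !mulr_sumr -sumrB -big_split /=.
  by apply: eq_bigr => u _; ring.
have saE : s * a - sg ^+ 2 = s * E by rewrite aE -cs; ring.
rewrite saE qE in hI.
have h1 : K * a < rh * (c ^+ 2 * D + 2 * c * V1 + EE) - #|core_nbrs S|%:R * (s * E).
  by apply: lt_le_trans hI; rewrite ltr_pM2r.
have h2 : rh * EE <= rh * (s * E) by exact: ler_wpM2l.
have h3 : (M + rh * s) * E <= (#|core_nbrs S|%:R * s + K) * E by exact: ler_wpM2r.
have h4 : c ^+ 2 * (s * K - rh * D) < 2 * c * rh * V1 - M * E.
  rewrite aE in h1; lra.
have h5 : M * (c ^+ 2 * (s * K - rh * D)) < M * (c ^+ 2 * (2 * V)).
  apply: (@lt_le_trans _ _ (M * (2 * c * rh * V1 - M * E))).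
    by rewrite ltr_pM2l.
  apply: (@le_trans _ _ (c ^+ 2 * rh ^+ 2 * V)).
    by rewrite mulrBr; move: sq; rewrite expr2; lra.
  have : c ^+ 2 * rh ^+ 2 * V <= c ^+ 2 * (2 * M) * V.
    by apply: ler_wpM2r => //; apply: ler_wpM2l => //; exact: sqr_ge0.
  lra.
by rewrite ltr_pM2l // ltr_pM2l ?exprn_gt0 // in h5.
Qed.
End Inequality.

Section CoreSize.
Variables (R : realType).

(* An edge [uv] shares at most one of its ends with any other edge, so the
   degrees of [u] and [v] add up to at most the number of edges plus one. *)
Lemma edge_degree_sq (T : finType) (S : {set T}) (B : rel T) (b : T -> R) :
  symmetric B -> irreflexive B ->
  (forall u, b u = \sum_(v in S) (B u v)%:R) ->
  4 * \sum_(u in S) b u ^+ 2 <=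
    (\sum_(u in S) b u) * (\sum_(u in S) b u + 2).
Proof.
move=> Bs Bi bE; set t := \sum_(u in S) b u.
have b0 u : 0 <= b u by rewrite bE; apply: sumr_ge0.
have key u v : u \in S -> v \in S -> B u v -> 2 * (b u + b v) <= t + 2.
  move=> uS vS uv.
  have nuv : v != u by apply: contraTneq uv => ->; rewrite Bi.
  have bsum w : \sum_(a in S) (B a w)%:R = b w.
    by rewrite bE; apply: eq_bigr => a _; rewrite Bs.
  have : b u - 1 + (b v - 1) <= \sum_(a in S) (b a - (B a u)%:R - (B a v)%:R).
    rewrite (bigD1 u) //= (bigD1 v) //= ?vS //.
    rewrite !Bi [B v u]Bs uv /= addrA -[leLHS]addr0; apply: lerD; first by lra.
    apply: sumr_ge0 => a /andP[/andP[aS au] av].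
    rewrite bE (bigD1 u) //= (bigD1 v) ?vS //=.
    have : 0 <= \sum_(i | (i \in S) && (i != u) && (i != v)) (B a i)%:R :> R.
      exact: sumr_ge0.
    lra.
  rewrite !sumrB !bsum -/t; lra.
have e : \sum_(u in S) b u ^+ 2 =
    \sum_(u in S) \sum_(v in S) (B u v)%:R * ((b u + b v) / 2).
  have e1 : \sum_(u in S) b u ^+ 2 = \sum_(u in S) \sum_(v in S) (B u v)%:R * b u.
    by apply: eq_bigr => u _; rewrite expr2 {1}bE mulr_suml.
  have e2 : \sum_(u in S) \sum_(v in S) (B u v)%:R * b v = \sum_(u in S) b u ^+ 2.
    rewrite exchange_big /= e1; apply: eq_bigr => u _; apply: eq_bigr => v _.
    by rewrite Bs.
  transitivity ((\sum_(u in S) b u ^+ 2 + \sum_(u in S) b u ^+ 2) / 2); first by field.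
  rewrite -{2}e2 e1 -big_split mulr_suml /=; apply: eq_bigr => u _.
  rewrite -big_split mulr_suml /=; apply: eq_bigr => v _; by field.
rewrite e {1}/t mulr_sumr mulr_suml; apply: ler_sum => u uS.
rewrite mulr_sumr [X in _ <= X * _]bE mulr_suml; apply: ler_sum => v vS.
have := key u v uS vS; case: (B u v) => [/(_ isT)|_];
  rewrite ?mul1r ?mul0r ?mulr0 //; lra.
Qed.

(* If [#|S| = k] then [S] is complete and the spread on the right is 0; if
   [#|S| = k.+1] and [D = k ^ 2 - 1] then the complement of [S] has (k + 1) / 2
   edges, and [edge_degree_sq] bounds the spread. *)
Lemma core_size (G : sgraph) (S : {set G}) (k : nat) (rh : R) :
  (2 <= k)%N -> (0 < #|S|)%N ->
  let s := #|S| in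
  let d u : R := \sum_(v in S) (adj u v)%:R in
  let D := (\sum_(u in S) \sum_(v in S) adj u v)%N in
  2 * s%:R ^+ 3 + s%:R * k%:R ^+ 2 <= rh ->
  rh * (s%:R * (k%:R - 1) - D%:R) + s%:R * (D%:R / 2 - k%:R * (k%:R - 1) / 2)
    < 2 * \sum_(u in S) (d u - D%:R / s%:R) ^+ 2 ->
  [/\ (k < s)%N, (s * k.-1 <= D)%N & s = k.+1 -> (k ^ 2 <= D)%N].
Proof.
move=> k2 S0 s d D hrh hV.
set V := \sum_(u in S) _ in hV.
have s0 : 0 < s%:R :> R by rewrite ltr0n.
have sn0 : s%:R != 0 :> R by rewrite gt_eqF.
have kk : k%:R - 1 = k.-1%:R :> R by rewrite -[in LHS](@prednK k) ?(ltnW k2) // -natr1 addrK.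
have DE : D%:R = \sum_(u in S) d u.
  by rewrite natr_sum; apply: eq_bigr => u _; rewrite natr_sum.
have d0 u : 0 <= d u by apply: sumr_ge0.
have ds u : u \in S -> d u <= s%:R - 1.
  move=> uS; rewrite /d (bigD1 u) //= adj_irrefl add0r.
  have -> : s%:R - 1 = \sum_(i in S | i != u) 1 :> R.
    by rewrite /s -sum1_card natr_sum (bigD1 u uS) /= addrC addrK.
  by apply: ler_sum => v _; case: (adj u v).
have sumc (y : R) : \sum_(u in S) y = s%:R * y by rewrite sumr_const [RHS]mulr_natl.
have Dle : D%:R <= s%:R * (s%:R - 1) :> R by rewrite DE -sumc; apply: ler_sum.
have hk : 0 <= k%:R * (k%:R - 1) :> R by rewrite kk mulr_ge0.
(* A deficit of at least 1 in [D] costs [rh] on the left of [hV], more than the trivial bound 2 s^3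
   on the right and the constant term can make up for. *)
have D1 : (s * k.-1 <= D)%N.
  rewrite leqNgt; apply/negP => hD.
  have hD' : 1 <= s%:R * (k%:R - 1) - D%:R :> R.
    by rewrite kk -natrM lerBrDl natr1 ler_nat.
  have V3 : V <= s%:R * s%:R ^+ 2.
    rewrite -sumc; apply: ler_sum => u uS.
    have h1 := ds u uS; have h2 := d0 u.
    have h3 : 0 <= D%:R / s%:R :> R by rewrite divr_ge0.
    have h4 : D%:R / s%:R <= s%:R - 1 :> R by rewrite ler_pdivrMr // mulrC.
    rewrite -real_normK ?num_real //; apply: lerXn2r; rewrite ?nnegrE ?(ltW s0) //.
    by rewrite ler_norml; apply/andP; split; lra.
  have rh0 : 0 <= rh.
    apply: le_trans hrh; rewrite addr_ge0 // mulr_ge0 ?exprn_ge0 ?(ltW s0) //.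
  have h5 : rh * 1 <= rh * (s%:R * (k%:R - 1) - D%:R) by apply: ler_wpM2l.
  have h6 : 0 <= s%:R * D%:R :> R by rewrite mulr_ge0.
  have h7 : s%:R * (k%:R * (k%:R - 1)) <= s%:R * k%:R ^+ 2 :> R.
    apply: ler_wpM2l; first exact: ltW.
    by rewrite expr2 mulrBr mulr1 gerBl.
  have h8 : s%:R * s%:R ^+ 2 = s%:R ^+ 3 :> R by rewrite -exprS.
  have h9 : 0 <= s%:R * (k%:R * (k%:R - 1)) :> R by rewrite mulr_ge0 // ltW.
  rewrite h8 in V3; lra.
have Dn : (D <= s * s.-1)%N.
  rewrite -(ler_nat R) natrM; apply: le_trans Dle _.
  have -> : s%:R = s.-1%:R + 1 :> R by rewrite natr1 prednK.
  by rewrite addrK.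
have ks : (k <= s)%N.
  have := leq_trans D1 Dn; rewrite leq_pmul2l //; lia.
have ks' : (k < s)%N.
  rewrite ltn_neqAle ks andbT; apply/eqP => e.
  have DD : D%:R = s%:R * (s%:R - 1) :> R.
    apply/eqP; rewrite eq_le Dle /=.
    have ss : s%:R - 1 = s.-1%:R :> R.
      have -> : s%:R = s.-1%:R + 1 :> R by rewrite natr1 prednK.
      by rewrite addrK.
    by rewrite ss -natrM ler_nat; move: D1; rewrite e.
  have V0 : V = 0.
    have h : \sum_(u in S) (s%:R - 1 - d u) = 0.
      by rewrite sumrB sumc -DD DE subrr.
    apply: big1 => u uS; rewrite DD mulrAC divff // mul1r.
    move/eqP: h; rewrite psumr_eq0 => [|v vS]; last by rewrite subr_ge0 ds.
    move=> /allP/(_ u); rewrite mem_index_enum uS /= => /(_ isT)/eqP h.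
    by rewrite -opprB sqrrN h expr0n.
  (* Both sides of [hV] are 0 here, so only its strictness excludes s = k. *)
  move: hV; rewrite V0 DD -e; lra.
split=> // sk.
rewrite leqNgt; apply/negP => hD.
have De : D = (k.+1 * k.-1)%N by apply/eqP; move: D1 hD; rewrite sk; nia.
have DR : D%:R = (k%:R + 1) * (k%:R - 1) :> R by rewrite De natrM kk natr1.
have sR : s%:R = k%:R + 1 :> R by rewrite sk natr1.
pose B : rel G := fun u v => (u != v) && ~~ adj u v.
have Bs : symmetric B by move=> u v; rewrite /B eq_sym adj_sym.
have Bi : irreflexive B by move=> u; rewrite /B eqxx.
pose b u : R := \sum_(v in S) (B u v)%:R.
have hb := @edge_degree_sq _ S _ _ Bs Bi (fun u => erefl (b u)).
set t := \sum_(u in S) b u in hb.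
have bd u : u \in S -> b u = k%:R - d u.
  move=> uS; apply/eqP; rewrite eq_sym subr_eq /b /d -big_split /= eq_sym.
  rewrite (bigD1 u) //= /B eqxx adj_irrefl addr0 add0r.
  have -> : k%:R = \sum_(i in S | i != u) 1 :> R.
    have := sum1_card [in S]; rewrite (bigD1 u uS) /= -/s sk => -[/esym ->].
    by rewrite natr_sum.
  apply/eqP; apply: eq_bigr => v /andP[_ vu]; rewrite eq_sym vu /=.
  by case: (adj u v); rewrite ?add0r ?addr0.
have tE : t = k%:R + 1.
  rewrite /t (eq_bigr (fun u => k%:R - d u)) // sumrB sumc -DE sR DR; ring.
have VE : V = \sum_(u in S) b u ^+ 2 - (k%:R + 1).
  transitivity (\sum_(u in S) (1 - 2 * b u + b u ^+ 2)).
    apply: eq_bigr => u uS; rewrite DR sR bd //.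
    have -> : (k%:R + 1) * (k%:R - 1) / (k%:R + 1) = k%:R - 1 :> R.
      by rewrite mulrAC divff ?mul1r // -sR.
    ring.
  rewrite big_split sumrB /= -mulr_sumr -/t tE sumc sR; ring.
(* [hb] bounds the right side of [hV] by (k^2 - 1) / 2, which is exactly the left side: again
   strictness decides. *)
rewrite tE in hb; move: hV; rewrite VE DR sR; lra.
Qed.
End CoreSize.

(** * Cycles alternating between the core and its common neighbours *)

Section CoreCycles.
Variables (G : sgraph) (S F : {set G}) (j : nat).
Hypotheses (dSF : forall v, v \in F -> v \notin S)
  (aSF : forall u v, u \in S -> v \in F -> adj u v).
Local Notation k := (j.+2).
Local Notation n := (k.*2.+1).

Let n3 : (3 <= n)%N. Proof. by rewrite !doubleS. Qed.

Definition alternating_homs : {set {ffun 'I_n -> G}} :=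
  [set f in cyc_homs n G | [forall i : 'I_n, (f i \in S) == ~~ odd i]]%SET.

Lemma alternatingS f (i : 'I_n) : f \in alternating_homs -> (f i \in S) = ~~ odd i.
Proof. by rewrite inE => /andP[_ /forallP/(_ i)/eqP]. Qed.

Lemma even_cycle_adj (a b : 'I_n) : cycle_adj a b -> ~~ odd a -> ~~ odd b ->
  (a = ord0 /\ b = ord_max) \/ (a = ord_max /\ b = ord0).
Proof.
have key (x y : 'I_n) : y = ordS x -> ~~ odd x -> ~~ odd y -> x = ord_max /\ y = ord0.
  move=> ->; rewrite val_ordS; case: ifP => [/eqP e _ _|_ /= -> //].
  split; apply: val_inj; rewrite ?val_ordS /= ?e ?eqxx //.
  by move: e => [->].
move=> /andP[_ /orP[/eqP h|/eqP h]] ha hb.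
  by right; apply: key.
by left; have [] := key b a h hb ha.
Qed.

(* Only one edge of the cycle, the one joining [ord_max] to [ord0], has both ends
   at even positions, so the copy determines this edge up to orientation. *)
Lemma alternating_fiber f g : f \in alternating_homs -> g \in alternating_homs ->
  copy_of f = copy_of g -> f ord0 = g ord0 -> f = g.
Proof.
move=> fA gA e e0.
have fh : f \in cyc_homs n G by move: fA; rewrite inE => /andP[].
have gh : g \in cyc_homs n G by move: gA; rewrite inE => /andP[].
have fi : injective f by move: fh; rewrite inE => /andP[/injectiveP].
have gi : injective g by move: gh; rewrite inE => /andP[/injectiveP].
have edge (x y : 'I_n) : cycle_adj x y ->
    exists a b, [/\ cycle_adj a b, g x = f a & g y = f b].
  move=> xy; have : [set g x; g y]%SET \in (copy_of g).2 by rewrite mem_copy_of.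
  rewrite -e => /imsetP[[a b]]; rewrite inE /= => ab /set2_eqP[[-> ->]|[-> ->]].
    by exists a, b.
  by exists b, a; rewrite cycle_adj_sym.
have adj0 : cycle_adj (ord0 : 'I_n) ord_max.
  rewrite cycle_adj_sym; have -> : (ord0 : 'I_n) = ordS ord_max.
    by apply: val_inj; rewrite val_ordS /= eqxx.
  exact: cycle_adjS.
have emax : f ord_max = g ord_max.
  have [a [b [ab ha hb]]] := edge _ _ adj0.
  have pa : ~~ odd a by rewrite -(alternatingS a fA) -ha (alternatingS _ gA).
  have pb : ~~ odd b by rewrite -(alternatingS b fA) -hb (alternatingS _ gA) /= odd_double.
  move: ha; rewrite -e0 => /fi a0.
  by case: (even_cycle_adj ab pa pb) => [[_ b0]|[a1]]; [rewrite hb b0|rewrite -a1 -a0].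
have h1 : (1 < n)%N by [].
pose i1 := Ordinal h1.
have s0 : ordS ord0 = i1 by apply: val_inj; rewrite val_ordS.
have e1 : f i1 = g i1.
  have adj1 : cycle_adj (ord0 : 'I_n) i1 by rewrite -s0 cycle_adjS.
  have [a [b [ab ha hb]]] := edge _ _ adj1.
  move: ha; rewrite -e0 => /fi a0; rewrite -a0 in ab.
  case/andP: ab => _ /orP[/eqP b1|/eqP b1]; first by rewrite hb b1 s0.
  have bm : b = ord_max.
    apply: val_inj => /=; move: (congr1 val b1); rewrite val_ordS.
    by case: eqP => // -[->].
  by move: hb; rewrite bm emax => /gi/(congr1 val).
apply: (copy_of_rigid n3 fh gh e) => -[[|[|i]] hi] //= _.
  by rewrite (_ : Ordinal hi = ord0) //; apply: val_inj.
by rewrite (_ : Ordinal hi = i1) //; apply: val_inj.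
Qed.

(** By [alternating_fiber] an alternating labelling of a given copy is determined by the image of
    [ord0], which must be one of the two ends of the single edge inside S. *)
Lemma alternating_le : (#|alternating_homs| <= 2 * nb_copies (cycle_graph n) G)%N.
Proof.
rewrite nb_copiesE // -sum1_card.
rewrite (partition_big (@copy_of n G) (fun H => H \in (@copy_of n G @: cyc_homs n G)%SET)) /=;
  last by move=> f; rewrite inE => /andP[fh _]; exact: imset_f.
rewrite mulnC -sum_nat_const; apply: leq_sum => H _.
rewrite sum1dep_card; set X := [set f | _]%SET.
have [->|[f fX]] := set_0Vmem X; first by rewrite cards0.
have /setIdP[fA /eqP fH] := fX.
have -> : #|X| = #|(fun g : {ffun 'I_n -> G} => g ord0) @: X|%SET.
  rewrite card_in_imset // => g1 g2.
  move=> /setIdP[h1 /eqP e1] /setIdP[h2 /eqP e2]; apply: alternating_fiber => //.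
  by rewrite e1.
apply: (@leq_trans #|[set f ord0; f ord_max]%SET|); last by rewrite cards2; case: (_ != _).
apply/subset_leq_card/fintype.subsetP => y /imsetP[g].
move=> /setIdP[gA /eqP gH] ->{y}.
have fh : f \in cyc_homs n G by move: fA; rewrite inE => /andP[].
have gh : g \in cyc_homs n G by move: gA; rewrite inE => /andP[].
have gi : injective g by move: gh; rewrite inE => /andP[/injectiveP].
have adj0 : cycle_adj (ord0 : 'I_n) ord_max.
  rewrite cycle_adj_sym; have -> : (ord0 : 'I_n) = ordS ord_max.
    by apply: val_inj; rewrite val_ordS /= eqxx.
  exact: cycle_adjS.
have : [set g ord0; g ord_max]%SET \in (copy_of g).2 by rewrite mem_copy_of.
rewrite gH -fH => /imsetP[[a b]]; rewrite inE /= => ab E.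
have pe c d : cycle_adj c d -> g ord0 = f c -> g ord_max = f d ->
    g ord0 \in [set f ord0; f ord_max]%SET.
  move=> cd hc hd.
  have pc : ~~ odd c by rewrite -(alternatingS c fA) -hc (alternatingS _ gA).
  have pd : ~~ odd d by rewrite -(alternatingS d fA) -hd (alternatingS _ gA) /= odd_double.
  by rewrite hc; case: (even_cycle_adj cd pc pd) => [[-> _]|[-> _]]; rewrite !inE eqxx ?orbT.
case: (set2_eqP E) => -[ha hb]; first exact: (pe a b).
by apply: (pe b a) => //; rewrite cycle_adj_sym.
Qed.

(* [h] fills the odd positions, [g] the even ones other than the two ends. *)
Definition zigzag (u v : G) (g : {ffun 'I_j.+1 -> G}) (h : {ffun 'I_j.+2 -> G}) :
    {ffun 'I_n -> G} :=
  [ffun i : 'I_n => if i == ord0 then u else if i == ord_max then v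
     else if odd i then h (inord i./2) else g (inord i./2.-1)].

Lemma zigzag0 u v g h : zigzag u v g h ord0 = u.
Proof. by rewrite ffunE eqxx. Qed.

Lemma zigzag_max u v g h : zigzag u v g h ord_max = v.
Proof. by rewrite ffunE eqxx. Qed.

Lemma zigzag_odd u v g h (i : 'I_n) : odd i -> zigzag u v g h i = h (inord i./2).
Proof.
move=> oi; rewrite ffunE oi; case: eqP => [i0|_]; first by rewrite i0 in oi.
by case: eqP => // im; move: oi; rewrite im /= odd_double.
Qed.

Lemma zigzag_even u v g h (i : 'I_n) : i != ord0 -> i != ord_max -> ~~ odd i ->
  zigzag u v g h i = g (inord i./2.-1).
Proof. by move=> i0 im oi; rewrite ffunE (negbTE i0) (negbTE im) (negbTE oi). Qed.

Section Zigzag.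
Variables (u v : G) (g : {ffun 'I_j.+1 -> G}) (h : {ffun 'I_j.+2 -> G}).
Hypotheses (uS : u \in S) (vS : v \in S) (uv : adj u v).
Hypotheses (gi : injective g) (hi : injective h).
Hypotheses (gS : forall a, g a \in (S :\ u :\ v)%SET) (hF : forall a, h a \in F).
Local Notation f := (zigzag u v g h).

Lemma zigzag_S (i : 'I_n) : ~~ odd i -> f i \in S.
Proof.
move=> oi; have [->|i0] := eqVneq i ord0; first by rewrite zigzag0.
have [->|im] := eqVneq i ord_max; first by rewrite zigzag_max.
by rewrite zigzag_even //; have := gS (inord i./2.-1); rewrite !inE => /and3P[].
Qed.

Lemma zigzag_F (i : 'I_n) : odd i -> f i \in F.
Proof. by move=> oi; rewrite zigzag_odd. Qed.

Lemma zigzag_inj : injective f.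
Proof.
have par (a b : 'I_n) : f a = f b -> odd a = odd b.
  move=> e; case oa: (odd a); case ob: (odd b) => //.
    by have := dSF (zigzag_F oa); rewrite e zigzag_S // ob.
  by have := dSF (zigzag_F ob); rewrite -e zigzag_S // oa.
have nuv : u != v by apply: contraTneq uv => ->; rewrite adj_irrefl.
have mid (i : 'I_n) : i != ord0 -> i != ord_max -> ~~ odd i ->
    f i != u /\ f i != v.
  move=> i0 im oi; rewrite zigzag_even //.
  by have := gS (inord i./2.-1); rewrite !inE => /and3P[-> ->].
move=> a b e; have ob := par a b e.
case oa: (odd a).
  move: e; rewrite !zigzag_odd -?ob // => /hi /(congr1 val).
  rewrite /= !inordK.
  - move=> e; apply: val_inj; rewrite /= -[LHS]odd_double_half -[RHS]odd_double_half.
    by rewrite -ob e.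
  - by have := odd_double_half b; rewrite -ob oa; have := ltn_ord b; lia.
  - by have := odd_double_half a; rewrite oa; have := ltn_ord a; lia.
move/negbT: oa => oa; have ob' : ~~ odd b by rewrite -ob.
have [a0|a0] := eqVneq a ord0.
  have [->//|b0] := eqVneq b ord0.
  have [bm|bm] := eqVneq b ord_max.
    by move: e; rewrite a0 bm zigzag0 zigzag_max => /eqP; rewrite (negbTE nuv).
  by have [/eqP] := mid b b0 bm ob'; rewrite -e a0 zigzag0.
have [am|am] := eqVneq a ord_max.
  have [->//|bm] := eqVneq b ord_max.
  have [b0|b0] := eqVneq b ord0.
    by move: e; rewrite am b0 zigzag0 zigzag_max => /eqP; rewrite eq_sym (negbTE nuv).
  by have [_ /eqP] := mid b b0 bm ob'; rewrite -e am zigzag_max.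
have [mu mv] := mid a a0 am oa.
have [b0|b0] := eqVneq b ord0; first by move: mu; rewrite e b0 zigzag0 eqxx.
have [bm|bm] := eqVneq b ord_max; first by move: mv; rewrite e bm zigzag_max eqxx.
have bound (i : 'I_n) : i != ord0 -> i != ord_max -> ~~ odd i ->
    (0 < i./2)%N /\ (i./2.-1 < j.+1)%N.
  rewrite -!val_eqE /= => i0 im oi; have := odd_double_half i.
  by rewrite (negbTE oi); move: i0 im (ltn_ord i); clear; lia.
have [ba1 ba2] := bound a a0 am oa; have [bb1 bb2] := bound b b0 bm ob'.
move: e; rewrite !zigzag_even // => /gi /(congr1 val); rewrite /= !inordK // => e.
apply: val_inj; rewrite /= -[LHS]odd_double_half -[RHS]odd_double_half.
by rewrite (negbTE oa) (negbTE ob'); move: e ba1 bb1; clear; lia.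
Qed.

Lemma zigzag_alternating : f \in alternating_homs.
Proof.
rewrite !inE; apply/andP; split; last first.
  apply/forallP => i; apply/eqP; case oi: (odd i) => /=.
    exact/negbTE/dSF/zigzag_F.
  by apply: zigzag_S; rewrite oi.
apply/andP; split; first exact/injectiveP/zigzag_inj.
apply/forallP => i; have [->|im] := eqVneq i ord_max.
  have -> : ordS (ord_max : 'I_n) = ord0 by apply: val_inj; rewrite val_ordS /= eqxx.
  by rewrite zigzag0 zigzag_max adj_sym.
have e : ordS i = i.+1 :> nat.
  rewrite val_ordS; case: eqP => // ei; case/eqP: im.
  by apply: val_inj => /=; move: ei => [->].
case oi: (odd i).
  by rewrite adj_sym aSF ?zigzag_F // zigzag_S // e /= oi.
by rewrite aSF ?zigzag_S ?oi // zigzag_F // e /= oi.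
Qed.
End Zigzag.

Lemma zigzag_injective u v g1 h1 g2 h2 :
  zigzag u v g1 h1 = zigzag u v g2 h2 -> (g1, h1) = (g2, h2).
Proof.
move=> e; congr (_, _); apply/ffunP => a.
  have ha : (a.+1.*2 < n)%N by have := ltn_ord a; lia.
  have := congr1 (fun f : {ffun 'I_n -> G} => f (Ordinal ha)) e.
  rewrite !zigzag_even ?odd_double //; try by rewrite -val_eqE /=; have := ltn_ord a; lia.
  by rewrite -[nat_of_ord (Ordinal ha)]/(a.+1.*2) doubleK /= inord_val.
have ha : (a.*2.+1 < n)%N by have := ltn_ord a; lia.
have := congr1 (fun f : {ffun 'I_n -> G} => f (Ordinal ha)) e.
rewrite !zigzag_odd /= ?odd_double //.
by rewrite -/(uphalf a.*2) uphalf_double inord_val.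
Qed.

(** An ordered adjacent pair in S is placed at the two ends, distinct other vertices of S at the
    inner even positions, and distinct vertices of [F] at the odd ones. The factor 2 on the right
    matches the ordered pairs on the left. *)
Lemma core_cycles :
  ((\sum_(u in S) \sum_(v in S) adj u v) * ((#|S| - 2) ^_ j.+1 * #|F| ^_ j.+2)
    <= 2 * nb_copies (cycle_graph n) G)%N.
Proof.
apply: leq_trans alternating_le; rewrite pair_big /=.
have -> : (\sum_(p : G * G | (p.1 \in S) && (p.2 \in S)) adj p.1 p.2 =
    \sum_(p : G * G | [&& p.1 \in S, p.2 \in S & adj p.1 p.2]) 1)%N.
  rewrite big_mkcond [RHS]big_mkcond; apply: eq_bigr => p _.
  by case: (p.1 \in S); case: (p.2 \in S); case: (adj _ _).
rewrite big_distrl /= -[leqRHS]sum1_card.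
rewrite (partition_big (fun f : {ffun 'I_n -> G} => (f ord0, f ord_max))
  (fun p => [&& p.1 \in S, p.2 \in S & adj p.1 p.2])) /=; last first.
  move=> f fA; rewrite !(alternatingS _ fA) /= odd_double /=.
  have fh : f \in cyc_homs n G by move: fA; rewrite inE => /andP[].
  rewrite adj_sym; apply: (cyc_homs_adj fh).
  have -> : (ord0 : 'I_n) = ordS ord_max.
    by apply: val_inj; rewrite val_ordS /= eqxx.
  exact: cycle_adjS.
apply: leq_sum => -[u v] /= /and3P[uS vS uv]; rewrite mul1n sum1dep_card.
have nuv : v != u by apply: contraTneq uv => ->; rewrite adj_irrefl.
pose Xg := [set g : {ffun 'I_j.+1 -> G} in ffun_on (S :\ u :\ v)%SET | injectiveb g]%SET.
pose Xh := [set h : {ffun 'I_j.+2 -> G} in ffun_on F | injectiveb h]%SET.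
have cg : #|Xg| = ((#|S| - 2) ^_ j.+1)%N.
  rewrite card_inj_ffuns_on card_ord; congr (_ ^_ _).
  have := cardsD1 u S; have := cardsD1 v (S :\ u)%SET.
  by rewrite uS !inE nuv vS /=; lia.
have ch : #|Xh| = (#|F| ^_ j.+2)%N by rewrite card_inj_ffuns_on card_ord.
rewrite -cg -ch -cardsX.
rewrite -(card_in_imset (f := fun p => zigzag u v p.1 p.2)); last first.
  by move=> [g1 h1] [g2 h2] _ _ /=; exact: zigzag_injective.
apply/subset_leq_card/fintype.subsetP => f /imsetP[[g h]].
rewrite !inE /= => /andP[/andP[/ffun_onP gS /injectiveP gi] /andP[/ffun_onP hF /injectiveP hi]] ->.
rewrite zigzag0 zigzag_max eqxx andbT.
by have := @zigzag_alternating u v g h uS vS uv gi hi gS hF; rewrite !inE.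
Qed.
End CoreCycles.

(** * The constants *)

Lemma bernoulli (R : realDomainType) (t : R) n :
  0 <= t -> t <= 1 -> 1 - n%:R * t <= (1 - t) ^+ n.
Proof.
move=> t0 t1; elim: n => [|n IH]; first by rewrite mul0r subr0 expr0.
rewrite exprS; apply: le_trans (_ : (1 - t) * (1 - n%:R * t) <= _).
  have h : 0 <= n%:R * (t * t) by rewrite !mulr_ge0.
  by rewrite -natr1; lra.
by apply: ler_wpM2l => //; rewrite subr_ge0.
Qed.

Lemma core_degree_even (G : sgraph) (S : {set G}) :
  ~~ odd (\sum_(u in S) \sum_(v in S) adj u v).
Proof.
pose lt (u v : G) := (enum_rank u < enum_rank v)%N.
suff -> : (\sum_(u in S) \sum_(v in S) adj u v =
    (\sum_(u in S) \sum_(v in S) adj u v && lt u v).*2)%N by rewrite odd_double.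
rewrite -addnn [X in (_ = _ + X)%N]exchange_big -big_split /=; apply: eq_bigr => u _.
rewrite -big_split /=; apply: eq_bigr => v _; rewrite /lt [adj v u]adj_sym.
have [->|nuv] := eqVneq u v; first by rewrite adj_irrefl.
have : enum_rank u != enum_rank v by rewrite (inj_eq enum_rank_inj).
rewrite -val_eqE /=.
by case: ltngtP => //; case: (adj u v).
Qed.

Lemma two_fact_le k : (2 <= k)%N -> (2 * k`! <= k.+2 ^ k.-1)%N.
Proof.
case: k => [//|[//|k]] _; elim: k => [//|k IH].
rewrite factS mulnCA; apply: (@leq_trans (k.+3 * k.+4 ^ k.+1)).
  by rewrite leq_mul2l IH.
rewrite -[k.+3.-1]/(k.+1.+1) [(_ ^ k.+2)%N]expnS; apply: leq_mul; first by lia.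
by rewrite leq_exp2r.
Qed.

(** Bernoulli's inequality for (1 - 1/(k+2))^(k-1), as 1 - (k-1)/(k+2) = 3/(k+2). *)
Lemma power_ratio_le k : (2 <= k)%N -> (3 * k.+2 ^ k.-1 <= k.+2 * k.+1 ^ k.-1)%N.
Proof.
move=> k2; pose R : realFieldType := rat.
have p : 0 < (k.+2%:R : R) by rewrite ltr0n.
have pn : (k.+2%:R : R) != 0 by rewrite gt_eqF.
have := @bernoulli R (k.+2%:R^-1) k.-1.
rewrite invr_ge0 ler0n invf_le1 // ler1n => /(_ isT isT).
have -> : 1 - k.+2%:R^-1 = k.+1%:R / k.+2%:R :> R.
  have -> : k.+1%:R = k.+2%:R - 1 :> R by rewrite -[k.+2%:R]natr1 addrK.
  by rewrite mulrBl divff // mul1r.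
have -> : 1 - k.-1%:R / k.+2%:R = 3 / k.+2%:R :> R.
  have -> : k.-1%:R = k.+2%:R - 3 :> R.
    rewrite (_ : k.+2 = (k.-1 + 3)%N); last by lia.
    by rewrite natrD addrK.
  by rewrite mulrBl divff // opprB addrC subrK.
rewrite expr_div_n ler_pdivrMr // mulrAC ler_pdivlMr ?exprn_gt0 //.
by rewrite -!natrX -!natrM ler_nat mulnC [(_ * k.+2)%N]mulnC.
Qed.

Lemma uphalf_sq_le k : ((uphalf (k ^ 2)).*2 <= k ^ 2 + 1)%N.
Proof. by have := odd_double_half (k ^ 2); rewrite uphalf_half; case: odd; lia. Qed.

(** The number of cycles from a core of size s is governed by D (s-2)!/(s-k-1)! / s^k. After
    division by (k-1)! this compares s = k + 1, D = 2 ceil(k^2/2) with s = k + 2, D = s (k - 1). *)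
Lemma constant_ineq k : (2 <= k)%N ->
  ((uphalf (k ^ 2)).*2 * k.+2 ^ k.-1 <= k.-1 * k * k.+1 ^ k)%N.
Proof.
move=> k2.
have h : ((uphalf (k ^ 2)).*2 * k.+2 <= 3 * (k.-1 * k * k.+1))%N.
  (* For k = 2 the bound k^2 + 1 on the doubled ceiling is too weak (20 against 18), whereas its
     true value 4 gives 16. *)
  have [->//|k3] := eqVneq k 2.
  apply: leq_trans (_ : (k ^ 2 + 1) * k.+2 <= _)%N.
    by rewrite leq_mul2r uphalf_sq_le orbT.
  have [j ->] : exists j, k = j.+3 by exists (k - 3)%N; lia.
  by rewrite /=; nia.
rewrite -(@leq_pmul2l (3 * k.+2)) //.
apply: leq_trans (_ : (uphalf (k ^ 2)).*2 * k.+2 * (k.+2 * k.+1 ^ k.-1) <= _)%N.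
  rewrite (_ : 3 * k.+2 * _ = (uphalf (k ^ 2)).*2 * k.+2 * (3 * k.+2 ^ k.-1))%N; last by ring.
  by rewrite leq_mul2l power_ratio_le ?orbT.
rewrite (_ : k.+1 ^ k = k.+1 * k.+1 ^ k.-1)%N; last by rewrite -expnS prednK // ltnW.
apply: leq_trans (leq_mul h (leqnn _)) _.
by rewrite leq_eqVlt; apply/orP; left; apply/eqP; ring.
Qed.

(** Factor by factor, (s - 2 - i) / s increases with s; the comparison is with s = k + 2. *)
Lemma ffact_ratio s k n : (k.+2 <= s)%N -> (n <= k)%N ->
  (k ^_ n * s ^ n <= (s - 2) ^_ n * k.+2 ^ n)%N.
Proof.
move=> ks; elim: n => [//|n IH] nk.
rewrite !ffactnSr !expnS.
rewrite (_ : _ * _ * (s * _) = (k ^_ n * s ^ n) * ((k - n) * s))%N; last by ring.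
rewrite (_ : _ * _ * (k.+2 * _) =
  ((s - 2) ^_ n * k.+2 ^ n) * ((s - 2 - n) * k.+2))%N; last by ring.
apply: leq_mul; first by apply: IH; lia.
have [d ->] : exists d, s = (k.+2 + d)%N by exists (s - k.+2)%N; lia.
have [i ->] : exists i, k = (n + i)%N by exists (k - n)%N; lia.
have -> : (n + i - n = i)%N by lia.
have -> : ((n + i).+2 + d - 2 - n = i + d)%N by lia.
nia.
Qed.

Section Constants.
Variables (R : realType) (k : nat).
Hypothesis k2 : (2 <= k)%N.
Local Notation c := (cycle_constant R k).

Lemma cycle_constant_gt0 : 0 < c.
Proof.
rewrite /cycle_constant divr_gt0 ?exprn_gt0 ?ltr0n // -natrM ltr0n muln_gt0 fact_gt0 andbT.
have : (0 < k ^ 2)%N by rewrite expn_gt0; lia.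
by case: (k ^ 2)%N.
Qed.

(** For s = k + 1 the parity of [D] raises k^2 to 2 ceil(k^2/2), and the bound is attained. For
    larger s, [ffact_ratio] reduces to s = k + 2, where [constant_ineq] applies. *)
Lemma core_constant (s D : nat) : (k < s)%N -> (s * k.-1 <= D)%N -> ~~ odd D ->
  (s = k.+1 -> (k ^ 2 <= D)%N) ->
  2 * c * s%:R ^+ k <= (D * (s - 2) ^_ k.-1)%N%:R.
Proof.
move=> ks sD oD hs.
suff H : ((uphalf (k ^ 2)).*2 * (k.-1)`! * s ^ k <= D * (s - 2) ^_ k.-1 * k.+1 ^ k)%N.
  have p : 0 < k.+1%:R ^+ k :> R by rewrite exprn_gt0 ?ltr0n.
  rewrite /cycle_constant -(ler_pM2r p) -!natrX -!natrM.
  rewrite [leLHS](_ : _ = ((uphalf (k ^ 2)).*2 * (k.-1)`! * s ^ k)%N%:R) ?ler_nat //.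
  rewrite -muln2 !natrM !natrX; field.
  by rewrite expf_neq0 // pnatr_eq0.
have [e|ne] := eqVneq s k.+1.
  rewrite e (_ : k.+1 - 2 = k.-1)%N; last by lia.
  rewrite ffactnn; apply: leq_mul => //; apply: leq_mul => //.
  have := hs e; rewrite uphalf_half.
  have := odd_double_half (k ^ 2); have := odd_double_half D; rewrite (negbTE oD).
  by case: odd; lia.
have ks2 : (k.+2 <= s)%N by lia.
have h1 := ffact_ratio ks2 (leq_pred k).
have h2 := constant_ineq k2.
have kf : (k ^_ k.-1 = k`!)%N.
  by rewrite -(ffact_fact (leq_pred k)) (_ : k - k.-1 = 1)%N ?muln1 //; lia.
apply: (@leq_trans (s * k.-1 * (s - 2) ^_ k.-1 * k.+1 ^ k)); last first.
  by rewrite !leq_mul.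
rewrite -(@leq_pmul2r (k.+2 ^ k.-1)) ?expn_gt0 //.
rewrite (_ : s ^ k = s * s ^ k.-1)%N; last by rewrite -expnS prednK // ltnW.
have kf' : (k`! = k * (k.-1)`!)%N by rewrite -{1}(prednK (ltnW k2)) factS (prednK (ltnW k2)).
rewrite kf kf' in h1.
have h3 := leq_mul h2 (leqnn (s * (k.-1)`! * s ^ k.-1)).
have h4 := leq_mul h1 (leqnn (s * k.-1 * k.+1 ^ k)).
apply: leq_trans (_ : _ <= (uphalf (k ^ 2)).*2 * k.+2 ^ k.-1 * (s * (k.-1)`! * s ^ k.-1))%N _.
  by rewrite leq_eqVlt; apply/orP; left; apply/eqP; ring.
apply: leq_trans h3 _.
apply: leq_trans (_ : _ <= k * (k.-1)`! * s ^ k.-1 * (s * k.-1 * k.+1 ^ k))%N _.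
  by rewrite leq_eqVlt; apply/orP; left; apply/eqP; ring.
apply: leq_trans h4 _.
by rewrite leq_eqVlt; apply/orP; left; apply/eqP; ring.
Qed.

(** The right side is the density of cycles in the case of small degrees. It suffices that 4 c <= k
    - 1, because 2 (k + 1) > 2k + 1. *)
Lemma cycle_constant_gap : c < (k%:R ^+ 2 - 1) / (2 * k.*2.+1%:R).
Proof.
have kp : (0 < k)%N by lia.
have h1 := constant_ineq k2; have h2 := two_fact_le k2.
have h3 : ((uphalf (k ^ 2)).*2 * (k.-1)`! * 2 <= k.-1 * k.+1 ^ k)%N.
  rewrite -(@leq_pmul2r (k.+2 ^ k.-1)) ?expn_gt0 //.
  have h4 := leq_mul h1 (leqnn ((k.-1)`! * 2)).
  have h5 := leq_mul h2 (leqnn (k.-1 * k.+1 ^ k)).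
  have kf : (k`! = k * (k.-1)`!)%N by rewrite -{1}(prednK kp) factS prednK.
  rewrite kf in h5.
  apply: leq_trans (_ : _ <= (uphalf (k ^ 2)).*2 * k.+2 ^ k.-1 * ((k.-1)`! * 2))%N _.
    by rewrite leq_eqVlt; apply/orP; left; apply/eqP; ring.
  apply: leq_trans h4 _.
  apply: leq_trans (_ : _ <= 2 * (k * (k.-1)`!) * (k.-1 * k.+1 ^ k))%N _.
    by rewrite leq_eqVlt; apply/orP; left; apply/eqP; ring.
  apply: leq_trans h5 _.
  by rewrite mulnC.
have p : 0 < k.+1%:R ^+ k :> R by rewrite exprn_gt0 ?ltr0n.
have h6 : 4 * c <= k.-1%:R.
  rewrite /cycle_constant -(ler_pM2r p) -natrX -!natrM.
  rewrite [leLHS](_ : _ = ((uphalf (k ^ 2)).*2 * (k.-1)`! * 2)%N%:R) ?ler_nat //.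
  rewrite -muln2 !natrM !natrX; field.
  by rewrite expf_neq0 // pnatr_eq0.
rewrite ltr_pdivlMr; last by rewrite mulr_gt0 // ltr0n.
have kR : k%:R = k.-1%:R + 1 :> R by rewrite natr1 prednK.
have n2 : k.*2.+1%:R = 2 * k%:R + 1 :> R by rewrite -natr1 -muln2 natrM mulrC.
have j1 : 1 <= k.-1%:R :> R by rewrite ler1n; lia.
rewrite n2 kR; have := ler_wpM2r (_ : 0 <= 2 * (k.-1%:R + 1) + 1) h6.
have : 0 <= 2 * (k.-1%:R + 1) + 1 :> R by lra.
by move=> h7 /(_ h7); rewrite expr2; nra.
Qed.

(** g_k(m) is the larger root of x^2 - (k - 1) x - m + k (k - 1) / 2. At sqrt m this polynomial is
    not positive, since k <= sqrt m. *)
Lemma g_bound_quadratic (m : nat) (x : R) : (k ^ 2 <= m)%N -> g_bound R k m < x ->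
  (k%:R - 1) * x + m%:R - k%:R * (k%:R - 1) / 2 < x ^+ 2 /\ Num.sqrt m%:R <= x.
Proof.
move=> km; rewrite /g_bound ltr_pdivrMr // => hx.
have k1 : 2 <= k%:R :> R by rewrite ler_nat.
have kmR : k%:R ^+ 2 <= m%:R :> R by rewrite -natrX ler_nat.
set dl := 4 * m%:R - k%:R ^+ 2 + 1 in hx.
have dl0 : 0 <= dl.
  by rewrite /dl; have := sqr_ge0 (k%:R : R); lra.
have hs := sqrtr_ge0 dl.
have hq : (k%:R - 1) * x + m%:R - k%:R * (k%:R - 1) / 2 < x ^+ 2.
  have : Num.sqrt dl ^+ 2 < (2 * x - (k%:R - 1)) ^+ 2.
    by rewrite ltr_pXn2r ?nnegrE //; lra.
  rewrite sqr_sqrtr // /dl sqrrB exprMn sqrrB expr1n; lra.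
split=> //.
set r := Num.sqrt m%:R; have rr : r ^+ 2 = m%:R by rewrite sqr_sqrtr.
have rk : k%:R <= r.
  by rewrite -(@ler_pXn2r _ 2) ?nnegrE ?sqrtr_ge0 // rr.
rewrite leNgt; apply/negP => xr.
have h : 0 <= (r - x) * (r + x - (k%:R - 1)) by rewrite mulr_ge0 //; lra.
have h2 : 0 <= (k%:R - 1) * (r - k%:R) by rewrite mulr_ge0 //; lra.
have : 0 <= (k%:R - 1) * k%:R :> R by rewrite mulr_ge0 //; lra.
move: hq; rewrite -rr; lra.
Qed.
End Constants.

Lemma power_sub_ge (R : realDomainType) (x y : R) n :
  0 <= y -> y <= x -> n.+1%:R * (x - y) * y ^+ n <= x ^+ n.+1 - y ^+ n.+1.
Proof.
move=> y0 yx; rewrite subrXX [n.+1%:R * _]mulrC -mulrA; apply: ler_wpM2l.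
  by rewrite subr_ge0.
have -> : n.+1%:R * y ^+ n = \sum_(i < n.+1) y ^+ n.
  by rewrite sumr_const card_ord mulr_natl.
apply: ler_sum => i _; rewrite -[in leLHS](@subnK i n) -1?ltnS // exprD.
apply: ler_wpM2r; first by rewrite exprn_ge0.
by apply: lerXn2r; rewrite ?nnegrE // (le_trans y0).
Qed.

Lemma quartic_root_large (R : realType) (Q : R) :
  exists m0 : nat, forall m : nat, (m0 <= m)%N ->
    Q <= Num.sqrt (Num.sqrt m%:R).
Proof.
have [Q0|Q0] := leP Q 0; first by exists 0%N => m _; rewrite (le_trans Q0) ?sqrtr_ge0.
have Qn := ltW Q0.
exists (Num.bound (Q ^+ 4)) => m hm.
have h : Q ^+ 4 <= m%:R.
  have := archi_boundP (exprn_ge0 4 Qn) => /ltW /le_trans; apply.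
  by rewrite ler_nat.
rewrite -(@ler_pXn2r _ 4) ?nnegrE ?sqrtr_ge0 //.
by rewrite [leRHS](exprM _ 2 2) !sqr_sqrtr ?sqrtr_ge0.
Qed.

Lemma nb_edges_card_gt0 (G : sgraph) : (0 < nb_edges G)%N -> (0 < #|G|)%N.
Proof.
rewrite !lt0n; apply: contra => /eqP G0; rewrite -double_eq0 -deg_sum.
by apply/eqP; apply: big1 => u _; have := card0_eq G0 u.
Qed.

(** * The lower bound *)

Section LowerBound.
Variables (R : realType) (k : nat).
Hypothesis k2 : (2 <= k)%N.
Local Notation c := (cycle_constant R k).
Local Notation n := (k.*2.+1).
Local Notation N G := ((nb_copies (cycle_graph k.*2.+1) G)%:R : R).
Local Notation tr G j := ((\sum_(u : vertex G) nwalk j u u)%N%:R : R).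

(** With B = rh^2 - m, the power rh^(2k+1) gains k B r^(2k-1) over r^(2k+1), and the negative part
    loses another B r^(2k-1). Since B >= (k - 1) r - k^2, the leading coefficient is (k + 1)(k -
    1). *)
Lemma trace_lower (G : sgraph) (sp : spectrum R G) (r : R) i0 :
  (0 < #|G|)%N -> lam sp i0 = rho R G -> 0 < r -> r ^+ 2 = (nb_edges G)%:R ->
  r <= rho R G ->
  (k%:R - 1) * rho R G + r ^+ 2 - k%:R * (k%:R - 1) / 2 < rho R G ^+ 2 ->
  ((k%:R ^+ 2 - 1) - (k%:R + 1) * k%:R ^+ 2 / r) * (nb_edges G)%:R ^+ k <= tr G n.
Proof.
move=> G0 h0 r0 rm rrh hq; set rh := rho R G in h0 rrh hq *.
have k1 : (1 <= k)%N by lia.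
have [L [L0 L2 trL _]] := trace_ge k1 G0 h0.
apply: le_trans trL; rewrite -rm -/rh; rewrite -rm -/rh in L2.
pose B := rh ^+ 2 - r ^+ 2.
have rn := ltW r0.
have rh2 : r ^+ 2 <= rh ^+ 2 by apply: lerXn2r; rewrite ?nnegrE // (le_trans rn).
have B0 : 0 <= B by rewrite subr_ge0.
have SE : 2 * r ^+ 2 - rh ^+ 2 = r ^+ 2 - B by rewrite /B; ring.
rewrite SE in L2 *.
have Lr : L <= r.
  by rewrite -(@ler_pXn2r _ 2) ?nnegrE // (le_trans L2) // gerBl.
have S0 : 0 <= r ^+ 2 - B by exact: le_trans (sqr_ge0 _) L2.
have p1 : 0 <= r ^+ k.-1.*2.+1 by exact: exprn_ge0.
have h1 : L ^+ k.-1.*2.+1 * (r ^+ 2 - B) <= r ^+ k.-1.*2.+1 * (r ^+ 2 - B).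
  by apply: ler_wpM2r => //; apply: lerXn2r; rewrite ?nnegrE.
have kS : k = k.-1.+1 by rewrite prednK.
have h2 : r ^+ k.-1.*2.+1 * r ^+ 2 + k%:R * B * r ^+ k.-1.*2.+1 <= rh ^+ n.
  have h := @power_sub_ge R (rh ^+ 2) (r ^+ 2) k.-1 (sqr_ge0 _) rh2.
  rewrite -kS -/B -!exprM !mul2n in h.
  have e : r ^+ k.*2 = r ^+ k.-1.*2 * r ^+ 2.
    by rewrite -exprD; congr (_ ^+ _); move: k1; clear; lia.
  rewrite [leRHS]exprS; apply: le_trans (_ : r * (r ^+ k.*2 + k%:R * B * r ^+ k.-1.*2) <= _).
    by rewrite le_eqVlt; apply/orP; left; apply/eqP; rewrite e exprS; ring.
  apply: ler_pM => //; last by lra.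
  by rewrite addr_ge0 ?mulr_ge0 ?exprn_ge0.
have kR : 2 <= k%:R :> R by rewrite ler_nat.
have h3 : (k%:R - 1) * r - k%:R ^+ 2 <= B.
  have : (k%:R - 1) * r <= (k%:R - 1) * rh by apply: ler_wpM2l => //; lra.
  have : k%:R * (k%:R - 1) <= k%:R ^+ 2 :> R by rewrite expr2 mulrBr mulr1 gerBl.
  have : 0 <= k%:R * (k%:R - 1) :> R by rewrite mulr_ge0 //; lra.
  rewrite /B; lra.
have h4 : (k%:R + 1) * ((k%:R - 1) * r - k%:R ^+ 2) * r ^+ k.-1.*2.+1 <=
    (k%:R + 1) * B * r ^+ k.-1.*2.+1.
  by apply: ler_wpM2r => //; apply: ler_wpM2l => //; lra.
apply: le_trans (_ : _ <= (k%:R + 1) * B * r ^+ k.-1.*2.+1) _; last by lra.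
apply: le_trans h4; rewrite le_eqVlt; apply/orP; left; apply/eqP.
have -> : (r ^+ 2) ^+ k = r * r ^+ k.-1.*2.+1.
  by rewrite -exprM mul2n -exprS {1}kS doubleS.
have rn0 : r != 0 by rewrite gt_eqF.
by field.
Qed.

Lemma lower_bound_trace (G : sgraph) (sp : spectrum R G) : (0 < #|G|)%N ->
  (2 * n%:R * c + n%:R ^+ 2 * 2 ^+ k + 1) * (nb_edges G)%:R ^+ k <= tr G n ->
  c * (nb_edges G)%:R ^+ k <= N G.
Proof.
move=> G0 h; have k1 : (1 <= k)%N by lia.
have := le_trans h (trace_le_copies_crude sp k1 G0); rewrite exprMn => h2.
have n0 : 0 < 2 * n%:R :> R by rewrite mulr_gt0 // ltr0n.
have M0 : 0 <= (nb_edges G)%:R ^+ k :> R by exact: exprn_ge0.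
by rewrite -(ler_pM2l n0); lra.
Qed.

(** To leading order the trace exceeds 2 n c m^k by 2 n gm m^k. Half of this surplus pays for the
    lower-order term of [trace_lower], the other half for the degenerate walks. *)
Lemma lower_bound_sparse (G : sgraph) (sp : spectrum R G) (r C2 dl gm : R) i0 :
  (0 < #|G|)%N -> lam sp i0 = rho R G -> 0 < r -> r ^+ 2 = (nb_edges G)%:R ->
  r <= rho R G ->
  (k%:R - 1) * rho R G + r ^+ 2 - k%:R * (k%:R - 1) / 2 < rho R G ^+ 2 ->
  0 <= C2 ->
  (forall b, (1 <= b < k)%N -> tr G b.*2.+1 <= C2 * (nb_edges G)%:R ^+ b) ->
  (forall v : G, (deg v)%:R <= dl * (nb_edges G)%:R) ->
  gm = (k%:R ^+ 2 - 1) / (2 * n%:R) - c ->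
  n%:R * 2 ^+ k * C2 * dl <= gm ->
  (k%:R + 1) * k%:R ^+ 2 / r <= n%:R * gm ->
  c * (nb_edges G)%:R ^+ k <= N G.
Proof.
move=> G0 h0 r0 rm rrh hq C20 hC hD gmE hdl hr; have k1 : (1 <= k)%N by lia.
have T1 := trace_lower G0 h0 r0 rm rrh hq.
have T2 := trace_le_copies_degree sp k1 G0 C20 hD hC.
have n0 : 0 < n%:R :> R by rewrite ltr0n.
have M0 : 0 <= (nb_edges G)%:R ^+ k :> R by exact: exprn_ge0.
have e : 2 ^+ k * C2 * (dl * (nb_edges G)%:R) * (nb_edges G)%:R ^+ k.-1 =
    2 ^+ k * C2 * dl * (nb_edges G)%:R ^+ k.
  by rewrite -{4}(prednK k1) exprS; ring.
rewrite e in T2.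
have n20 : 0 < 2 * n%:R :> R by rewrite mulr_gt0.
have kE : k%:R ^+ 2 - 1 = 2 * n%:R * (gm + c) :> R.
  by rewrite gmE subrK mulrC divfK // gt_eqF.
have h1 := ler_wpM2r M0 hr.
have h2 := ler_wpM2l (ltW n0) (ler_wpM2r M0 hdl).
rewrite -(ler_pM2l n20); rewrite kE in T1.
have := le_trans T1 T2; rewrite expr2; lra.
Qed.
End LowerBound.

(** * Graphs with a vertex of large degree *)

Section Dense.
Variables (R : realType) (k : nat).
Hypothesis k2 : (2 <= k)%N.
Local Notation c := (cycle_constant R k).
Local Notation N G := ((nb_copies (cycle_graph k.*2.+1) G)%:R : R).

Lemma core_count (G : sgraph) (S : {set G}) (m eps et : R) :
  let s := #|S| in let T := #|core_nbrs S| in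
  let D := (\sum_(u in S) \sum_(v in S) adj u v)%N in
  (k < s)%N -> (s * k.-1 <= D)%N -> (s = k.+1 -> (k ^ 2 <= D)%N) ->
  0 <= m -> 0 <= et -> et < 1 -> c * k%:R * et <= eps ->
  m * (1 - et) <= s%:R * (T%:R - k%:R) ->
  (c - eps) * m ^+ k <= N G.
Proof.
move=> s T D ks sD hs m0 et0 et1 hek hT.
have c0 := cycle_constant_gt0 R k2.
have s0 : 0 < s%:R :> R by rewrite ltr0n; lia.
have kj : k = (k - 2).+2 by lia.
have cc : (D * ((s - 2) ^_ k.-1 * T ^_ k) <= 2 * nb_copies (cycle_graph k.*2.+1) G)%N.
  have := @core_cycles G S (core_nbrs S) (k - 2).
  rewrite -kj; have -> : (k - 2).+1 = k.-1 by lia.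
  apply=> [v|u v uS]; rewrite inE => /andP[// _ /forall_inP]; exact.
have C1 := core_constant R k2 ks sD (core_degree_even S) hs.
(* The second alternative, T < k, is harmless: [hT] then forces m = 0. *)
have T1 : (T%:R - k%:R) ^+ k <= (T ^_ k)%N%:R :> R \/ T%:R - k%:R < 0 :> R.
  have [Tk|Tk] := ltrP (T%:R - k%:R : R) 0; [by right|left].
  have kT : (k <= T)%N by rewrite -(ler_nat R) -subr_ge0.
  rewrite -natrB // -natrX ler_nat.
  have gen i : (i <= k)%N -> ((T - k) ^ i <= T ^_ i)%N.
    elim: i => [//|i IH] ik; rewrite ffactnSr expnSr; apply: leq_mul.
      exact/IH/ltnW.
    by rewrite leq_sub2l // ltnW.
  exact: gen.
case: T1 => [T1|T1]; last first.
  have m00 : m = 0.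
    apply/eqP; rewrite eq_le m0 andbT leNgt; apply/negP => mp.
    have : 0 < m * (1 - et) by rewrite mulr_gt0 // subr_gt0.
    have : s%:R * (T%:R - k%:R) < 0 :> R by rewrite pmulr_rlt0.
    lra.
  by rewrite m00 expr0n; case: (k) k2 => [//|kk] _ /=; rewrite mulr0.
have e1 : (m * (1 - et)) ^+ k <= (s%:R * (T%:R - k%:R)) ^+ k.
  by apply: lerXn2r; rewrite ?nnegrE ?(le_trans _ hT) // mulr_ge0 // subr_ge0 ltW.
have Mk : 0 <= m ^+ k by exact: exprn_ge0.
have e2 : m ^+ k * (1 - k%:R * et) <= s%:R ^+ k * (T ^_ k)%N%:R.
  apply: le_trans (_ : (m * (1 - et)) ^+ k <= _).
    by rewrite exprMn; apply: ler_wpM2l => //; apply: bernoulli => //; exact: ltW.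
  by apply: le_trans e1 _; rewrite exprMn; apply: ler_wpM2l.
have e3 : 2 * c * (m ^+ k * (1 - k%:R * et)) <= 2 * N G.
  apply: le_trans (_ : 2 * c * (s%:R ^+ k * (T ^_ k)%N%:R) <= _).
    by apply: ler_wpM2l => //; rewrite mulr_ge0 // ltW.
  apply: le_trans (_ : (D * (s - 2) ^_ k.-1)%N%:R * (T ^_ k)%N%:R <= _).
    by rewrite mulrA; apply: ler_wpM2r.
  by rewrite -natrM -[2 * N G]natrM ler_nat -mulnA.
have e4 : c * k%:R * et * m ^+ k <= eps * m ^+ k by apply: ler_wpM2r.
lra.
Qed.

Lemma final_threshold (q0 K K2 sm C dl eps : R) :
  0 <= K -> 0 <= K2 -> 0 <= sm -> 1 <= C -> 0 < dl -> 0 < eps ->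
  exists Q0 : R, 1 <= Q0 /\ forall q, Q0 <= q ->
    [/\ q0 <= q, 2 * K <= q * dl, 3 * C + 2 * K2 + 2 * k%:R ^+ 2 + 4 * sm <= q,
        2 * sm ^+ 3 + sm * k%:R ^+ 2 <= q
      & 2 * (K2 + sm * k%:R) <= q /\ c * k%:R * (K2 + sm * k%:R) <= q * eps].
Proof.
move=> K0 K20 sm0 C1 dl0 eps0; have c0 := ltW (cycle_constant_gt0 R k2).
exists (`|q0| + 2 * K / dl + (3 * C + 2 * K2 + 2 * k%:R ^+ 2 + 4 * sm)
  + (2 * sm ^+ 3 + sm * k%:R ^+ 2) + 2 * (K2 + sm * k%:R)
  + c * k%:R * (K2 + sm * k%:R) / eps).
have smk : 0 <= sm * k%:R by exact: mulr_ge0.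
have h1 : 0 <= 2 * K / dl by apply: divr_ge0; [exact: mulr_ge0|exact: ltW].
have h2 : 0 <= k%:R ^+ 2 :> R by exact: sqr_ge0.
have h3 : 0 <= sm ^+ 3 by exact: exprn_ge0.
have h4 : 0 <= sm * k%:R ^+ 2 by exact: mulr_ge0.
have h5 : 0 <= c * k%:R * (K2 + sm * k%:R) / eps.
  apply: divr_ge0; last exact: ltW.
  by apply: mulr_ge0; [exact: mulr_ge0|exact: addr_ge0].
have h6 := normr_ge0 q0; have h7 := ler_norm q0.
split; first by lra.
move=> q hq; split; [lra| |lra|lra|split; first by lra].
  by rewrite -ler_pdivrMr //; lra.
by rewrite -ler_pdivrMr //; lra.
Qed.

Lemma dense_conclusion (K2 sm C eps q rh : R) (G : sgraph) (x : G -> R)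
    (S : {set G}) (u0 : G) :
  0 <= K2 -> 0 <= sm -> 1 <= C -> 1 <= q -> 0 < eps ->
  3 * C + 2 * K2 + 2 * k%:R ^+ 2 + 4 * sm <= q ->
  2 * sm ^+ 3 + sm * k%:R ^+ 2 <= q ->
  2 * (K2 + sm * k%:R) <= q -> c * k%:R * (K2 + sm * k%:R) <= q * eps ->
  q ^+ 4 = (nb_edges G)%:R -> q ^+ 2 <= rh -> rh <= q ^+ 2 + C ->
  (k%:R - 1) * rh + q ^+ 4 - k%:R * (k%:R - 1) / 2 < rh ^+ 2 ->
  (forall u, 0 <= x u) -> (forall u, \sum_v (adj u v)%:R * x v = rh * x u) ->
  u0 \in S -> 0 < x u0 -> #|S|%:R <= sm ->
  q ^+ 4 - K2 * q ^+ 3 <= #|S|%:R * #|core_nbrs S|%:R ->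
  (forall w w', w \notin S -> w' \notin S ->
     2 * rh * (x w * x w') <= \sum_(u in S) x u ^+ 2) ->
  (c - eps) * (nb_edges G)%:R ^+ k <= N G.
Proof.
move=> K20 sm0 C1 q1 eps0 hQ2 hQ3 hQ4 hQ5 q4m qrh rhC hq x0 hx u0S xu0 ssm sT hW.
have qp : 0 < q by lra.
have q20 : 0 < q ^+ 2 by exact: exprn_gt0.
have q30 : 0 < q ^+ 3 by exact: exprn_gt0.
have q43 : q ^+ 4 = q * q ^+ 3 by rewrite exprS.
have rh0 : 0 <= rh by lra.
have kR : 2 <= k%:R :> R by rewrite ler_nat.
have hI := core_ineq rh0 x0 hx hW.
have S0 : (0 < #|S|)%N by apply/card_gt0P; exists u0.
have s1 : 1 <= #|S|%:R :> R by rewrite ler1n.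
have D0 : 0 <= \sum_(u in S) \sum_(v in S) (adj u v)%:R :> R.
  by apply: sumr_ge0 => u _; apply: sumr_ge0.
have xu : exists2 u, u \in S & 0 < x u by exists u0.
have spread := fun K M => @spread_ineq R G x rh K M S rh0 x0 xu.
move: spread hI; cbv beta zeta => spread hI.
set D := (\sum_(u in S) \sum_(v in S) _) in hI D0 spread.
have DE : D = (\sum_(u in S) \sum_(v in S) adj u v)%N%:R.
  by rewrite natr_sum; apply: eq_bigr => u _; rewrite natr_sum.
have size := fun h => @core_size R G S k rh k2 S0 h.
rewrite -DE in size.
have count := fun et => @core_count G S (nb_edges G)%:R eps et.
move: hI spread size count sT ssm s1; cbv zeta.
set s : R := #|S|%:R; set T : R := #|core_nbrs S|%:R.
move: s T D D0 {DE hW hx xu} => s T D D0 hI spread size count sT ssm s1.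
have q32 : q ^+ 2 <= q ^+ 3 by rewrite [leRHS]exprS ler_peMl // ltW.
have q31 : 1 <= q ^+ 3 by exact: exprn_ege1.
have [ks sD hs] : [/\ (k < #|S|)%N, (#|S| * k.-1 <= \sum_(u in S) \sum_(v in S) adj u v)%N
    & #|S| = k.+1 -> (k ^ 2 <= \sum_(u in S) \sum_(v in S) adj u v)%N].
  apply: size.
    have h1 : s ^+ 3 <= sm ^+ 3 by apply: lerXn2r; rewrite ?nnegrE //; lra.
    have h2 : s * k%:R ^+ 2 <= sm * k%:R ^+ 2 by apply: ler_wpM2r => //; exact: sqr_ge0.
    have h3 : q <= q ^+ 2 by rewrite expr2 ler_peMl // ltW.
    lra.
  (* This is the quantity that rho > g_k(m) puts strictly below rh^2 - m + D / 2; with it the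
     conclusion of [spread_ineq] becomes the hypothesis of [core_size]. *)
  pose Kc := (k%:R - 1) * rh + D / 2 - k%:R * (k%:R - 1) / 2.
  have Kc0 : - k%:R ^+ 2 <= Kc.
    have kk0 : 0 <= k%:R * (k%:R - 1) :> R by rewrite mulr_ge0 //; lra.
    have kk : k%:R * (k%:R - 1) <= k%:R ^+ 2 :> R by rewrite expr2 mulrBr mulr1 gerBl.
    have : 0 <= (k%:R - 1) * rh by rewrite mulr_ge0 //; lra.
    rewrite /Kc; lra.
  (* The bracket is taken as [M], which turns one hypothesis of [spread_ineq] into an equality. It
     is at least m - O(q^3), while rh^2 is at most m + O(q^2), so the factor 2 leaves ample room. *)
  have rhM : rh ^+ 2 <= 2 * (T * s + Kc - rh * s).
    have Cq : C <= q ^+ 2.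
      have : q <= q ^+ 2 by rewrite expr2 ler_peMl // ltW.
      have := sqr_ge0 (k%:R : R); lra.
    have h1 : rh ^+ 2 <= q ^+ 4 + 3 * C * q ^+ 2.
      apply: le_trans (_ : (q ^+ 2 + C) ^+ 2 <= _).
        by apply: lerXn2r; rewrite ?nnegrE //; lra.
      have h : C * C <= C * q ^+ 2 by apply: ler_wpM2l => //; move: C1; clear; lra.
      have -> : (q ^+ 2 + C) ^+ 2 = q ^+ 4 + 2 * (C * q ^+ 2) + C * C by ring.
      lra.
    have h2 : rh * s <= 2 * q ^+ 2 * sm.
      by apply: ler_pM => //; move: rhC Cq s1; clear; lra.
    have h3 := ler_wpM2r (ltW q30) hQ2; rewrite -q43 in h3.
    have h4 : C * q ^+ 2 <= C * q ^+ 3 by apply: ler_wpM2l => //; lra.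
    have h5 : sm * q ^+ 2 <= sm * q ^+ 3 by apply: ler_wpM2l.
    have h6 : k%:R ^+ 2 * 1 <= k%:R ^+ 2 * q ^+ 3 by apply: ler_wpM2l => //; exact: sqr_ge0.
    rewrite [T * s]mulrC; clear -h1 h2 h3 h4 h5 h6 sT Kc0; lra.
  have M0 : 0 < T * s + Kc - rh * s.
    have : 0 < rh ^+ 2 by rewrite exprn_gt0 //; lra.
    clear -rhM; lra.
  have hV := spread Kc _ M0 rhM.
  apply: le_lt_trans (hV _ hI _).
  - by rewrite le_eqVlt; apply/orP; left; apply/eqP; rewrite /Kc; ring.
  - by rewrite subrK.
  - by rewrite /Kc -q4m; clear -hq; lra.
(* [K2] comes from the edges missing between S and T, and [sm * k] from replacing |T| by |T| - k. *)
apply: (count ((K2 + sm * k%:R) / q)) => //.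
- by apply: divr_ge0; [apply: addr_ge0 => //; exact: mulr_ge0|exact: ltW].
- have : 0 <= sm * k%:R by exact: mulr_ge0.
  by rewrite ltr_pdivrMr // mul1r; lra.
- by rewrite mulrA ler_pdivrMr // [eps * q]mulrC.
rewrite -q4m.
have -> : q ^+ 4 * (1 - (K2 + sm * k%:R) / q) = q ^+ 4 - (K2 + sm * k%:R) * q ^+ 3.
  by rewrite q43; field; rewrite gt_eqF.
have h1 : s * k%:R <= sm * k%:R * q ^+ 3.
  rewrite -[leLHS]mulr1; apply: ler_pM => //; first by rewrite mulr_ge0 //; lra.
  by apply: ler_wpM2r.
clear -h1 sT; lra.
Qed.

(** The degree of [v] is at most 4 m x_v^2 + K q^3, and half of dl m absorbs the error. This leaves
    dl < 8 x_v^2 <= 8 x_v, whence the factor 8. *)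
Lemma top_weight_ge (G : sgraph) (x : G -> R) (rh K q dl b : R) (v u0 : G) :
  0 < q -> 0 < dl -> b * 8 <= dl -> 2 * K <= q * dl ->
  rh ^+ 2 <= 2 * q ^+ 4 -> 0 <= x v -> x v <= 1 -> x v <= x u0 ->
  `|(nwalk 2 v v)%:R - 2 * rh ^+ 2 * (x v * x v)| <= K * q ^+ 3 ->
  dl * q ^+ 4 < (deg v)%:R -> b <= x u0.
Proof.
move=> qp dl0 bdl hK rhm xv0 xv1 xvu; rewrite nwalk2_diag ler_norml => /andP[_ h] hv.
have q30 : 0 < q ^+ 3 by exact: exprn_gt0.
have q40 : 0 < q ^+ 4 by exact: exprn_gt0.
have Kq := ler_wpM2r (ltW q30) hK.
have q43 : q ^+ 4 = q * q ^+ 3 by rewrite exprS.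
have h2 : 2 * rh ^+ 2 * (x v * x v) <= 4 * q ^+ 4 * (x v * x v).
  by apply: ler_wpM2r; [exact: mulr_ge0|lra].
have h3 : q ^+ 4 * dl < q ^+ 4 * (8 * (x v * x v)).
  have : 2 * K * q ^+ 3 <= dl * q ^+ 4 by rewrite q43; lra.
  lra.
rewrite ltr_pM2l // in h3.
have h4 : x v * x v <= x v by rewrite ler_piMr.
lra.
Qed.

Lemma lower_bound_dense (C dl eps : R) : 1 <= C -> 0 < dl -> 0 < eps ->
  exists Q0 : R, 1 <= Q0 /\ forall (G : sgraph) (sp : spectrum R G) (q r : R) i0 i1,
    Q0 <= q -> r = q ^+ 2 -> r ^+ 2 = (nb_edges G)%:R -> (0 < #|G|)%N ->
    lam sp i0 = rho R G ->
    (forall u, \sum_v (adj u v)%:R * wt sp i0 v = rho R G * wt sp i0 u) ->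
    (k%:R - 1) * rho R G + r ^+ 2 - k%:R * (k%:R - 1) / 2 < rho R G ^+ 2 ->
    r <= rho R G -> rho R G <= r + C ->
    i1 != i0 -> - r <= lam sp i1 -> lam sp i1 <= C - r ->
    \sum_(i | (i != i0) && (i != i1)) lam sp i ^+ 2 <= 2 * C * r ->
    (exists v : G, dl * (nb_edges G)%:R < (deg v)%:R) ->
    (c - eps) * (nb_edges G)%:R ^+ k <= N G.
Proof.
move=> C1 dl0 eps0.
have [b [b0 b1 bdl]] : exists b : R, [/\ 0 < b, b <= 1 & b * 8 <= dl].
  exists (dl / (8 + dl)); have d8 : 0 < 8 + dl by lra.
  split; first exact: divr_gt0.
    by rewrite ler_pdivrMr //; lra.
  by rewrite mulrAC ler_pdivrMr // [leRHS]mulrDr lerDl mulr_ge0 // ltW.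
have K1 : 1 <= 12 * C by lra.
have K0 : 0 <= 12 * C by lra.
have [K2 [q0 [K20 q01 HC]]] := core_exists K1 b0 b1.
have b20 : 0 < b ^+ 2 by rewrite exprn_gt0.
have sm0 : 0 <= 4 / b ^+ 2 by rewrite divr_ge0 // ltW.
have [Q0 [Q01 HQ]] := final_threshold q0 K0 K20 sm0 C1 dl0 eps0.
exists Q0; split=> // G sp q r i0 i1 hQ rE rm G0 h0 hx hq rrh rhC i10 lr lC rest [v hv].
have [q0q hK hQ2 hQ3 [hQ4 hQ5]] := HQ q hQ.
have {Q01 hQ HQ} q1 : 1 <= q by exact: le_trans q01 q0q.
have q4m : q ^+ 4 = (nb_edges G)%:R by rewrite -rm rE -exprM.
have q4r : q ^+ 4 = r ^+ 2 by rewrite rE -exprM.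
have Cr : 2 * C <= r.
  have : q <= r by rewrite rE expr2 ler_peMl //; lra.
  have := sqr_ge0 (k%:R : R); lra.
have r1 : 1 <= r by rewrite rE expr_ge1 //; lra.
have rhm : rho R G ^+ 2 <= 2 * q ^+ 4 by rewrite q4m; exact: rho_sq_le sp G0.
have rh2 : `|lam sp i0| <= 2 * r by rewrite h0 ger0_norm; move: rhC rrh Cr r1 C1; clear; lra.
have l1 : `|lam sp i1| <= r by rewrite ler_norml lr /=; move: lC Cr r1 C1; clear; lra.
have l1' : r / 2 <= `|lam sp i1|.
  by rewrite ler0_norm; move: lC Cr r1 C1; clear; lra.
have l2 : `|lam sp i1| <= 2 * r by move: l1 r1; clear; lra.
have l01 : `|lam sp i0 + lam sp i1| <= 2 * C.
  by rewrite h0 ler_norml; apply/andP; split; move: rhC rrh lr lC C1; clear; lra.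
have Qq : lam sp i1 ^+ 2 <= q ^+ 4.
  rewrite -real_normK ?num_real // q4r.
  by apply: lerXn2r; rewrite ?nnegrE //; move: r1; clear; lra.
have qQ : q ^+ 4 <= 4 * lam sp i1 ^+ 2.
  rewrite (_ : q ^+ 4 = 4 * (r / 2) ^+ 2); last by rewrite q4r expr_div_n; field.
  apply: ler_wpM2l => //; rewrite -[leRHS]real_normK ?num_real //.
  by apply: lerXn2r; rewrite ?nnegrE //; lra.
have H2 u w : `|(nwalk 2 u w)%:R - 2 * rho R G ^+ 2 * (wt sp i0 u * wt sp i0 w)| <= 12 * C * q ^+ 3.
  by rewrite -h0; apply: (codegree_estimate u w C1 q1 rE i10 rh2 l2 l01 rest).
(* The two dominant eigenvalues exchange roles: now the contribution of rho is the one that almost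
   cancels. *)
have H3 u w : `|(nwalk 2 u w)%:R - 2 * lam sp i1 ^+ 2 * (wt sp i1 u * wt sp i1 w)| <= 12 * C * q ^+ 3.
  apply: (@codegree_estimate _ _ sp C r q i1 i0) => //; first by rewrite eq_sym.
    by rewrite addrC.
  by under eq_bigl => i do rewrite andbC.
have H4 w : (deg w)%:R <= rho R G ^+ 2 * wt sp i0 w ^+ 2 +
    lam sp i1 ^+ 2 * wt sp i1 w ^+ 2 + 12 * C * q ^+ 2.
  rewrite -nwalk2_diag (walk_spec sp) (bigD1 i0) //= (bigD1 i1) //= h0 addrA lerD2l.
  apply: le_trans (_ : 2 * C * r <= _); last first.
    by rewrite -rE; apply: ler_wpM2r; move: r1 C1; clear; lra.
  apply: le_trans rest; apply: ler_sum => i _; apply: ler_piMr; first exact: sqr_ge0.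
  by rewrite expr_le1 ?wt_ge0 ?wt_le1.
have [u0 _ xmax] := @arg_maxP _ R _ v predT (wt sp i0) isT.
have bX : b <= wt sp i0 u0.
  apply: (@top_weight_ge G _ (rho R G) (12 * C) q dl b v) => //; rewrite ?wt_ge0 ?wt_le1 //.
  - lra.
  - exact: xmax.
  - by rewrite q4m.
have qrh : q ^+ 2 <= rho R G by rewrite -rE.
have [sb sT hW] := HC G _ _ _ _ q u0 q0q (wt_ge0 sp i0) (wt_ge0 sp i1) (wt_row sp i0) hx
  (fun w => xmax w isT) bX q4m qrh rhm qQ Qq H2 H3 H4.
have u0S : u0 \in core (wt sp i0) u0.
  by rewrite inE; move: (wt_ge0 sp i0 u0); clear; lra.
apply: (@dense_conclusion K2 (4 / b ^+ 2) C eps q (rho R G) G (wt sp i0)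
  (core (wt sp i0) u0) u0) => //.
- by rewrite -rE.
- by rewrite q4r.
- exact: wt_ge0.
- exact: lt_le_trans bX.
- by rewrite ler_pdivlMr.
move=> w w' wS wS'; apply: le_trans (hW w w' wS wS') _.
rewrite (bigD1 u0) //= ler_wpDr //; first by apply: sumr_ge0 => u _; exact: sqr_ge0.
by apply: lerXn2r; rewrite ?nnegrE ?(ltW b0) ?wt_ge0.
Qed.
End Dense.

Lemma lower_bound (R : realType) (k : nat) : (2 <= k)%N ->
  asymptotic_lower_bound k (cycle_constant R k).
Proof.
move=> k2 eps eps0; set c := cycle_constant R k.
have k1 : (1 <= k)%N by lia.
have c0 : 0 < c := cycle_constant_gt0 R k2.
have nn : 0 < k.*2.+1%:R :> R by rewrite ltr0n.
pose gm : R := (k%:R ^+ 2 - 1) / (2 * k.*2.+1%:R) - c.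
have gm0 : 0 < gm by rewrite subr_gt0; exact: cycle_constant_gap.
(* A trace above C m^k already gives c m^k cycles by the crude count; below it the spectral
   structure is available. *)
have [C [C1 CE]] : exists C : R, 1 <= C /\
    C = 2 * k.*2.+1%:R * c + k.*2.+1%:R ^+ 2 * 2 ^+ k + 1.
  eexists; split; last by [].
  have h1 : 0 <= k.*2.+1%:R * c by rewrite mulr_ge0 // ltW.
  have h2 : 0 <= k.*2.+1%:R ^+ 2 * 2 ^+ k :> R by rewrite mulr_ge0 // exprn_ge0.
  lra.
have C0 : 0 <= C by lra.
have [C2 [C20 C2E]] : exists C2 : R, 0 < C2 /\
    C2 = k.*2.+1%:R * (2 * C) * 2 ^+ k + (2 * C) ^+ k.*2.
  eexists; split; last by [].
  by rewrite ltr_wpDl ?exprn_gt0 ?mulr_ge0 ?exprn_ge0 //; lra.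
(* [dl] separates small from large degrees: it is small enough for the degenerate walks to use up at
   most half of the surplus measured by [gm]. *)
have [dl [dl0 hdl]] : exists dl : R, 0 < dl /\ k.*2.+1%:R * 2 ^+ k * C2 * dl <= gm.
  have p : 0 < k.*2.+1%:R * 2 ^+ k * C2 by rewrite !mulr_gt0 // exprn_gt0.
  exists (gm / (k.*2.+1%:R * 2 ^+ k * C2)); split; first exact: divr_gt0.
  by rewrite mulrC divfK // gt_eqF.
have [Q0 [Q01 HQ]] := lower_bound_dense k2 C1 dl0 eps0.
have [m0 hm0] := quartic_root_large
  (Q0 + (C + 1) + (k%:R + 1) * k%:R ^+ 2 / (k.*2.+1%:R * gm) + k%:R).
exists m0 => m G mm0 Gm hg.
have := hm0 m mm0; set r := Num.sqrt m%:R; set q := Num.sqrt r => hq.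
have r0 : 0 <= r by exact: sqrtr_ge0.
have rm : r ^+ 2 = m%:R by rewrite sqr_sqrtr.
have rE : r = q ^+ 2 by rewrite sqr_sqrtr.
have h3 : 0 <= (k%:R + 1) * k%:R ^+ 2 / (k.*2.+1%:R * gm).
  apply: divr_ge0; last exact: ltW (mulr_gt0 nn gm0).
  by apply: mulr_ge0; [exact: addr_ge0|exact: sqr_ge0].
have k0 : 0 <= k%:R :> R by [].
have [qQ0 qC qk q3] : [/\ Q0 <= q, C + 1 <= q, k%:R <= q &
   (k%:R + 1) * k%:R ^+ 2 / (k.*2.+1%:R * gm) <= q].
  move: h3 hq; set X := _ / _; move: X k0; move: (k%:R : R) => kk X kk0 X0 hq.
  by clear -hq X0 Q01 C1 kk0; split; lra.
have q1 : 1 <= q by exact: le_trans qQ0.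
have qr : q <= r by rewrite rE expr2 ler_peMl // (le_trans ler01).
have rp : 0 < r by rewrite (lt_le_trans ltr01) // (le_trans q1).
have km : (k ^ 2 <= m)%N.
  rewrite -(ler_nat R) natrX -rm; apply: lerXn2r; rewrite ?nnegrE //.
  exact: le_trans qr.
have m_gt0 : (0 < m)%N by rewrite -(ltr_nat R) -rm exprn_gt0.
have G0 : (0 < #|G|)%N by apply: nb_edges_card_gt0; rewrite Gm.
have [hq2 rrh] := g_bound_quadratic k2 km hg.
rewrite -/r in rrh; rewrite -rm in hq2.
pose sp := graph_spectrum R G.
have [i0 [h0 hx]] := perron sp G0.
rewrite -Gm in rm *.
have Mk : 0 <= (nb_edges G)%:R ^+ k :> R by exact: exprn_ge0.
have weaken : c * (nb_edges G)%:R ^+ k <= (nb_copies (cycle_graph k.*2.+1) G)%:R ->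
    (c - eps) * (nb_edges G)%:R ^+ k <= (nb_copies (cycle_graph k.*2.+1) G)%:R.
  by apply: le_trans; apply: ler_wpM2r => //; rewrite gerBl ltW.
have [trC|trC] := leP (C * (nb_edges G)%:R ^+ k)
    (\sum_(u : G) nwalk k.*2.+1 u u)%N%:R.
  by apply: weaken; apply: (lower_bound_trace k2 sp G0); rewrite -CE.
have Cr : C < r by clear -qC qr; lra.
have rsq : Num.sqrt (nb_edges G)%:R = r by rewrite -rm sqrtr_sqr ger0_norm.
have := spectral_structure k1 G0 h0 C0; rewrite rsq.
move=> /(_ Cr rrh (ltW trC)) [i1 [i10 rhC lr lC rest]].
have [hD|/existsNP[v hv]] := pselect (forall v : G, (deg v)%:R <= dl * (nb_edges G)%:R).
  apply: weaken.
  apply: (lower_bound_sparse k2 G0 h0 rp rm rrh hq2 (ltW C20) _ hD erefl hdl).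
    move=> b /andP[b1 bk].
    have := @odd_trace_le R G sp G0 C i0 i1 b h0 C1; rewrite rsq.
    move=> /(_ (le_trans q1 qr) rrh i10 rhC lr lC (ltW Cr) rest b1) /le_trans; apply.
    apply: ler_wpM2r; first exact: exprn_ge0.
    have C21 : 1 <= 2 * C by clear -C1; lra.
    have C2p : 0 <= 2 * C by clear -C1; lra.
    rewrite C2E; apply: lerD; last by rewrite ler_weXn2l // leq_double ltnW.
    apply: ler_pM; rewrite ?mulr_ge0 ?exprn_ge0 //.
      by apply: ler_wpM2r => //; rewrite ler_nat ltnS leq_double ltnW.
    by rewrite ler_weXn2l ?ler1n // ltnW.
  rewrite ler_pdivrMr //.
  apply: le_trans (_ : k.*2.+1%:R * gm * q <= _); last by apply: ler_wpM2l; rewrite ?mulr_ge0 // ltW.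
  by rewrite [leRHS]mulrC -ler_pdivrMr //; exact: mulr_gt0.
apply: (HQ G sp q r i0 i1) => //.
by exists v; rewrite ltNge; apply/negP.
Qed.

(** * The extremal graphs *)

Section Symmetry.
Variables (n : nat) (G : sgraph).
Hypothesis n3 : (3 <= n)%N.

Definition reindexed (s : 'I_n -> 'I_n) (f : {ffun 'I_n -> G}) : {ffun 'I_n -> G} :=
  [ffun i => f (s i)].

Lemma reindexed_copy s f : bijective s ->
  (forall i j, cycle_adj (s i) (s j) = cycle_adj i j) ->
  f \in cyc_homs n G ->
  reindexed s f \in cyc_homs n G /\ copy_of (reindexed s f) = copy_of f.
Proof.
move=> [s' sK s'K] sA fh.
have fi : injective f by move: fh; rewrite inE => /andP[/injectiveP].
split.
  rewrite inE; apply/andP; split.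
    by apply/injectiveP => i j; rewrite !ffunE => /fi/(can_inj sK).
  by apply/forallP => i; rewrite !ffunE; apply: (cyc_homs_adj fh); rewrite sA cycle_adjS.
congr (_, _).
  apply/setP => v; apply/imsetP/imsetP => -[i _ ->].
    by exists (s i); rewrite ?ffunE.
  by exists (s' i); rewrite ?ffunE ?s'K.
apply/setP => e; apply/imsetP/imsetP => -[[i j]]; rewrite inE /= => ij ->.
  by exists (s i, s j); rewrite ?inE /= ?sA ?ffunE.
exists (s' i, s' j); last by rewrite /= !ffunE !s'K.
by rewrite inE /= -(sA (s' i)) !s'K.
Qed.

Lemma ordS_cycle_adj (i j : 'I_n) : cycle_adj (ordS i) (ordS j) = cycle_adj i j.
Proof. by rewrite /cycle_adj !(inj_eq (can_inj (@ordSK n))). Qed.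

Lemma ordS_rev (i : 'I_n) : ordS (rev_ord (ordS i)) = rev_ord i.
Proof.
apply: val_inj; rewrite val_ordS /=.
have := ltn_ord i; have := val_ordS i; rewrite /= => ->.
by case: (eqVneq i.+1 n) => [e|ne] hi; case: ifP => /eqP; lia.
Qed.

Lemma rev_cycle_adj (i j : 'I_n) : cycle_adj (rev_ord i) (rev_ord j) = cycle_adj i j.
Proof.
rewrite /cycle_adj (inj_eq rev_ord_inj) orbC; congr (_ && (_ || _)).
  by rewrite -(ordS_rev i) (inj_eq (can_inj (@ordSK n))) (inj_eq rev_ord_inj) eq_sym.
by rewrite -(ordS_rev j) (inj_eq (can_inj (@ordSK n))) (inj_eq rev_ord_inj) eq_sym.
Qed.

Lemma ordS_iter_copy p f : f \in cyc_homs n G ->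
  reindexed (iter p (@ordS n)) f \in cyc_homs n G /\
  copy_of (reindexed (iter p (@ordS n)) f) = copy_of f.
Proof.
move=> fh; apply: reindexed_copy => //.
  elim: p => [|p IH]; first by exists id.
  by apply: bij_comp IH; exists (@ord_pred n); [exact: ordSK|exact: ord_predK].
by elim: p => [//|p IH] i j; rewrite !iterS ordS_cycle_adj.
Qed.

Lemma rev_copy f : f \in cyc_homs n G ->
  reindexed (@rev_ord n) f \in cyc_homs n G /\
  copy_of (reindexed (@rev_ord n) f) = copy_of f.
Proof.
move=> fh; apply: reindexed_copy => //; last exact: rev_cycle_adj.
by exists (@rev_ord n); exact: rev_ordK.
Qed.
End Symmetry.

Section Representatives.
Variables (G : sgraph) (S : {set G}) (j : nat).
Hypotheses (indep : forall u v, u \notin S -> v \notin S -> ~~ adj u v)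
  (cardS : #|S| = j.+3).
Local Notation k := (j.+2).
Local Notation n := (k.*2.+1).

Let n3 : (3 <= n)%N. Proof. by rewrite !doubleS. Qed.

Lemma iter_ordS p (hp : (p < n)%N) : iter p (@ordS n) ord0 = Ordinal hp.
Proof.
elim: p hp => [|p IH] hp; first exact: val_inj.
rewrite iterS (IH (ltnW hp)); apply: val_inj; rewrite val_ordS /=.
by case: ifP => //; lia.
Qed.

Lemma cyc_homs_SS f : f \in cyc_homs n G ->
  exists i : 'I_n, (f i \in S) && (f (ordS i) \in S).
Proof.
move=> fh; apply/existsP; apply: contraT; rewrite negb_exists => /forallP h.
have step (i : 'I_n) : (f (ordS i) \in S) = ~~ (f i \in S).
  have := h i; case fi: (f i \in S) => /=; first by move/negbTE.
  move=> _.
  apply: contraT => fS; have := indep (negbT fi) fS.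
  by rewrite (cyc_homs_adj fh) // cycle_adjS.
have alt p (hp : (p < n)%N) : (f (Ordinal hp) \in S) = (f ord0 \in S) (+) odd p.
  elim: p hp => [|p IH] hp.
    by rewrite addbF; congr (f _ \in S); apply: val_inj.
  rewrite -iter_ordS iterS (iter_ordS (ltnW hp)) step IH /=.
  by case: (f ord0 \in S); case: odd.
have := step ord_max.
have -> : ordS (ord_max : 'I_n) = ord0 by apply: val_inj; rewrite val_ordS /= eqxx.
have -> : (ord_max : 'I_n) = Ordinal (ltnSn k.*2) by apply: val_inj.
by rewrite alt odd_double addbF; case: (f ord0 \in S).
Qed.

Lemma sum_pairs (b : nat -> nat) p :
  (\sum_(i < p.*2.+1) b i = \sum_(i < p) (b i.*2 + b i.*2.+1) + b p.*2)%N.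
Proof.
elim: p => [|p IH]; first by rewrite big_ord_recr !big_ord0.
rewrite doubleS !big_ord_recr /= -(big_ord_recr p.*2 (fun i => b i)) IH.
by rewrite -!addnA.
Qed.

(* [S] meets each of the k disjoint pairs of positions 2i, 2i + 1 as well as the
   last position 2k, and it has only k + 1 elements. *)
Lemma alternating_ends f : f \in cyc_homs n G ->
  f ord0 \in S -> f ord_max \in S -> f \in alternating_homs S j.
Proof.
move=> fh f0 fm.
have fi : injective f by move: fh; rewrite inE => /andP[/injectiveP].
pose b (i : nat) : nat := f (inord i) \in S.
have bE (i : 'I_n) : b i = (f i \in S) by rewrite /b inord_val.
have b1 i : (b i <= 1)%N by rewrite /b; case: (_ \in S).
have consec i : (i.+1 < n)%N -> (1 <= b i + b i.+1)%N.
  move=> hi; rewrite /b.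
  have e : inord i.+1 = ordS (inord i : 'I_n).
    by apply: val_inj; rewrite val_ordS /= !inordK ?(ltnW hi) // ltn_eqF.
  case: (boolP (f (inord i) \in S)) => // h1.
  case: (boolP (f (inord i.+1) \in S)) => // h2.
  by have := indep h1 h2; rewrite e (cyc_homs_adj fh) // cycle_adjS.
move: b bE b1 consec => b bE b1 consec.
have tot : (\sum_(i < n) b i <= k.+1)%N.
  rewrite -cardS; have -> : (\sum_(i < n) b i = #|[set i | f i \in S]%SET|)%N.
    rewrite -sum1_card [RHS]big_mkcond; apply: eq_bigr => i _.
    by rewrite bE inE; case: (_ \in S).
  rewrite -(card_imset _ fi); apply/subset_leq_card/fintype.subsetP => v hv.
  have [i hi ->] := imsetP hv.
  by rewrite inE in hi.
have bm : b k.*2 = 1%N.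
  by have := bE ord_max; rewrite fm.
have pairs i : (i < k)%N -> (b i.*2 + b i.*2.+1 = 1)%N.
  move=> ik; move: tot; rewrite sum_pairs bm (bigD1 (Ordinal ik)) //=.
  have : (k.-1 <= \sum_(i0 < k | i0 != Ordinal ik) (b i0.*2 + b i0.*2.+1))%N.
    have -> : k.-1 = (\sum_(i0 < k | i0 != Ordinal ik) 1)%N.
      by rewrite sum1_card cardC1 card_ord.
    by apply: leq_sum => i0 _; apply: consec; have := ltn_ord i0; lia.
  have c1 : (1 <= b i.*2 + b i.*2.+1)%N by apply: consec; lia.
  move: c1; move: (b i.*2 + b i.*2.+1)%N (\sum_(_ < _ | _) _)%N => x y.
  by clear; lia.
have b0 : b 0 = 1%N by have := bE ord0; rewrite f0.
have even i : (i <= k)%N -> b i.*2 = 1%N.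
  elim: i => [//|i IH] ik; have := pairs i ik; rewrite IH ?(ltnW ik) // => bo.
  have c1 : (1 <= b i.*2.+1 + b i.*2.+2)%N by apply: consec; lia.
  by rewrite doubleS; move: c1 (b1 i.*2.+2) bo; lia.
rewrite inE fh /=; apply/forallP => i.
have hb := bE i; have := odd_double_half i; case oi: (odd i) => /= e.
  have e' : (i./2.*2.+1 = i)%N by [].
  have ik : (i./2 < k)%N by have := ltn_ord i; lia.
  by have := pairs _ ik; rewrite even ?(ltnW ik) // e' hb; case: (f i \in S).
have e' : (i./2.*2 = i)%N by [].
have ik : (i./2 <= k)%N by have := ltn_ord i; lia.
by have := even _ ik; rewrite e' hb; case: (f i \in S).
Qed.

(** A rotation by i + 1 brings the edge inside S found by [cyc_homs_SS] between [ord_max] and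
    [ord0]. *)
Lemma alternating_repr f : f \in cyc_homs n G ->
  exists2 g, g \in alternating_homs S j & copy_of g = copy_of f.
Proof.
move=> fh; have [i /andP[i1 i2]] := cyc_homs_SS fh.
have [gh gc] := ordS_iter_copy n3 i.+1 fh.
exists (reindexed (iter i.+1 (@ordS n)) f) => //.
have it : iter i (@ordS n) ord0 = i.
  by rewrite (iter_ordS (ltn_ord i)); apply: val_inj.
apply: alternating_ends => //; rewrite ffunE.
  by rewrite iterS it.
rewrite iterSr; have -> : ordS (ord_max : 'I_n) = ord0.
  by apply: val_inj; rewrite val_ordS /= eqxx.
by rewrite it.
Qed.

(** The reflection of the cycle exchanges the two ends, so one orientation of each inner edge is
    enough. This saves the factor 2 that the count must not lose. *)
Lemma nb_copies_le_alternating (E : {set G * G}) :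
  (forall u v, u \in S -> v \in S -> adj u v -> ((u, v) \in E) || ((v, u) \in E)) ->
  (nb_copies (cycle_graph n) G <=
   #|[set f in alternating_homs S j | (f ord0, f ord_max) \in E]|)%N.
Proof.
move=> hE; rewrite nb_copiesE //.
apply: leq_trans (leq_imset_card (@copy_of n G) _).
apply/subset_leq_card/fintype.subsetP => H /imsetP[f fh ->].
have [g gA <-] := alternating_repr fh.
have gh : g \in cyc_homs n G by move: gA; rewrite inE => /andP[].
have r0 : rev_ord (ord0 : 'I_n) = ord_max by apply: val_inj; rewrite /= subn1.
have rm : rev_ord (ord_max : 'I_n) = ord0 by rewrite -r0 rev_ordK.
have g0 : g ord0 \in S by rewrite (alternatingS _ gA).
have gm : g ord_max \in S by rewrite (alternatingS _ gA) /= odd_double.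
have ad : adj (g ord0) (g ord_max).
  rewrite adj_sym; apply: (cyc_homs_adj gh).
  have -> : (ord0 : 'I_n) = ordS ord_max.
    by apply: val_inj; rewrite val_ordS /= eqxx.
  exact: cycle_adjS.
have [h|h] := orP (hE _ _ g0 gm ad).
  by apply/imsetP; exists g => //; apply/setIdP.
have [rh rc] := rev_copy n3 gh.
apply/imsetP; exists (reindexed (@rev_ord n) g); last by rewrite rc.
apply/setIdP; split; last by rewrite !ffunE r0 rm.
by apply: alternating_ends => //; rewrite ffunE ?r0 ?rm.
Qed.

(** Once the ends are fixed, the other k - 1 vertices of S fill the inner even positions in some
    order, and the odd positions are bounded by arbitrary choices outside S, repetitions
    included. *)
Lemma alternating_family_le (E : {set G * G}) :
  (#|[set f in alternating_homs S j | (f ord0, f ord_max) \in E]| <=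
   #|E| * (j.+1`! * #|~: S| ^ k))%N.
Proof.
rewrite -sum1_card (partition_big (fun f : {ffun 'I_n -> G} => (f ord0, f ord_max))
  [in E]) /=; last by move=> f /setIdP[].
rewrite -sum_nat_const; apply: leq_sum => p pE; rewrite sum1dep_card.
set X := [set f | _]%SET.
pose he (a : 'I_j.+1) : 'I_n := inord a.+1.*2.
pose ho (a : 'I_j.+2) : 'I_n := inord a.*2.+1.
have heE a : he a = a.+1.*2 :> nat by rewrite inordK //; have := ltn_ord a; lia.
have hoE a : ho a = a.*2.+1 :> nat by rewrite inordK //; have := ltn_ord a; lia.
pose phi (f : {ffun 'I_n -> G}) : {ffun 'I_j.+1 -> G} * {ffun 'I_j.+2 -> G} :=
  ([ffun a => f (he a)], [ffun a => f (ho a)]).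
have phi_inj : {in X &, injective phi}.
  move=> f g; rewrite !inE => /andP[_ /eqP fp] /andP[_ /eqP gp] [/ffunP e1 /ffunP e2].
  rewrite -fp in gp; case: gp => g0 gm; apply/ffunP => i.
  have [->//|i0] := eqVneq i ord0.
  have [->//|im] := eqVneq i ord_max.
  have := odd_double_half i; have hi := ltn_ord i.
  have i0' : (nat_of_ord i != 0)%N by rewrite -val_eqE in i0.
  have im' : (nat_of_ord i != k.*2)%N by rewrite -val_eqE in im.
  case oi: (odd i) => /= ei.
    have ha : (i./2 < j.+2)%N by lia.
    have := e2 (Ordinal ha); rewrite !ffunE.
    by have -> : ho (Ordinal ha) = i by apply: val_inj; rewrite /= hoE /=; lia.
  have ha : (i./2.-1 < j.+1)%N by lia.
  have := e1 (Ordinal ha); rewrite !ffunE.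
  by have -> : he (Ordinal ha) = i by apply: val_inj; rewrite /= heE /=; lia.
have [->|[f1 f1X]] := set_0Vmem X; first by rewrite cards0.
have p12 : [/\ p.1 \in S, p.2 \in S & p.1 != p.2].
  move: f1X; rewrite inE => /andP[/setIdP[fA _] /eqP <-] /=.
  rewrite !(alternatingS _ fA) /= odd_double; split=> //.
  have fh : f1 \in cyc_homs n G by move: fA; rewrite inE => /andP[].
  have fi : injective f1 by move: fh; rewrite inE => /andP[/injectiveP].
  by rewrite (inj_eq fi).
case: p12 => p1 p2 p3.
pose Xg := [set g : {ffun 'I_j.+1 -> G} in ffun_on (S :\ p.1 :\ p.2)%SET | injectiveb g]%SET.
pose Xh := [set h : {ffun 'I_j.+2 -> G} in ffun_on (~: S)%SET]%SET.
have cg : #|Xg| = (j.+1`!)%N.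
  rewrite card_inj_ffuns_on card_ord.
  have -> : #|(S :\ p.1 :\ p.2)%SET| = j.+1.
    have := cardsD1 p.1 S; have := cardsD1 p.2 (S :\ p.1)%SET.
    by rewrite p1 !inE eq_sym p3 p2 cardS /=; lia.
  exact: ffactnn.
have ch : #|Xh| = (#|~: S| ^ k)%N.
  by rewrite cardsE card_ffun_on card_ord.
rewrite -cg -ch -cardsX -(card_in_imset phi_inj).
apply/subset_leq_card/fintype.subsetP => y /imsetP[f]; rewrite inE.
move=> /andP[/setIdP[fA _] /eqP fp] ->{y}.
have fh : f \in cyc_homs n G by move: fA; rewrite inE => /andP[].
have fi : injective f by move: fh; rewrite inE => /andP[/injectiveP].
have f0 : f ord0 = p.1 by rewrite -fp.
have fm : f ord_max = p.2 by rewrite -fp.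
apply/setXP; split; rewrite inE /=; last first.
  apply/ffun_onP => a; rewrite ffunE inE (alternatingS _ fA) hoE /= odd_double //.
apply/andP; split.
  apply/ffun_onP => a; rewrite ffunE !inE (alternatingS _ fA) heE odd_double /=.
  rewrite -f0 -fm !(inj_eq fi) -!val_eqE /= heE andbT.
  by have := ltn_ord a; lia.
apply/injectiveP => a b; rewrite !ffunE => /fi /(congr1 val) /=; rewrite !heE.
by move=> e; apply: val_inj => /=; lia.
Qed.
End Representatives.

Section Extremal.
Variables (k t r' : nat) (E0 : {set 'I_k.+1 * 'I_k.+1}).
Hypotheses (E0lt : forall p, p \in E0 -> (p.1 < p.2)%N) (rk : (r' <= k.+1)%N).

(* The vertices [inr w] with [w < t] are joined to all of 'I_k.+1, and [inr t]
   only to the first [r'] of them, which adjusts the number of edges. *)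
Definition extremal_adj (x y : 'I_k.+1 + 'I_t.+1) : bool :=
  match x, y with
  | inl a, inl b => (a != b) && (((a, b) \in E0) || ((b, a) \in E0))
  | inl a, inr w | inr w, inl a => (w < t)%N || (a < r')%N
  | inr _, inr _ => false
  end.

Lemma extremal_adj_sym : symmetric extremal_adj.
Proof. by move=> [a|w] [b|z] //=; rewrite eq_sym orbC. Qed.

Lemma extremal_adj_irrefl : irreflexive extremal_adj.
Proof. by move=> [a|w] //=; rewrite eqxx. Qed.

Definition extremal_graph : sgraph := SGraph extremal_adj_sym extremal_adj_irrefl.

Lemma inner_adj a b :
  extremal_adj (inl a) (inl b) = (((a, b) \in E0) + ((b, a) \in E0))%N :> nat.
Proof.
rewrite /=; case h1: ((a, b) \in E0); case h2: ((b, a) \in E0); rewrite ?andbF //=.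
- by have := E0lt h1; have := E0lt h2 => /=; lia.
- by have := E0lt h1 => /=; rewrite -val_eqE /=; case: ltngtP.
- by have := E0lt h2 => /=; rewrite -val_eqE /=; case: ltngtP.
Qed.

Lemma inner_adj_sum :
  (\sum_(a : 'I_k.+1) \sum_(b : 'I_k.+1) extremal_adj (inl a) (inl b) = 2 * #|E0|)%N.
Proof.
have h : (\sum_(a : 'I_k.+1) \sum_(b : 'I_k.+1) ((a, b) \in E0) = #|E0|)%N.
  rewrite pair_big /= -sum1_card [RHS]big_mkcond; apply: eq_bigr => -[a b] _ /=.
  by case: (_ \in _).
transitivity (\sum_(a : 'I_k.+1) ((\sum_(b : 'I_k.+1) ((a, b) \in E0)) +
    (\sum_(b : 'I_k.+1) ((b, a) \in E0))))%N.
  by apply: eq_bigr => a _; rewrite -big_split; apply: eq_bigr => b _; exact: inner_adj.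
by rewrite big_split /= h [X in (_ + X)%N]exchange_big /= h mul2n addnn.
Qed.

Lemma cross_adj_sum :
  (\sum_(a : 'I_k.+1) \sum_(w : 'I_t.+1) extremal_adj (inl a) (inr w) = k.+1 * t + r')%N.
Proof.
rewrite exchange_big big_ord_recr /=; congr (_ + _)%N.
  rewrite (eq_bigr (fun => k.+1)) => [|w _].
    by rewrite sum_nat_const card_ord mulnC.
  by rewrite (eq_bigr (fun => 1%N)) ?sum_nat_const ?card_ord ?muln1 // => a _; rewrite ltn_ord.
rewrite (eq_bigr (fun a : 'I_k.+1 => (a < r')%N : nat)) => [|a _]; last by rewrite ltnn.
rewrite -(big_mkord xpredT (fun a => (a < r')%N : nat)) (@big_cat_nat _ _ _ r') //=.
rewrite (eq_big_nat _ _ (F2 := fun => 1%N)) => [|i /andP[_ ->] //].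
rewrite sum_nat_const_nat subn0 muln1 big_nat_cond big1 ?addn0 // => i.
by rewrite andbT => /andP[h _]; rewrite ltnNge h.
Qed.

Lemma extremal_edges : nb_edges extremal_graph = (#|E0| + k.+1 * t + r')%N.
Proof.
apply: double_inj; rewrite -deg_sum /deg big_sumType /=.
under eq_bigr => a _ do rewrite big_sumType.
under [X in (_ + X)%N]eq_bigr => w _ do rewrite big_sumType /= big1_eq addn0.
rewrite big_split /= inner_adj_sum cross_adj_sum exchange_big /=.
by rewrite cross_adj_sum -muln2; lia.
Qed.

(** The test vector [f] is the Perron vector of the complete bipartite graph with parts of sizes k +
    1 and t, extended by 0 to the last outer vertex. *)
Lemma extremal_rho (R : realType) : (0 < t)%N ->
  #|E0|%:R / k.+1%:R + Num.sqrt (k.+1%:R * t%:R) <= rho R extremal_graph.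
Proof.
move=> t0; have sp := graph_spectrum R extremal_graph.
pose al : R := Num.sqrt t%:R; pose be : R := Num.sqrt k.+1%:R.
pose f (x : extremal_graph) : R :=
  match x with inl _ => al | inr w => if (w < t)%N then be else 0 end.
have al2 : al ^+ 2 = t%:R by rewrite sqr_sqrtr.
have be2 : be ^+ 2 = k.+1%:R by rewrite sqr_sqrtr.
have tR : 0 < t%:R :> R by rewrite ltr0n.
have kR : 0 < k.+1%:R :> R by rewrite ltr0n.
have ab : Num.sqrt (k.+1%:R * t%:R) = be * al by rewrite sqrtrM.
have := rayleigh_le sp f.
have -> : \sum_u f u ^+ 2 = 2 * (k.+1%:R * t%:R).
  rewrite big_sumType /= sumr_const card_ord al2 big_ord_recr /= ltnn expr0n addr0.
  under eq_bigr => w _ do rewrite ltn_ord be2.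
  by rewrite sumr_const card_ord -[X in X + _]mulr_natl -[X in _ + X]mulr_natl; ring.
have -> : \sum_(u : extremal_graph) \sum_(v : extremal_graph) (adj u v)%:R * (f u * f v) =
    2 * (#|E0|%:R * t%:R) + 2 * (k.+1%:R * t%:R * (be * al)).
  rewrite big_sumType /=.
  under eq_bigr => a _ do rewrite big_sumType /=.
  under [X in _ + X]eq_bigr => w _ do rewrite big_sumType /=.
  have cross : \sum_(a : 'I_k.+1) \sum_(w : 'I_t.+1)
      ((w < t)%N || (a < r')%N)%:R * (al * (if (w < t)%N then be else 0)) =
      k.+1%:R * t%:R * (be * al).
    rewrite (eq_bigr (fun => t%:R * (be * al))) => [|a _].
      by rewrite sumr_const card_ord -[LHS]mulr_natl mulrA.
    rewrite big_ord_recr /= ltnn !mulr0 addr0.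
    under eq_bigr => w _ do rewrite ltn_ord mul1r.
    by rewrite sumr_const card_ord -[LHS]mulr_natl [al * be]mulrC.
  have inner : \sum_(a : 'I_k.+1) \sum_(b : 'I_k.+1)
      ((a != b) && (((a, b) \in E0) || ((b, a) \in E0)))%:R * (al * al) =
      2 * (#|E0|%:R * t%:R).
    under eq_bigr => a _ do rewrite -mulr_suml.
    rewrite -mulr_suml -expr2 al2.
    have := congr1 (fun n : nat => n%:R : R) inner_adj_sum.
    rewrite natr_sum; under eq_bigr => a _ do rewrite natr_sum.
    by move=> ->; rewrite natrM mulrA.
  rewrite big_split /= inner cross.
  have -> : \sum_(w : 'I_t.+1) (\sum_(a : 'I_k.+1)
      ((w < t)%N || (a < r')%N)%:R * ((if (w < t)%N then be else 0) * al) +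
      \sum_(z : 'I_t.+1) false%:R * ((if (w < t)%N then be else 0) *
        (if (z < t)%N then be else 0))) = k.+1%:R * t%:R * (be * al).
    rewrite -cross exchange_big /=; apply: eq_bigr => w _.
    rewrite [X in _ + X]big1 ?addr0 => [|z _]; last by rewrite mul0r.
    by apply: eq_bigr => a _; rewrite [al * _]mulrC.
  by ring.
rewrite ab => h.
have p : 0 < 2 * (k.+1%:R * t%:R) :> R by rewrite !mulr_gt0.
rewrite -(ler_pM2r p); apply: le_trans h; rewrite le_eqVlt; apply/orP; left; apply/eqP.
by move: kR; clear; move: (k.+1%:R : R) => K K0; field; rewrite gt_eqF.
Qed.

Definition inner_vertices : {set extremal_graph} :=
  [set x : extremal_graph | if x is inl _ then true else false]%SET.

Lemma inner_card : #|inner_vertices| = k.+1.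
Proof.
rewrite -sum1_card big_mkcond big_sumType /= [X in (_ + X)%N]big1 ?addn0 => [|w _].
  rewrite (eq_bigr (fun => 1%N)) => [|a _]; last by rewrite inE.
  by rewrite sum1_card card_ord.
by rewrite inE.
Qed.

Lemma outer_card : #|~: inner_vertices|%SET = t.+1.
Proof. by have := cardsC inner_vertices; rewrite inner_card card_sum !card_ord; lia. Qed.

Lemma extremal_copies j : k = j.+2 ->
  (nb_copies (cycle_graph k.*2.+1) extremal_graph <= #|E0| * (k.-1`! * t.+1 ^ k))%N.
Proof.
move=> kj.
pose g (p : 'I_k.+1 * 'I_k.+1) : extremal_graph * extremal_graph := (inl p.1, inl p.2).
have gi : injective g by move=> [a b] [c d] [-> ->].
have indep (u v : extremal_graph) :
    u \notin inner_vertices -> v \notin inner_vertices -> ~~ adj u v.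
  by case: u => [a|w]; case: v => [b|z]; rewrite ?inE.
have edge (u v : extremal_graph) : u \in inner_vertices -> v \in inner_vertices ->
    adj u v -> ((u, v) \in (g @: E0)%SET) || ((v, u) \in (g @: E0)%SET).
  case: u => [a|w]; case: v => [b|z]; rewrite ?inE //= => _ _ /andP[_ /orP[h|h]].
    by apply/orP; left; apply/imsetP; exists (a, b).
  by apply/orP; right; apply/imsetP; exists (b, a).
have iS : #|inner_vertices| = j.+3 by rewrite inner_card kj.
have h1 := nb_copies_le_alternating indep iS edge.
have h2 := alternating_family_le iS (g @: E0)%SET.
have := leq_trans h1 h2.
by rewrite outer_card card_imset // -kj (_ : j.+1 = k.-1) // kj.
Qed.
End Extremal.

(** Any choice of the inner edges will do, as the edge count, the Rayleigh bound and the cycle count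
    depend on their number alone. *)
Lemma increasing_pairs (k q : nat) : (q.*2 <= k.+1 * k)%N ->
  exists2 E0 : {set 'I_k.+1 * 'I_k.+1}, #|E0| = q &
    forall p, p \in E0 -> (p.1 < p.2)%N.
Proof.
move=> hq.
pose P := [set p : 'I_k.+1 * 'I_k.+1 | (p.1 < p.2)%N]%SET.
have cP : #|P| = (\sum_(a < k.+1) \sum_(b < k.+1) (a < b))%N.
  rewrite pair_big /= -sum1_card big_mkcond; apply: eq_bigr => p _.
  by rewrite inE; case: (_ < _)%N.
have hP : (q <= #|P|)%N.
  suff e : (#|P| + #|P| + k.+1 = k.+1 * k.+1)%N by move: hq e; nia.
  have h1 : (\sum_(a < k.+1) 1 = k.+1)%N by rewrite sum_nat_const card_ord muln1.
  have h2 : (\sum_(a < k.+1) \sum_(b < k.+1) 1 = k.+1 * k.+1)%N.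
    by under eq_bigr => a _ do rewrite h1; rewrite sum_nat_const card_ord.
  transitivity (#|P| + #|P| + \sum_(a < k.+1) 1)%N; first by rewrite h1.
  rewrite -h2 {1}cP cP [X in (_ + X + _)%N]exchange_big /= -!big_split /=.
  apply: eq_bigr => a _; rewrite -big_split /= (bigD1 a) //= ltnn add0n addnC.
  rewrite [RHS](bigD1 a) //=; congr (_ + _)%N; apply: eq_bigr => b.
  by rewrite eq_sym -val_eqE /=; case: ltngtP.
exists [set p in take q (enum P)]%SET.
  rewrite cardsE; have /card_uniqP -> : uniq (take q (enum P)).
    exact/take_uniq/enum_uniq.
  by rewrite size_takel // -cardE.
move=> p; rewrite inE => /mem_take; rewrite mem_enum inE; exact.
Qed.

(** * Parameters of the extremal graphs *)

Section UpperBound.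
Variables (R : realType) (k : nat).
Hypothesis k2 : (2 <= k)%N.
Local Notation c := (cycle_constant R k).
Local Notation N G := ((nb_copies (cycle_graph k.*2.+1) G)%:R : R).

Lemma sqrt_shift_ge (x a : R) : 0 < x -> 0 <= a -> a <= x ->
  Num.sqrt x - a / Num.sqrt x <= Num.sqrt (x - a).
Proof.
move=> x0 a0 ax; set r := Num.sqrt x.
have r0 : 0 < r by rewrite sqrtr_gt0.
have rr : r ^+ 2 = x by rewrite sqr_sqrtr // ltW.
have l0 : 0 <= r - a / r by rewrite subr_ge0 ler_pdivrMr // -expr2 rr.
rewrite -(@ler_pXn2r _ 2) ?nnegrE ?sqrtr_ge0 // sqr_sqrtr ?subr_ge0 //.
have -> : (r - a / r) ^+ 2 = r ^+ 2 - a - a * (1 - a / r ^+ 2).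
  by field; rewrite gt_eqF.
rewrite rr gerBl mulr_ge0 // subr_ge0 ler_pdivrMr // mul1r //.
Qed.

Lemma upper_bound (eps : R) : 0 < eps -> exists m0 : nat, forall m, (m0 <= m)%N ->
  exists G : sgraph, [/\ nb_edges G = m, g_bound R k m < rho R G
    & N G <= (c + eps) * m%:R ^+ k].
Proof.
move=> eps0; have c0 := cycle_constant_gt0 R k2.
have [q0 [q0E q0le q0ge]] : exists q0, [/\ uphalf (k ^ 2) = q0,
    (q0.*2 <= k ^ 2 + 1)%N & (k ^ 2 <= q0.*2)%N].
  exists (uphalf (k ^ 2)); split=> //; first exact: uphalf_sq_le.
  by rewrite uphalf_half; have := odd_double_half (k ^ 2); case: odd; lia.
have [E0 cE E0lt] : exists2 E0 : {set 'I_k.+1 * 'I_k.+1}, #|E0| = q0 &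
    forall p, p \in E0 -> (p.1 < p.2)%N.
  by apply: increasing_pairs; move: q0le k2; nia.
(* As the remainder r' is at most k, (k + 1) t >= m - a. *)
pose a : R := (q0 + k)%N%:R.
have k1R : 0 < k.+1%:R :> R by rewrite ltr0n.
have [m0 hm0] := @quartic_root_large R
  (1 + 2 * k.+1%:R * a + k.+1%:R + c * k%:R * 2 ^+ k * k.+1%:R / eps).
exists (maxn m0 (q0 + k.+1)) => m; rewrite geq_max => /andP[/hm0 + hm].
set r : R := Num.sqrt m%:R; set q := Num.sqrt r => hq.
have [t [r' [mE t0 r'k]]] : exists t r',
    [/\ m = (q0 + k.+1 * t + r')%N, (0 < t)%N & (r' <= k)%N].
  exists ((m - q0) %/ k.+1)%N, ((m - q0) %% k.+1)%N; split.
  - rewrite -addnA mulnC -divn_eq subnKC // (leq_trans _ hm) //; exact: leq_addr.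
  - by rewrite divn_gt0 // leq_subRL ?hm // (leq_trans _ hm) // leq_addr.
  - by rewrite -ltnS ltn_mod.
have rk : (r' <= k.+1)%N by exact: leqW.
exists (extremal_graph t r' E0); split.
- by rewrite extremal_edges // cE.
- have rhoge := @extremal_rho k t r' E0 E0lt rk R t0.
  rewrite cE in rhoge; apply: lt_le_trans rhoge.
  have a0 : 0 <= a by exact: ler0n.
  have p1 : 0 <= k.+1%:R * a by rewrite mulr_ge0.
  have p2 : 0 <= c * k%:R * 2 ^+ k * k.+1%:R / eps.
    apply: divr_ge0; last exact: ltW.
    by apply: mulr_ge0 => //; apply: mulr_ge0; [apply: mulr_ge0 => //; exact: ltW|exact: exprn_ge0].
  have [q1 qa] : 1 <= q /\ 2 * k.+1%:R * a < q by split; lra.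
  have r0 : 0 <= r by exact: sqrtr_ge0.
  have rE : r = q ^+ 2 by rewrite sqr_sqrtr.
  have qr : q <= r by rewrite rE expr2 ler_peMl //; lra.
  have rp : 0 < r by lra.
  have rm : r ^+ 2 = m%:R by rewrite sqr_sqrtr.
  have mR : 0 < m%:R :> R by rewrite -rm exprn_gt0.
  have am : a <= m%:R by rewrite /a ler_nat (leq_trans _ hm) // leq_add2l.
  have h1 := sqrt_shift_ge mR a0 am; rewrite -/r in h1.
  have h2 : Num.sqrt (m%:R - a) <= Num.sqrt (k.+1%:R * t%:R).
    apply: ler_wsqrtr; rewrite /a lerBlDr -natrM -natrD ler_nat mE.
    by clear -r'k; lia.
  have h3 : g_bound R k m <= r + (k%:R - 1) / 2.
    rewrite /g_bound ler_pdivrMr //.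
    have : Num.sqrt (4 * m%:R - k%:R ^+ 2 + 1) <= 2 * r.
      have -> : 2 * r = Num.sqrt (2 ^+ 2 * m%:R).
        by rewrite sqrtrM ?sqr_ge0 // sqrtr_sqr ger0_norm.
      apply: ler_wsqrtr.
      have : 1 <= k%:R ^+ 2 :> R by rewrite -natrX ler1n expn_gt0; clear -k2; lia.
      lra.
    lra.
  have h4 : a / r < 1 / (2 * k.+1%:R).
    rewrite ltr_pdivrMr // mulrAC mul1r ltr_pdivlMr ?mulr_gt0 //; lra.
  (* k^2 / (2 (k + 1)) exceeds (k - 1) / 2 by exactly 1 / (2 (k + 1)). This slack pays for the loss
     a / r in passing from sqrt m to sqrt (m - a). *)
  have h5 : (k%:R - 1) / 2 + 1 / (2 * k.+1%:R) <= q0%:R / k.+1%:R :> R.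
    have -> : (k%:R - 1) / 2 + 1 / (2 * k.+1%:R) = (k%:R ^+ 2 / 2) / k.+1%:R :> R.
      move: k1R; rewrite -natr1; clear; move: (k%:R : R) => K K0.
      by field; rewrite gt_eqF.
    apply: ler_wpM2r; first by rewrite invr_ge0.
    rewrite ler_pdivrMr // -natrX -[2]/(2%:R) -natrM ler_nat; clear -q0ge; lia.
  move: h1 h2 h3 h4 h5.
  move: (Num.sqrt (m%:R - a)) (Num.sqrt (k.+1%:R * t%:R)) (g_bound R k m) (a / r)
    (1 / (2 * k.+1%:R)) (q0%:R / k.+1%:R) => y1 y2 y3 y4 y5 y6.
  by clear; lra.
have kj : k = (k - 2).+2 by clear -k2; lia.
have h1 := @extremal_copies k t r' E0 rk (k - 2)%N kj; rewrite cE in h1.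
have p1 : 0 <= k.+1%:R * a by rewrite mulr_ge0.
have h2 : 1 + c * k%:R * 2 ^+ k * k.+1%:R / eps <= q /\ k.+1%:R <= q.
  have p2 : 0 <= c * k%:R * 2 ^+ k * k.+1%:R / eps.
    apply: divr_ge0; last exact: ltW.
    by apply: mulr_ge0 => //; apply: mulr_ge0; [apply: mulr_ge0 => //; exact: ltW|exact: exprn_ge0].
  by split; lra.
have [q1 kq] := h2.
have p2 : 0 <= c * k%:R * 2 ^+ k * k.+1%:R / eps.
  apply: divr_ge0; last exact: ltW.
  by apply: mulr_ge0 => //; apply: mulr_ge0; [apply: mulr_ge0 => //; exact: ltW|exact: exprn_ge0].
have q1' : 1 <= q by lra.
have r0 : 0 <= r by exact: sqrtr_ge0.
have rE : r = q ^+ 2 by rewrite sqr_sqrtr.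
have rm : r ^+ 2 = m%:R by rewrite sqr_sqrtr.
have qm : q <= m%:R.
  have qr : q <= r by rewrite rE expr2 ler_peMl //; lra.
  by rewrite (le_trans qr) // -rm expr2 ler_peMl //; lra.
have mR : 0 < m%:R :> R by lra.
(* There are t + 1 outer vertices, the partially joined one included, and (k + 1)(t + 1) <= m + k +
   1 = m (1 + x). *)
pose x : R := k.+1%:R / m%:R.
have x0 : 0 <= x by rewrite divr_ge0.
have x1 : x <= 1 by rewrite ler_pdivrMr // mul1r (le_trans kq).
have tk : t.+1%:R * k.+1%:R <= m%:R * (1 + x) :> R.
  have -> : m%:R * (1 + x) = (m + k.+1)%N%:R by rewrite /x natrD; field; rewrite gt_eqF.
  by rewrite -natrM ler_nat mE; clear; lia.
apply: le_trans (_ : q0%:R * (k.-1)`!%:R * t.+1%:R ^+ k <= _).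
  by rewrite -natrX -!natrM ler_nat -mulnA.
have kk : 0 < k.+1%:R ^+ k :> R by exact: exprn_gt0.
have cE' : q0%:R * (k.-1)`!%:R = c * k.+1%:R ^+ k :> R.
  by rewrite /cycle_constant q0E divfK // gt_eqF.
rewrite cE' -mulrA -exprMn [k.+1%:R * _]mulrC.
have h3 : (t.+1%:R * k.+1%:R) ^+ k <= m%:R ^+ k * (1 + x) ^+ k :> R.
  rewrite -exprMn; apply: lerXn2r; rewrite ?nnegrE ?mulr_ge0 //.
  by rewrite addr_ge0.
have kS : k = k.-1.+1 by clear -k2; lia.
have h4 : (1 + x) ^+ k <= 1 + k%:R * x * 2 ^+ k.
  have := @power_sub_le R (1 + x) 1 k.-1 ler01; rewrite lerDl => /(_ x0).
  rewrite -kS expr1n => h; rewrite -lerBlDl; apply: le_trans h _.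
  have -> : 1 + x - 1 = x by ring.
  apply: ler_wpM2l; first by rewrite mulr_ge0.
  apply: le_trans (_ : 2 ^+ k.-1 <= _).
    by apply: lerXn2r; rewrite ?nnegrE //; lra.
  by rewrite ler_weXn2l ?ler1n ?leq_pred.
have h5 : c * (k%:R * x * 2 ^+ k) <= eps.
  have -> : c * (k%:R * x * 2 ^+ k) = c * k%:R * 2 ^+ k * k.+1%:R / m%:R by rewrite /x; ring.
  rewrite ler_pdivrMr // [X in _ <= X]mulrC -ler_pdivrMr //.
  by apply: le_trans qm; apply: le_trans q1; rewrite lerDr.
have Mk : 0 <= m%:R ^+ k :> R by exact: exprn_ge0.
have h6 := ler_wpM2l (ltW c0) h3.
have h7 := ler_wpM2l (ltW c0) (ler_wpM2l Mk h4).
have h8 := ler_wpM2l Mk h5.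
lra.
Qed.
End UpperBound.

Local Open Scope classical_set_scope.
Local Open Scope ring_scope.

Theorem theorem1p1 (R : realType) (k : nat) (hk : (2 <= k)%N) :
  [/\ inf_density R k m @[m --> \oo] --> (cycle_constant R k)%:E,
      asymptotic_lower_bound k (cycle_constant R k)
    & forall c : R, cycle_constant R k < c -> ~ asymptotic_lower_bound k c].
Proof.
have LB := @lower_bound R k hk; split => //.
- have bounds (e : R) : 0 < e -> \forall m \near \oo,
      ((cycle_constant R k - e)%:E <= inf_density R k m <= (cycle_constant R k + e)%:E)%E.
    move=> e0; have [m1 h1] := LB e e0; have [m2 h2] := @upper_bound R k hk _ e0.
    exists (maxn 1 (maxn m1 m2)) => // m /=; rewrite !geq_max => /and3P[m0 hm1 hm2].
    have mk : 0 < m%:R ^+ k :> R by rewrite exprn_gt0 // ltr0n.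
    apply/andP; split.
      apply: le_ereal_inf_tmp => x [G [Gm Gr ->]].
      by rewrite lee_fin ler_pdivlMr //; exact: h1.
    have [G [Gm Gr GN]] := h2 m hm2.
    apply: le_trans (_ : ((nb_copies (cycle_graph k.*2.+1) G)%:R / m%:R ^+ k)%:E <= _)%E.
      by apply: ereal_inf_lbound; exists G.
    by rewrite lee_fin ler_pdivrMr.
  (* The two-sided bounds make the infimum finite for large m, so that convergence can be checked on
     real values. *)
  apply/fine_cvgP; split.
    by apply: filterS (bounds 1 ltr01) => m /andP[]; case: (inf_density R k m).
  apply/cvgrPdist_le => e e0; apply: filterS (bounds e e0) => m /=.
  case: (inf_density R k m) => [x||] //=; rewrite ?lee_fin.
    by move=> h; rewrite distrC ler_distl.
  by rewrite leye_eq andbF.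
(* A third of the gap: lowering the supposed bound and raising the extremal count by [e] each still
   leaves a contradiction. *)
- move=> c ck h; pose e := (c - cycle_constant R k) / 3.
  have e0 : 0 < e by rewrite divr_gt0 // subr_gt0.
  have [m1 h1] := h e e0; have [m2 h2] := @upper_bound R k hk _ e0.
  pose m := maxn 1 (maxn m1 m2).
  have [G [Gm Gr GN]] := h2 m (leq_trans (leq_maxr m1 m2) (leq_maxr _ _)).
  have := le_trans (h1 m G (leq_trans (leq_maxl m1 m2) (leq_maxr _ _)) Gm Gr) GN.
  rewrite ler_pM2r ?exprn_gt0 ?ltr0n ?leq_max //.
  by apply/negP; rewrite -ltNge /e; move: ck; clear; lra.
Qed.
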